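(* Let $\mu$ be a free regular infinitely divisible probability measure, with Voiculescu transform $$\phi_{\mu}(z)=\gamma+\int_{\mathbb{R}^+}\frac{1+tz}{z-t}\,d\sigma(t),\qquad z\in\mathbb{C}^+,$$ where $\gamma\in\mathbb{R}$ and $\sigma$ is a finite measure. Assume that either $\mu$ or $\sigma$ is concentrated on $[0,\infty)$. Let $\alpha\ge 0$. Then the following statements are equivalent: (1) $\mu$ has regularly varying tail of index $-\alpha$; (2) $\sigma$ has regularly varying tail of index $-\alpha$. If $\mu$ or $\sigma$ has regularly varying tail of index $-\alpha$, then $\mu(x,\infty)\sim\sigma(x,\infty)$ as $x\to\infty$.
   Context: Notation: $\mathbb{R}^+=[0,\infty)$, $\mathbb{C}^+$ and $\mathbb{C}^-$ are the open upper and lower half-planes. Regular variation: a measurable $f$ on $[0,\infty)$ (positive for large arguments) is regularly varying (at infinity) of index $\beta$ if $f(tx)/f(x)\to t^{\beta}$ as $x\to\infty$ for every $t>0$. A measure $\lambda$ has regularly varying tail of index $-\alpha$ if $x\mapsto\lambda(x,\infty)$ is regularly varying of index $-\alpha$. $f\sim g$ means $f/g\to1$. Transforms: for a probability measure $\mu$ on $\mathbb{R}$, $G_\mu(z)=\int\frac{1}{z-t}d\mu(t)$ and $F_\mu=1/G_\mu$ on $\mathbb{C}^+$. The Voiculescu transform is $\phi_\mu(z)=F_\mu^{-1}(z)-z$, defined on a truncated cone $\{z\in\mathbb{C}^+:|\Re z|<\eta\,\Im z,\ |z|>M\}$ where $F_\mu^{-1}$ is defined, and the free cumulant transform is $C_\mu(z)=z\phi_\mu(1/z)$.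 Free additive convolution $\boxplus$ is characterized by $\phi_{\mu_1\boxplus\mu_2}=\phi_{\mu_1}+\phi_{\mu_2}$. $\mu$ is free infinitely divisible if for each $n$ it is the $n$-fold $\boxplus$-power of some probability measure; then $\phi_\mu$ extends to $\mathbb{C}^+$ as $\phi_\mu(z)=\gamma+\int_{\mathbb{R}}\frac{1+tz}{z-t}d\sigma(t)$ with $\gamma\in\mathbb{R}$ and $\sigma$ a finite measure, both unique. Free regular: $\mu$ is free regular infinitely divisible if $$C_\mu(z)=\eta' z+\int_{\mathbb{R}^+}\Big(\frac{1}{1-zt}-1\Big)d\nu(t),\quad z\in\mathbb{C}^-,$$ with $\eta'\ge0$ and $\nu$ a L\'evy measure with $\nu((-\infty,0])=0$ and $\int\min(1,t)\,d\nu(t)<\infty$. In this case $d\sigma(t)=\frac{t^2}{1+t^2}d\nu(t)$ and $\gamma=\eta'+\int_{\mathbb{R}^+}\frac{t}{1+t^2}d\nu(t)$. *)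

(* Defs.v *)
From HB Require Import structures.
From mathcomp Require Import all_boot all_order all_algebra.
From mathcomp Require Import all_classical all_reals all_analysis.
From mathcomp Require Import complex.

Set Implicit Arguments.
Unset Strict Implicit.
Unset Printing Implicit Defensive.

Import Order.TTheory GRing.Theory Num.Theory.
Import numFieldNormedType.Exports.

Local Open Scope classical_set_scope.
Local Open Scope ring_scope.
Local Open Scope complex_scope.

Definition Rnonneg (R : realType) : set R := `[0, +oo[%classic.

Definition regularly_varying (R : realType) (f : R -> R) (beta : R) : Prop :=
  [/\ measurable_fun (@Rnonneg R) f,
      \forall x \near +oo, 0 < f x
    & forall t : R, 0 < t -> f (t * x) / f x @[x --> +oo] --> t `^ beta].

Definition asymp_equiv (R : realType) (f g : R -> R) : Prop :=
  f x / g x @[x --> +oo] --> (1 : R).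

Definition tail (R : realType)
    (lambda : {finite_measure set (measurableTypeR R) -> \bar R}) (x : R) : R :=
  fine (lambda (`]x, +oo[%classic : set R)).

Definition regularly_varying_tail (R : realType)
    (lambda : {finite_measure set (measurableTypeR R) -> \bar R})
    (beta : R) : Prop :=
  regularly_varying (tail lambda) beta.

Definition concentrated_on_nonneg (R : realType)
    (lambda : {measure set (measurableTypeR R) -> \bar R}) : Prop :=
  lambda (`]-oo, 0[%classic : set R) = 0%E.

Definition upper_half (R : realType) : set R[i] :=
  [set z | 0 < complex.Im z].

Definition lower_half (R : realType) : set R[i] := [set z | complex.Im z < 0].

Definition truncated_cone (R : realType) (eta M : R) : set R[i] :=
  [set z | [/\ 0 < complex.Im z, `|complex.Re z| < eta * complex.Im z
             & M%:C < `|z|]].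

(* [Rintegral] is 0 on non-integrable functions; every integrand used below is
   integrable for the measure it is integrated against. *)
Definition cintegral (R : realType)
    (lambda : {measure set (measurableTypeR R) -> \bar R})
    (D : set R) (f : R -> R[i]) : R[i] :=
  (Rintegral lambda D (fun t => complex.Re (f t)))
    +i* (Rintegral lambda D (fun t => complex.Im (f t))).

Definition G_transform (R : realType)
    (mu : probability (measurableTypeR R) R) (z : R[i]) : R[i] :=
  cintegral mu setT (fun t => 1 / (z - t%:C)).

Definition F_transform (R : realType)
    (mu : probability (measurableTypeR R) R) (z : R[i]) : R[i] :=
  1 / G_transform mu z.

(* [R[i]^o] carries the normed structure of the field [R[i]] over itself, so
   this is complex differentiability at every point of [D]. *)
Definition holomorphic_on (R : realType) (D : set R[i]) (phi : R[i] -> R[i]) :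
    Prop :=
  forall z : R[i], D z -> derivable (phi : R[i]^o -> R[i]^o) z 1.

(* [F_mu] need not be injective on the whole half-plane: [F_mu^-1] is the
   inverse of the restriction of [F_mu] to a truncated cone on which it is
   injective, and it is defined on a truncated cone contained in the image.
   Two choices of cones give inverses that agree on a smaller cone, so the
   extension of [F_mu^-1(z) - z] to the half-plane does not depend on them. *)
Definition voiculescu_transform (R : realType)
    (mu : probability (measurableTypeR R) R) (phi : R[i] -> R[i]) : Prop :=
  holomorphic_on (@upper_half R) phi /\
  exists eta M eta' M' : R,
    [/\ [/\ 0 < eta, 0 < M, 0 < eta' & 0 < M'],
        set_inj (truncated_cone eta M) (F_transform mu)
      & forall z : R[i], truncated_cone eta' M' z ->
          truncated_cone eta M (z + phi z) /\ F_transform mu (z + phi z) = z].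

Definition free_cumulant_transform (R : realType)
    (mu : probability (measurableTypeR R) R) (C : R[i] -> R[i]) : Prop :=
  exists2 phi : R[i] -> R[i], voiculescu_transform mu phi &
    forall z : R[i], lower_half z -> C z = z * phi (1 / z).

Definition levy_measure (R : realType)
    (nu : {measure set (measurableTypeR R) -> \bar R}) : Prop :=
  nu [set 0 : R] = 0%E /\
  (\int[nu]_t (Num.min 1 (t ^+ 2))%:E < +oo)%E.

Definition free_regular (R : realType)
    (mu : probability (measurableTypeR R) R) : Prop :=
  exists (eta : R) (nu : {measure set (measurableTypeR R) -> \bar R})
         (C : R[i] -> R[i]),
    [/\ 0 <= eta,
        [/\ levy_measure nu, nu (`]-oo, 0]%classic : set R) = 0%E
          & (\int[nu]_(t in (@Rnonneg R))
               (Num.min 1 t)%:E < +oo)%E],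
        free_cumulant_transform mu C
      & forall z : R[i], lower_half z ->
          C z = eta%:C * z +
            cintegral nu (@Rnonneg R) (fun t => 1 / (1 - z * t%:C) - 1)].

(* Main.v *)
(** For a measure [l] put [g_l(w) = \int t / (w - t) dl(t)]. Inverting
[F_mu(w) = w / (1 + g_mu(w))] gives [phi(w) / w = g_mu(w + phi(w))], while the
integral representation of [phi] gives [phi(w) / w = g_sigma(w)] up to a
polynomial in [1 / w] and terms of lower order. Let [T] be the regularly varying
tail, of [l = mu] or [l = sigma]. Expanding [g_l] to the right order in [1 / w]
leaves a remainder of size [E] with [E ^ 2 = o(T)] and [E / y = o(T)] at
[w = i y], so that solving the functional equation by iteration yields
[phi(i y) / (i y) - g_mu(i y) = Q(1 / (i y)) + o(T(y))] with a real polynomial [Q],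
[Q(0) = 0]. With [xi = t ^ 2 / (t ^ 2 + y ^ 2)] the real part compares the
integrals of [xi] against [mu] and [sigma] modulo a polynomial in [y ^ -2].
Divided differences in the scale [y] remove the polynomial and produce powers of
[xi]: for all large [k], the [k]-th moments of [xi] under [mu] and [sigma] differ by
[o(T)]. Squeezing an indicator between polynomials in [xi] turns this into
equivalence of the tails.

All this uses that [mu] lives on the half-line, which is a consequence of free
regularity: the Gram matrix of [t dmu] at points of the imaginary axis is the
entrywise product of positive semidefinite matrices, and rational functions that
grow on the negative half-line and stay bounded on the positive one then exclude
negative mass. *)
Require Import Defs.
From mathcomp Require Import all_boot all_order all_algebra.
From mathcomp Require Import all_classical all_reals all_analysis.
From mathcomp Require Import complex measurable_realfun.
From mathcomp Require Import zify ring lra.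

Set Implicit Arguments.
Unset Strict Implicit.
Unset Printing Implicit Defensive.

Import Order.TTheory GRing.Theory Num.Theory.
Import numFieldNormedType.Exports.

Local Open Scope classical_set_scope.
Local Open Scope ring_scope.
Local Open Scope complex_scope.

Local Notation nc := ComplexField.Normc.normc.
Local Notation Re := complex.Re.
Local Notation Im := complex.Im.

(** * Complex modulus and complex-valued integrals *)

Section ComplexModulus.
Variable R : realType.
Implicit Types (x y z : R[i]) (a b : R).

(** The remainder of size [E] can never be dropped: [E] is [gauge l p y], which is at least [T y].
    It is carried along exactly instead. The solution of the functional equation contains the same
    remainder, taken at [i y], as the transform that is expanded; it cancels in
    [phi(i y) / (i y) - g_mu(i y)], and only products such as [E ^ 2] and [E / y] are discarded. Nor
    can the polynomial be estimated away: for [alpha > 2] the integral of [xi] is typically of order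
    [y ^ -2], much larger than [T]. A power [xi ^ k] with [k > alpha] barely sees the bulk of the
    measure, and its integral is [O(T)]; thus integer and noninteger [alpha] are treated alike,
    whatever the first infinite moment. These powers would come from divided differences at a
    multiple node. Distinct nodes clustered at [1] replace it, so that only finite sums of integrals
    at different scales occur. Since low powers of [xi] stay out of reach, the polynomials of the
    final squeeze have to be divisible by a high power of [xi]. *)

Lemma nc_ge0 z : 0 <= nc z.
Proof. by case: z => a b; rewrite sqrtr_ge0. Qed.

Lemma nc_real a : nc a%:C = `|a|.
Proof. by rewrite /= expr0n addr0 sqrtr_sqr. Qed.

Lemma ncN z : nc (- z) = nc z.
Proof. by case: z => a b; rewrite /= !sqrrN. Qed.

Lemma ncD x y : nc (x + y) <= nc x + nc y.
Proof. exact: le_normcD. Qed.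

Lemma ncBC x y : nc (x - y) = nc (y - x).
Proof. by rewrite -ncN opprB. Qed.

Lemma ncB x y : nc x - nc y <= nc (x - y).
Proof. by have := ncD (x - y) y; rewrite subrK; lra. Qed.

Lemma ncBD x y : nc (x - y) <= nc x + nc y.
Proof. by have := ncD x (- y); rewrite ncN. Qed.

Lemma ncM x y : nc (x * y) = nc x * nc y.
Proof. exact: ComplexField.Normc.normcM. Qed.

Lemma ncV x : nc x^-1 = (nc x)^-1.
Proof. exact: ComplexField.Normc.normcV. Qed.

Lemma ncX z n : nc (z ^+ n) = nc z ^+ n.
Proof.
elim: n => [|n IH]; first by rewrite !expr0 (nc_real 1) normr1.
by rewrite !exprS ncM IH.
Qed.

Lemma nc0 : nc 0 = 0 :> R.
Proof. by rewrite (nc_real 0) normr0. Qed.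

Lemma nc1 : nc 1 = 1 :> R.
Proof. by rewrite (nc_real 1) normr1. Qed.

Lemma nc_gt0 z : z != 0 -> 0 < nc z.
Proof.
move=> z0; rewrite lt_neqAle nc_ge0 andbT eq_sym.
by apply: contraNneq z0 => /ComplexField.Normc.eq0_normc ->.
Qed.

Lemma nc_neq0 z : 0 < nc z -> z != 0.
Proof. by apply: contraTneq => ->; rewrite nc0 ltxx. Qed.

Lemma nc_sqr z : nc z ^+ 2 = Re z ^+ 2 + Im z ^+ 2.
Proof. by case: z => a b; rewrite /= sqr_sqrtr// addr_ge0 ?sqr_ge0. Qed.

Lemma nc_normr z : `|z| = (nc z)%:C.
Proof. by case: z. Qed.

Lemma Re_nc z : `|Re z| <= nc z.
Proof.
by rewrite -ler_sqr ?nnegrE ?nc_ge0// real_normK ?num_real// nc_sqr lerDl sqr_ge0.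
Qed.

Lemma Im_nc z : `|Im z| <= nc z.
Proof.
by rewrite -ler_sqr ?nnegrE ?nc_ge0// real_normK ?num_real// nc_sqr lerDr sqr_ge0.
Qed.

Lemma nc_le z : nc z <= `|Re z| + `|Im z|.
Proof.
rewrite -ler_sqr ?nnegrE ?nc_ge0 ?addr_ge0//.
rewrite nc_sqr sqrrD !real_normK ?num_real//.
by rewrite addrAC lerDl mulrn_wge0// mulr_ge0.
Qed.

Lemma nc_conj z : nc z^* = nc z.
Proof. by case: z => a b /=; rewrite sqrrN. Qed.

Lemma ReD x y : Re (x + y) = Re x + Re y.
Proof. by case: x y => [a b] [c d]. Qed.

Lemma ImD x y : Im (x + y) = Im x + Im y.
Proof. by case: x y => [a b] [c d]. Qed.

Lemma ReN x : Re (- x) = - Re x.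
Proof. by case: x. Qed.

Lemma ImN x : Im (- x) = - Im x.
Proof. by case: x. Qed.

Lemma Re_mulc x y : Re (x * y) = Re x * Re y - Im x * Im y.
Proof. by case: x y => [a b] [c d]. Qed.

Lemma Im_mulc x y : Im (x * y) = Re x * Im y + Im x * Re y.
Proof. by case: x y => [a b] [c d]. Qed.

Lemma ReV x : Re x^-1 = Re x / nc x ^+ 2.
Proof. by rewrite nc_sqr; case: x => [a b]. Qed.

Lemma ImV x : Im x^-1 = - Im x / nc x ^+ 2.
Proof. by rewrite nc_sqr; case: x => [a b] /=; rewrite mulNr. Qed.

Lemma ReC x : Re x^* = Re x.
Proof. by case: x. Qed.

Lemma ImC x : Im x^* = - Im x.
Proof. by case: x. Qed.

Lemma complex_eq x y : Re x = Re y -> Im x = Im y -> x = y.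
Proof. by case: x y => [a b] [c d] /= -> ->. Qed.

Lemma Im_neq0 z : Im z != 0 -> z != 0.
Proof. by apply: contraNneq => ->. Qed.

End ComplexModulus.

Section ComplexIntegral.
Variable R : realType.
Local Notation T := (measurableTypeR R).
Implicit Types (f g : R -> R[i]).

Definition cmeas f := measurable_fun [set: T] (fun t => Re (f t)) /\
  measurable_fun [set: T] (fun t => Im (f t)).

Lemma cmeas_cst c : cmeas (fun=> c).
Proof. by split; exact: measurable_cst. Qed.

Lemma cmeas_id : cmeas (fun t => t%:C).
Proof. by split => //=; exact: measurable_cst. Qed.

Lemma cmeasD f g : cmeas f -> cmeas g -> cmeas (fun t => f t + g t).
Proof.
move=> [f1 f2] [g1 g2]; split.
  by under eq_fun do rewrite ReD; exact: measurable_funD.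
by under eq_fun do rewrite ImD; exact: measurable_funD.
Qed.

Lemma cmeasN f : cmeas f -> cmeas (fun t => - f t).
Proof.
move=> [f1 f2]; split.
  by under eq_fun do rewrite ReN; exact: measurable_funN.
by under eq_fun do rewrite ImN; exact: measurable_funN.
Qed.

Lemma cmeasB f g : cmeas f -> cmeas g -> cmeas (fun t => f t - g t).
Proof. by move=> mf mg; apply: cmeasD => //; exact: cmeasN. Qed.

Lemma cmeasM f g : cmeas f -> cmeas g -> cmeas (fun t => f t * g t).
Proof.
move=> [f1 f2] [g1 g2]; split.
  by under eq_fun do rewrite Re_mulc; apply: measurable_funB; exact: measurable_funM.
by under eq_fun do rewrite Im_mulc; apply: measurable_funD; exact: measurable_funM.
Qed.

Lemma cmeasX f n : cmeas f -> cmeas (fun t => f t ^+ n).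
Proof.
move=> mf; elim: n => [|n IH]; first by under eq_fun do rewrite expr0; exact: cmeas_cst.
by under eq_fun do rewrite exprS; exact: cmeasM.
Qed.

Lemma measurable_fun_inv_ge0 (f : R -> R) : (forall t, 0 <= f t) ->
  measurable_fun [set: T] f -> measurable_fun [set: T] (fun t => (f t)^-1).
Proof.
move=> f0 mf; under eq_fun do rewrite -powR_inv1//.
exact: (measurableT_comp (measurable_powR _)).
Qed.

Lemma measurable_nc f : cmeas f -> measurable_fun [set: T] (fun t => nc (f t)).
Proof.
move=> [f1 f2].
suff -> : (fun t => nc (f t)) = (fun t => (Re (f t) ^+ 2 + Im (f t) ^+ 2) `^ (2^-1)).
  apply: (measurableT_comp (measurable_powR _)).
  by apply: measurable_funD; exact: measurable_funX.
apply/funext => t; rewrite powR12_sqrt ?addr_ge0 ?sqr_ge0//.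
by case: (f t).
Qed.

Lemma cmeasV f : cmeas f -> cmeas (fun t => (f t)^-1).
Proof.
move=> mf; have mn := measurable_nc mf; case: mf => f1 f2.
have mi : measurable_fun [set: T] (fun t => (nc (f t) ^+ 2)^-1).
  apply: measurable_fun_inv_ge0 => [t|]; first exact: sqr_ge0.
  exact: measurable_funX.
split.
  by under eq_fun do rewrite ReV; exact: measurable_funM.
under eq_fun do rewrite ImV; apply: measurable_funM => //; exact: measurable_funN.
Qed.

Lemma cmeas_conj f : cmeas f -> cmeas (fun t => (f t)^*).
Proof.
move=> [f1 f2]; split; first by under eq_fun do rewrite ReC.
by under eq_fun do rewrite ImC; exact: measurable_funN.
Qed.

Variables (l : {measure set T -> \bar R}) (D : set R).
Hypothesis mD : measurable (D : set T).

Definition cintegrable f := l.-integrable D (EFin \o (fun t => Re (f t))) /\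
  l.-integrable D (EFin \o (fun t => Im (f t))).

Lemma measurable_EFin_comp (f : R -> R) : measurable_fun [set: T] f ->
  measurable_fun (D : set T) (EFin \o f).
Proof. by move=> mf; apply/measurable_EFinP; exact: measurable_funTS. Qed.

Lemma Rintegrable_le (f B : R -> R) : measurable_fun [set: T] f ->
  l.-integrable D (EFin \o B) -> (forall t, D t -> `|f t| <= B t) ->
  l.-integrable D (EFin \o f).
Proof.
move=> mf iB fB; apply: le_integrable iB => //; first exact: measurable_EFin_comp.
by move=> t Dt; rewrite /= lee_fin (le_trans (fB t Dt))// ler_norm.
Qed.

Lemma cintegrable_le f (B : R -> R) : cmeas f -> l.-integrable D (EFin \o B) ->
  (forall t, D t -> nc (f t) <= B t) -> cintegrable f.
Proof.
move=> [f1 f2] iB fB; split; apply: Rintegrable_le iB _ => // t Dt.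
  exact: le_trans (Re_nc _) (fB t Dt).
exact: le_trans (Im_nc _) (fB t Dt).
Qed.

Lemma nc_cintegral_le f (B : R -> R) : cmeas f -> l.-integrable D (EFin \o B) ->
  (forall t, D t -> nc (f t) <= B t) ->
  nc (cintegral l D f) <= 2 * \int[l]_(t in D) B t.
Proof.
move=> mf iB fB; have [i1 i2] := cintegrable_le mf iB fB.
have le1 (g : R -> R) : l.-integrable D (EFin \o g) ->
    (forall t, D t -> `|g t| <= B t) ->
    `| \int[l]_(t in D) g t | <= \int[l]_(t in D) B t.
  move=> ig gB; apply: le_trans (le_normr_Rintegral mD ig) _.
  apply: le_Rintegral => //; exact: integrable_norm.
apply: le_trans (nc_le _) _; rewrite mulr2n mulrDl mul1r.
apply: lerD; apply: le1 => // t Dt.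
  exact: le_trans (Re_nc _) (fB t Dt).
exact: le_trans (Im_nc _) (fB t Dt).
Qed.

Lemma eq_cintegral f g : (forall t, D t -> f t = g t) ->
  cintegral l D f = cintegral l D g.
Proof.
move=> fg; rewrite /cintegral; congr (_ +i* _); apply: eq_Rintegral => t;
  by rewrite inE => Dt; rewrite fg.
Qed.

Lemma cintegralD f g : cintegrable f -> cintegrable g ->
  cintegral l D (fun t => f t + g t) = cintegral l D f + cintegral l D g.
Proof.
move=> [f1 f2] [g1 g2]; apply: complex_eq.
  by rewrite ReD /=; under eq_Rintegral do rewrite ReD; rewrite RintegralD.
by rewrite ImD /=; under eq_Rintegral do rewrite ImD; rewrite RintegralD.
Qed.

Lemma cintegrableD f g : cintegrable f -> cintegrable g ->
  cintegrable (fun t => f t + g t).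
Proof.
move=> [f1 f2] [g1 g2]; split.
  apply: eq_integrable (integrableD mD f1 g1) => // t _.
  by rewrite /= ReD EFinD.
apply: eq_integrable (integrableD mD f2 g2) => // t _.
by rewrite /= ImD EFinD.
Qed.

Lemma integrableZ (k : R) (f : R -> R) : l.-integrable D (EFin \o f) ->
  l.-integrable D (EFin \o (fun t => k * f t)).
Proof.
by move=> i; apply: eq_integrable (integrableZl mD k i) => // t _.
Qed.

Lemma integrable_add (f g : R -> R) : l.-integrable D (EFin \o f) ->
  l.-integrable D (EFin \o g) -> l.-integrable D (EFin \o (fun t => f t + g t)).
Proof.
by move=> i j; apply: eq_integrable (integrableD mD i j) => // t _.
Qed.

Lemma integrable_sub (f g : R -> R) : l.-integrable D (EFin \o f) ->
  l.-integrable D (EFin \o g) -> l.-integrable D (EFin \o (fun t => f t - g t)).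
Proof.
by move=> i j; apply: eq_integrable (integrableB mD i j) => // t _.
Qed.

Lemma cintegrableZ (c : R[i]) f : cintegrable f -> cintegrable (fun t => c * f t).
Proof.
move=> [f1 f2]; split.
  under [X in EFin \o X]eq_fun do rewrite Re_mulc.
  by apply: integrable_sub; exact: integrableZ.
under [X in EFin \o X]eq_fun do rewrite Im_mulc.
by apply: integrable_add; exact: integrableZ.
Qed.

Lemma cintegralZ (c : R[i]) f : cintegrable f ->
  cintegral l D (fun t => c * f t) = c * cintegral l D f.
Proof.
move=> [f1 f2]; apply: complex_eq.
  rewrite Re_mulc /=; under eq_Rintegral do rewrite Re_mulc.
  by rewrite RintegralB ?RintegralZl//; exact: integrableZ.
rewrite Im_mulc /=; under eq_Rintegral do rewrite Im_mulc.
by rewrite RintegralD ?RintegralZl//; exact: integrableZ.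
Qed.

Lemma cintegralB f g : cintegrable f -> cintegrable g ->
  cintegral l D (fun t => f t - g t) = cintegral l D f - cintegral l D g.
Proof.
move=> fi gi; rewrite -[X in _ = _ - X]mul1r -mulNr -cintegralZ// -cintegralD//.
  by apply: eq_cintegral => t _; rewrite mulN1r.
exact: cintegrableZ.
Qed.

Lemma cintegrable0 : cintegrable (fun=> 0).
Proof. by split; exact: integrable0. Qed.

Lemma cintegral0 : cintegral l D (fun=> 0) = 0.
Proof.
by rewrite /cintegral /= /Rintegral integral0.
Qed.

Lemma cintegrable_sum I (s : seq I) (F : I -> R -> R[i]) :
  (forall i, cintegrable (F i)) -> cintegrable (fun t => \sum_(i <- s) F i t).
Proof.
move=> iF; elim: s => [|i s IH].
  under [X in cintegrable X]eq_fun do rewrite big_nil.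
  exact: cintegrable0.
under [X in cintegrable X]eq_fun do rewrite big_cons.
exact: cintegrableD.
Qed.

Lemma cintegral_sum I (s : seq I) (F : I -> R -> R[i]) :
  (forall i, cintegrable (F i)) ->
  cintegral l D (fun t => \sum_(i <- s) F i t) = \sum_(i <- s) cintegral l D (F i).
Proof.
move=> iF; elim: s => [|i s IH].
  rewrite big_nil -[RHS]cintegral0; apply: eq_cintegral => t _.
  by rewrite big_nil.
rewrite big_cons -IH -cintegralD//; last exact: cintegrable_sum.
by apply: eq_cintegral => t _; rewrite big_cons.
Qed.

Lemma cintegralC (f : R -> R) :
  cintegral l D (fun t => (f t)%:C) = (\int[l]_(t in D) f t)%:C.
Proof.
by apply: complex_eq => //=; rewrite /Rintegral integral0.
Qed.

Lemma cintegrableC (f : R -> R) : l.-integrable D (EFin \o f) ->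
  cintegrable (fun t => (f t)%:C).
Proof. by move=> i; split => //=; exact: integrable0. Qed.

Lemma cintegral_conj f : cintegrable f ->
  cintegral l D (fun t => (f t)^*) = (cintegral l D f)^*.
Proof.
move=> [f1 f2]; apply: complex_eq.
  by rewrite ReC /=; apply: eq_Rintegral => t _; rewrite ReC.
rewrite ImC /= -mulN1r -RintegralZl//.
by apply: eq_Rintegral => t _; rewrite ImC mulN1r.
Qed.

End ComplexIntegral.

(** * Asymptotic comparison with the tail *)

Section Asymptotics.
Variable R : realType.
Implicit Types f g T : R -> R.

(** There is no absolute value on the right, here and in [oinf]: each relation forces the comparison
    function to be eventually nonnegative. *)
Definition Oinf f g := exists2 C : R, 0 < C & \forall y \near +oo, `|f y| <= C * g y.
Definition oinf f g := forall e : R, 0 < e -> \forall y \near +oo, `|f y| <= e * g y.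

Lemma Oinf_o f g h : Oinf f g -> oinf g h -> oinf f h.
Proof.
move=> [C C0 fg] gh e e0; near=> y.
have fy : `|f y| <= C * g y by near: y.
have gy : `|g y| <= e / C * h y by near: y; apply: gh; exact: divr_gt0.
apply: le_trans fy _; apply: (@le_trans _ _ (C * `|g y|)).
  by rewrite ler_wpM2l ?ler_norm// ltW.
apply: (@le_trans _ _ (C * (e / C * h y))); first by rewrite ler_wpM2l// ltW.
by rewrite mulrA mulrCA mulfV ?mulr1// gt_eqF.
Unshelve. all: by end_near. Qed.

Lemma oinf_O f g h : oinf f g -> Oinf g h -> oinf f h.
Proof.
move=> fg [C C0 gh] e e0; near=> y.
have fy : `|f y| <= e / C * g y by near: y; apply: fg; exact: divr_gt0.
have gy : `|g y| <= C * h y by near: y.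
have eC0 : 0 <= e / C by rewrite divr_ge0 ?ltW.
apply: le_trans fy _; apply: (@le_trans _ _ (e / C * (C * h y))).
  by rewrite ler_wpM2l// (le_trans (ler_norm _)).
by rewrite mulrA divfK// gt_eqF.
Unshelve. all: by end_near. Qed.

Lemma oinfD f g T : oinf f T -> oinf g T -> oinf (fun y => f y + g y) T.
Proof.
move=> fT gT e e0; have e2 : 0 < e / 2 by lra.
near=> y.
have fy : `|f y| <= e / 2 * T y by near: y; exact: fT.
have gy : `|g y| <= e / 2 * T y by near: y; exact: gT.
by apply: le_trans (ler_normD _ _) _; lra.
Unshelve. all: by end_near. Qed.

Lemma oinfZ (c : R) f T : oinf f T -> oinf (fun y => c * f y) T.
Proof.
move=> fT e e0; have c0 : 0 < `|c| + 1 by rewrite ltr_wpDl.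
near=> y.
have fy : `|f y| <= e / (`|c| + 1) * T y by near: y; apply: fT; exact: divr_gt0.
rewrite normrM; apply: (@le_trans _ _ ((`|c| + 1) * `|f y|)).
  by rewrite ler_wpM2r// lerDl.
by rewrite -ler_pdivlMl// mulrA [_^-1 * _]mulrC.
Unshelve. all: by end_near. Qed.

Lemma oinf_near_eq f g T : (\forall y \near +oo, f y = g y) -> oinf f T -> oinf g T.
Proof.
move=> fg fT e e0; near=> y.
have <- : f y = g y by near: y.
by near: y; exact: fT.
Unshelve. all: by end_near. Qed.

Lemma oinf_ext f g T : f =1 g -> oinf f T -> oinf g T.
Proof. by move=> /funext ->. Qed.

Lemma oinf_le f g T : (\forall y \near +oo, `|f y| <= g y) -> oinf g T -> oinf f T.
Proof.
by move=> fg; apply: Oinf_o; exists 1 => //; near do rewrite mul1r.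
Unshelve. all: by end_near. Qed.

Lemma Oinf_le f g T : (\forall y \near +oo, `|f y| <= g y) -> Oinf g T -> Oinf f T.
Proof.
move=> fg [C C0 gT]; exists C => //; near=> y.
apply: (@le_trans _ _ (g y)); first by near: y.
by apply: le_trans (ler_norm _) _; near: y.
Unshelve. all: by end_near. Qed.

(** Regular variation at the single ratio [2] relates only [y] and [2 * y]; this propagates a bound
    from one dyadic block to the whole half-line. *)
Lemma dyadic_ind (x0 : R) (P : R -> Prop) : 0 < x0 ->
  (forall y, x0 <= y <= 2 * x0 -> P y) ->
  (forall y, x0 <= y -> P y -> P (2 * y)) ->
  forall y, x0 <= y -> P y.
Proof.
move=> x00 base step.
suff H n : forall y, x0 <= y <= 2 ^+ n.+1 * x0 -> P y.
  move=> y xy; apply: (H (Num.Def.archi_bound (y / x0))); rewrite xy /=.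
  by rewrite -ler_pdivrMr//; apply/ltW/upper_nthrootP.
elim: n => [|n IH] y /andP[xy yx]; first by apply: base; rewrite xy -[2]expr1.
have [y2|y2] := leP y (2 * x0); first by apply: base; rewrite xy.
have -> : y = 2 * (y / 2) by lra.
apply: step; first lra.
apply: IH; apply/andP; split; first lra.
by rewrite ler_pdivrMr// mulrAC -exprSr.
Qed.

Lemma powRN_cvg0 (d e : R) : 0 < d -> 0 < e -> \forall y \near +oo, y `^ (- d) <= e.
Proof.
move=> d0 e0; near=> y.
have y0 : 0 < y by near: y; exact: nbhs_pinfty_gt.
have : (e^-1) `^ (d^-1) <= y by near: y; apply: nbhs_pinfty_ge; exact: num_real.
move=> /(ge0_ler_powR (ltW d0)); rewrite !nnegrE powR_ge0 (ltW y0) => /(_ isT isT).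
rewrite -powRrM mulVf ?gt_eqF// powRr1 ?invr_ge0 ?(ltW e0)// => H.
by rewrite powRN -[e]invrK lef_pV2 ?posrE ?invr_gt0 ?powR_gt0.
Unshelve. all: by end_near. Qed.

Lemma cvg_inv_small (e : R) : 0 < e -> \forall y \near +oo, (y : R)^-1 <= e.
Proof.
move=> e0; near=> y.
have y0 : 0 < y by near: y; exact: nbhs_pinfty_gt.
by rewrite -[e]invrK lef_pV2 ?posrE ?invr_gt0.
Unshelve. all: by end_near. Qed.

End Asymptotics.

(** * Integrals of the truncated ratio t / y *)

Section Tails.
Variable R : realType.
Local Notation RT := (measurableTypeR R).
Variable l : {finite_measure set RT -> \bar R}.
Local Notation D := (@Rnonneg R).

Lemma measurable_Rnonneg : measurable (D : set RT).
Proof. exact: measurable_itv. Qed.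
Local Notation mD := measurable_Rnonneg.

(** Up to a constant this is the modulus of [t / (i y - t)]: linear in [t] below [y], bounded above
    it. *)
Definition min1 (y t : R) := Num.min 1 `|t / y|.

Lemma min1_ge0 y t : 0 <= min1 y t.
Proof. by rewrite le_min ler01 normr_ge0. Qed.

Lemma min1_le1 y t : min1 y t <= 1.
Proof. by rewrite ge_min lexx. Qed.

Lemma min1_le y t : min1 y t <= `|t / y|.
Proof. by rewrite ge_min lexx orbT. Qed.

Lemma measurable_scale_norm y : measurable_fun [set: RT] (fun t : R => `|t / y|).
Proof. by apply: measurableT_comp => //; exact: mulrr_measurable. Qed.

Lemma measurable_min1 y : measurable_fun [set: RT] (min1 y).
Proof. by apply: measurable_minr => //; exact: measurable_scale_norm. Qed.

Lemma bounded_integrable (A : set R) (f : R -> R) (C : R) :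
  measurable (A : set RT) -> measurable_fun [set: RT] f ->
  (forall t, A t -> `|f t| <= C) -> l.-integrable A (EFin \o f).
Proof.
move=> mA mf fC; apply: (@Rintegrable_le _ l A mA f (cst C)) => //.
exact: finite_measure_integrable_cst.
Qed.

Lemma integrable_min1X (A : set R) y c : measurable (A : set RT) ->
  l.-integrable A (EFin \o (fun t => min1 y t ^+ c)).
Proof.
move=> mA; apply: (@bounded_integrable _ _ 1) => //.
  by apply: measurable_funX; exact: measurable_min1.
by move=> t _; rewrite ger0_norm ?exprn_ge0 ?min1_ge0// exprn_ile1 ?min1_ge0 ?min1_le1.
Qed.

Lemma Rintegral_min1_cvg0 (A : set R) : measurable (A : set RT) ->
  \int[l]_(t in A) min1 y t @[y --> +oo] --> (0 : R).
Proof.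
move=> mA; apply/cvg_pinftyP => u uy.
have -> : (0 : R) = fine (0%:E) by [].
apply: fine_cvg.
have H : (\int[l]_(t in A) (min1 (u n) t)%:E)%E @[n --> \oo] -->
    (\int[l]_(t in A) (cst 0%E) t)%E.
  apply: (@dominated_cvg _ _ _ l A mA _ _ (cst 1%E)).
  - by move=> n; apply/measurable_EFinP; apply: measurable_funTS; exact: measurable_min1.
  - move=> t _; apply/cvg_EFin; first by apply: nearW.
    have : `|t / u n| @[n --> \oo] --> `|0 : R|.
      apply: cvg_norm; rewrite -[X in _ --> X](mulr0 t); apply: cvgMr.
      apply/gtr0_cvgV0 => //; exact: (cvgry_gt uy).
    rewrite normr0 => tu.
    apply: (squeeze_cvgr _ (cvg_cst 0) tu).
    by apply: nearW => n; rewrite min1_ge0 min1_le.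
  - by [].
  - exact: finite_measure_integrable_cst.
  - by move=> n t _; rewrite /= lee_fin ger0_norm ?min1_ge0 ?min1_le1.
by rewrite integral0 in H.
Qed.

End Tails.

(** * Truncated moments of a measure with regularly varying tail *)

Section RegularVariation.
Variable R : realType.
Local Notation RT := (measurableTypeR R).
Variable l : {finite_measure set RT -> \bar R}.
Local Notation D := (@Rnonneg R).
Local Notation mD := (@measurable_Rnonneg R).
Local Notation T := (tail l).

Lemma near_pinfty_ge (P : R -> Prop) : (\forall y \near +oo, P y) ->
  exists2 x0 : R, 0 < x0 & forall y, x0 <= y -> P y.
Proof.
move=> [M [_ MP]]; exists (Num.max M 0 + 1); first by rewrite ltr_wpDl// le_max lexx orbT.
by move=> y My; apply: MP; rewrite (lt_le_trans _ My)// ltr_pwDr// le_max lexx.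
Qed.

Lemma measurable_gt (x : R) : measurable (`]x, +oo[%classic : set RT).
Proof. exact: measurable_itv. Qed.

Lemma tail_ge0 x : 0 <= T x.
Proof. by rewrite fine_ge0. Qed.

Lemma tail_nonincreasing x y : x <= y -> T y <= T x.
Proof.
move=> xy; rewrite /tail fine_le ?fin_num_measure ?measurable_gt//.
apply: le_measure; rewrite ?inE; try exact: measurable_gt.
by move=> t /=; rewrite !in_itv /= !andbT; apply: le_lt_trans.
Qed.

Lemma Rintegral_tail (y : R) : 0 <= y -> \int[l]_(t in D) (\1_(`]y, +oo[) t : R) = T y.
Proof.
move=> y0; rewrite /Rintegral integral_indic; [|exact: mD|exact: measurable_gt].
rewrite setIidl// => t; rewrite /Rnonneg /= !in_itv /= !andbT => yt.
exact: ltW (le_lt_trans y0 yt).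
Qed.

Lemma integrable_tail y : l.-integrable D (EFin \o (\1_(`]y, +oo[) : R -> R)).
Proof.
apply: (@bounded_integrable _ _ _ _ 1) => //; first exact: mD.
by move=> t _; rewrite indicE; case: (t \in _); rewrite ?normr1 ?normr0.
Qed.

Lemma tail_le_min1 (y : R) : 0 < y -> T y <= \int[l]_(t in D) min1 y t.
Proof.
move=> y0; rewrite -Rintegral_tail ?(ltW y0)//; apply: le_Rintegral.
- exact: mD.
- exact: integrable_tail.
- have := @integrable_min1X _ l D y 1 mD.
  by under [X in EFin \o X]eq_fun do rewrite expr1.
- move=> t; rewrite /Rnonneg /= in_itv /= andbT => t0.
  rewrite indicE; have [|_] := boolP (t \in _); last by rewrite min1_ge0.
  rewrite inE /= in_itv /= andbT => yt; rewrite /min1 min_l// ger0_norm ?divr_ge0 ?(ltW y0)//.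
  by rewrite ler_pdivlMr// mul1r ltW.
Qed.

Lemma tail_cvg0 (e : R) : 0 < e -> \forall y \near +oo, T y <= e.
Proof.
move=> e0; near=> y; have y0 : 0 < y by near: y; exact: nbhs_pinfty_gt.
apply: le_trans (tail_le_min1 y0) _.
by near: y; apply: cvgr_le e0; exact: Rintegral_min1_cvg0 mD.
Unshelve. all: by end_near. Qed.

Variable alpha : R.
Hypothesis alpha0 : 0 <= alpha.
Hypothesis rv : regularly_varying_tail l (- alpha).

Lemma tail_gt0 : \forall y \near +oo, 0 < T y.
Proof. by case: rv. Qed.

Lemma tail_ratio_le (t c : R) : 0 < t -> t `^ (- alpha) < c ->
  \forall y \near +oo, T (t * y) <= c * T y.
Proof.
move=> t0 tc; have [_ _ /(_ t t0) rt] := rv; near=> y.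
rewrite -ler_pdivrMr; last by near: y; exact: tail_gt0.
by near: y; exact: cvgr_le tc.
Unshelve. all: by end_near. Qed.

Lemma tail_ratio_ge (t c : R) : 0 < t -> c < t `^ (- alpha) ->
  \forall y \near +oo, c * T y <= T (t * y).
Proof.
move=> t0 tc; have [_ _ /(_ t t0) rt] := rv; near=> y.
rewrite -ler_pdivlMr; last by near: y; exact: tail_gt0.
by near: y; exact: cvgr_ge tc.
Unshelve. all: by end_near. Qed.

Lemma powR2_lt (a b : R) : a < b -> 2 `^ (- b) < 2 `^ (- a) :> R.
Proof.
move=> ab; rewrite !powRN ltf_pV2 ?posrE ?powR_gt0//.
by rewrite /powR !ifF ?pnatr_eq0// ltr_expR ltr_pM2r// ln_gt0// ltr1n.
Qed.

(** Doubling the argument keeps at least the fraction [2 ^ -b'] of the tail, for [alpha < b' < b],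
    so the tail dominates a multiple of [y ^ -b']. The gap [b - b'] supplies the little o. *)
Lemma powRN_oinf_tail (b : R) : alpha < b -> oinf (fun y => y `^ (- b)) T.
Proof.
move=> ab e e0; pose b' := (alpha + b) / 2.
have ab' : alpha < b' by rewrite /b'; lra.
have b'b : b' < b by rewrite /b'; lra.
have [x0 x00 Hx0] : exists2 x0 : R, 0 < x0 & forall y, x0 <= y ->
    2 `^ (- b') * T y <= T (2 * y) /\ 0 < T y.
  apply: near_pinfty_ge; apply: filterI; last exact: tail_gt0.
  by apply: tail_ratio_ge => //; exact: powR2_lt.
(* Chosen for the block [[x0, 2 * x0]]: there the tail is at least [T (2 * x0)] and [y ^ -b'] at
   most [x0 ^ -b']. *)
pose c := T (2 * x0) * x0 `^ b'.
have c0 : 0 < c.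
  by rewrite mulr_gt0 ?powR_gt0//; have [] := Hx0 (2 * x0); [lra|].
have lb : forall y, x0 <= y -> c * y `^ (- b') <= T y.
  apply: (dyadic_ind x00) => [y /andP[xy yx]|y xy IH].
    apply: le_trans (tail_nonincreasing yx).
    rewrite /c powRN -mulrA ler_piMr ?tail_ge0// ler_pdivrMr ?mul1r ?powR_gt0//.
      apply: ge0_ler_powR => //; rewrite ?nnegrE; [exact: le_trans (ltW ab')|exact: ltW|].
      exact: le_trans (ltW x00) xy.
    lra.
  apply: le_trans (Hx0 y xy).1; rewrite powRM//; last lra.
  by rewrite mulrCA ler_wpM2l// powR_ge0.
near=> y.
have xy : x0 <= y by near: y; apply: nbhs_pinfty_ge; exact: num_real.
have y0 : 0 < y by lra.
rewrite ger0_norm ?powR_ge0//.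
have -> : - b = - b' + - (b - b') by lra.
rewrite powRD; last by apply/implyP => _; rewrite gt_eqF.
have H : y `^ (- (b - b')) <= e * c by near: y; apply: powRN_cvg0; [lra|exact: mulr_gt0].
apply: (@le_trans _ _ (y `^ (- b') * (e * c))); first by rewrite ler_wpM2l ?powR_ge0.
by rewrite mulrCA ler_wpM2l ?(ltW e0)// mulrC lb.
Unshelve. all: by end_near. Qed.

Lemma expVn_oinf_tail (n : nat) : alpha < n%:R -> oinf (fun y => y^-1 ^+ n) T.
Proof.
move=> an; apply: oinf_le (powRN_oinf_tail an); near=> y.
have y0 : 0 < y by near: y; exact: nbhs_pinfty_gt.
by rewrite ger0_norm ?exprn_ge0 ?invr_ge0 ?(ltW y0)// powRN powR_mulrn ?(ltW y0)// exprVn.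
Unshelve. all: by end_near. Qed.

(* Karamata-type bound. The truncated moment [J] satisfies
   [J (2 y) <= 2^-c * J y + T y], and [T y <= 2^b * T (2 y)] with [b < c]. *)
Lemma Rintegral_min1X_Oinf (c : nat) : alpha < c%:R ->
  Oinf (fun y => \int[l]_(t in D) min1 y t ^+ c) T.
Proof.
move=> ac; pose b := (alpha + c%:R) / 2.
have ab : alpha < b by rewrite /b; lra.
have bc : b < c%:R by rewrite /b; lra.
have [x0 x00 Hx0] : exists2 x0 : R, 0 < x0 & forall y, x0 <= y ->
    2 `^ (- b) * T y <= T (2 * y) /\ 0 < T y.
  apply: near_pinfty_ge; apply: filterI; last exact: tail_gt0.
  by apply: tail_ratio_ge => //; exact: powR2_lt.
pose J y := \int[l]_(t in D) min1 y t ^+ c.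
have iJ y : l.-integrable D (EFin \o (fun t => min1 y t ^+ c)).
  by apply: integrable_min1X; exact: mD.
pose m := \int[l]_(t in D) (1 : R).
have i1 : l.-integrable D (EFin \o (fun=> 1 : R)).
  exact: finite_measure_integrable_cst mD.
have Jm y : J y <= m.
  apply: le_Rintegral => //; first exact: mD.
  by move=> t _; rewrite exprn_ile1 ?min1_ge0 ?min1_le1.
have Jrec y : 0 < y -> J (2 * y) <= 2^-1 ^+ c * J y + T y.
  move=> y0; rewrite -Rintegral_tail ?(ltW y0)// -RintegralZl//; last exact: mD.
  rewrite -RintegralD; [|exact: mD| |exact: integrable_tail]; last exact: integrableZ mD _ _ (iJ y).
  apply: le_Rintegral => //; first exact: mD.
    apply: integrable_add; [exact: mD| |exact: integrable_tail].
    exact: integrableZ mD _ _ (iJ y).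
  move=> t; rewrite /Rnonneg /= in_itv /= andbT => t0.
  (* Above [y] the indicator pays for everything; below, [min1 y t] is [t / y], which is halved when
     [y] doubles. *)
  rewrite indicE; have [yt|] := boolP (t \in _) => /=.
    rewrite ler_wpDl ?mulr_ge0 ?exprn_ge0 ?min1_ge0 ?invr_ge0//.
    by rewrite exprn_ile1 ?min1_ge0 ?min1_le1.
  rewrite notin_setE /= in_itv /= andbT => /negP; rewrite -leNgt => ty.
  rewrite addr0 -exprMn lerXn2r ?nnegrE ?min1_ge0 ?mulr_ge0 ?invr_ge0 ?min1_ge0//.
  rewrite {2}/min1 min_r; last by rewrite ger0_norm ?divr_ge0 ?(ltW y0)// ler_pdivrMr ?mul1r.
  apply: le_trans (min1_le _ _) _.
  by rewrite invfM mulrCA normrM [`|2^-1|]ger0_norm ?invr_ge0.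
have T2 y : x0 <= y -> T y <= 2 `^ b * T (2 * y).
  move=> /Hx0[+ _]; rewrite powRN => H.
  by rewrite -ler_pdivrMl ?powR_gt0.
pose q : R := 2^-1 ^+ c * 2 `^ b.
have q0 : 0 <= q by rewrite mulr_ge0 ?exprn_ge0 ?invr_ge0 ?powR_ge0.
have q1 : q < 1.
  rewrite /q exprVn -powR_mulrn// -powRN -[2 `^ b]invrK -powRN.
  by rewrite ltr_pdivrMr ?mul1r ?powR_gt0// powR2_lt.
have T20 : 0 < T (2 * x0) by have [] := Hx0 (2 * x0); [lra|].
(* The first summand settles the initial block, where [J] is at most the total mass; the second
   makes the recursion stable, as [C * q + 2 ^ b <= C]. *)
pose C := m / T (2 * x0) + 2 `^ b / (1 - q).
have m0 : 0 <= m by apply: Rintegral_ge0.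
have C0 : 0 < C by rewrite ltr_wpDl ?divr_ge0 ?divr_gt0 ?powR_gt0 ?(ltW T20)//; lra.
have CK : 2 `^ b <= C * (1 - q).
  by rewrite mulrDl divfK; [rewrite lerDr mulr_ge0 ?divr_ge0 ?(ltW T20)//; lra|lra].
exists C => //.
have H : forall y, x0 <= y -> J y <= C * T y.
  apply: (dyadic_ind x00) => [y /andP[xy yx]|y xy IH].
    apply: le_trans (Jm y) _; apply: (@le_trans _ _ (C * T (2 * x0))).
      by rewrite mulrDl divfK ?gt_eqF// lerDl mulr_ge0 ?divr_ge0 ?powR_ge0 ?(ltW T20)//; lra.
    by rewrite ler_wpM2l ?(ltW C0)// tail_nonincreasing.
  apply: le_trans (Jrec y _) _; first lra.
  apply: (@le_trans _ _ ((2^-1 ^+ c * C + 1) * T y)).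
    by rewrite mulrDl mul1r lerD2r -mulrA ler_wpM2l ?exprn_ge0 ?invr_ge0.
  apply: (@le_trans _ _ ((2^-1 ^+ c * C + 1) * (2 `^ b * T (2 * y)))).
    by rewrite ler_wpM2l ?T2// addr_ge0// mulr_ge0 ?exprn_ge0 ?invr_ge0// ltW.
  rewrite mulrA ler_wpM2r ?tail_ge0//.
  by rewrite mulrDl mul1r mulrAC -/q; lra.
near=> y; rewrite ger0_norm; last first.
  by apply: Rintegral_ge0 => t _; rewrite exprn_ge0 ?min1_ge0.
by apply: H; near: y; apply: nbhs_pinfty_ge; exact: num_real.
Unshelve. all: by end_near. Qed.

End RegularVariation.

(** * Finite moments and the size of the expansion remainder *)

Section Gauge.
Variable R : realType.
Local Notation RT := (measurableTypeR R).
Variable l : {finite_measure set RT -> \bar R}.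
Local Notation D := (@Rnonneg R).
Local Notation mD := (@measurable_Rnonneg R).
Local Notation T := (tail l).
Variable alpha : R.
Hypothesis rv : regularly_varying_tail l (- alpha).

Lemma geometric_partial_sum_le (q : R) n : 0 <= q < 1 ->
  \sum_(i < n) q ^+ i <= (1 - q)^-1.
Proof.
move=> /andP[q0 q1]; rewrite -[leRHS]mul1r ler_pdivlMr; last lra.
have := subrX1 q n; have : 0 <= q ^+ n by rewrite exprn_ge0.
by set S := \sum_(i < n) _ => + E; lra.
Qed.

(** Truncate [t] at the dyadic points [x n]. The tail at [x n] is at most a multiple of
    [2 ^ (-a' n)] with [a < a' < alpha], so the truncated moments increase by the terms of a
    geometric series of ratio [2 ^ (a - a')]; monotone convergence removes the truncation. *)
Lemma integral_powR_lty (a : R) : 0 <= a < alpha ->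
  (\int[l]_(t in D) (t `^ a)%:E < +oo)%E.
Proof.
move=> /andP[a0 aa]; pose a' := (a + alpha) / 2.
have aa' : a < a' by rewrite /a'; lra.
have a'a : a' < alpha by rewrite /a'; lra.
have [x0 x00 Hx0] : exists2 x0 : R, 0 < x0 & forall y, x0 <= y ->
    T (2 * y) <= 2 `^ (- a') * T y.
  by apply: near_pinfty_ge; apply: (tail_ratio_le rv) => //; exact: powR2_lt.
pose x n : R := 2 ^+ n * x0.
have x_gt0 n : 0 < x n by rewrite mulr_gt0 ?exprn_gt0.
have xS n : x n.+1 = 2 * x n by rewrite /x exprS mulrA.
have x_ge n : x0 <= x n by rewrite ler_peMl ?(ltW x00)// exprn_ege1// ler1n.
have x_nd m n : (m <= n)%N -> x m <= x n.
  by move=> mn; rewrite ler_pM2r// ler_weXn2l// ler1n.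
have Tx n : T (x n) <= (2 `^ (- a')) ^+ n * T x0.
  elim: n => [|n IH]; first by rewrite /x !expr0 !mul1r.
  rewrite xS; apply: le_trans (Hx0 _ (x_ge n)) _.
  by rewrite exprS -mulrA ler_wpM2l ?powR_ge0.
pose f n t : R := (Num.min t (x n)) `^ a.
have mf n : measurable_fun [set: RT] (f n).
  apply: (measurableT_comp (measurable_powR _)).
  by apply: measurable_minr.
have f_ge0 n t : 0 <= f n t by exact: powR_ge0.
have xa n : x n.+1 `^ a = (2 `^ a) ^+ n * (2 * x0) `^ a.
  rewrite /x exprSr -mulrA powRM ?exprn_ge0 ?mulr_ge0 ?(ltW x00)//.
  congr (_ * _).
  by rewrite -(powR_mulrn n (ler0n R 2)) -(powR_mulrn n (powR_ge0 2 a)) -!powRrM mulrC.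
have if_ n : l.-integrable D (EFin \o f n).
  apply: (@bounded_integrable _ _ _ _ ((x n) `^ a) mD) => // t.
  rewrite /Rnonneg /= in_itv /= andbT => t0; rewrite ger0_norm//.
  apply: ge0_ler_powR => //; rewrite ?nnegrE ?le_min ?t0 ?(ltW (x_gt0 n))//.
  by rewrite ge_min lexx orbT.
pose W n := \int[l]_(t in D) f n t.
pose q : R := 2 `^ a * 2 `^ (- a').
have q01 : 0 <= q < 1.
  rewrite /q mulr_ge0 ?powR_ge0//= powRN ltr_pdivrMr ?powR_gt0// mul1r.
  by have := @powR2_lt _ (- a') (- a); rewrite !opprK; apply; lra.
pose K := (2 * x0) `^ a * T x0.
have Wrec n : W n.+1 <= W n + K * q ^+ n.
  have -> : K * q ^+ n = (x n.+1) `^ a * ((2 `^ (- a')) ^+ n * T x0).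
    by rewrite xa /K /q exprMn; ring.
  apply: (@le_trans _ _ (W n + x n.+1 `^ a * T (x n))); last first.
    by rewrite lerD2l ler_wpM2l ?powR_ge0.
  rewrite -Rintegral_tail ?(ltW (x_gt0 n))// -RintegralZl; [|exact: mD|exact: integrable_tail].
  rewrite -RintegralD; [|exact: mD| |]; last 2 first.
  - exact: if_.
  - apply: integrableZ; [exact: mD|exact: integrable_tail].
  apply: le_Rintegral; [exact: mD|exact: if_| |].
    apply: integrable_add; [exact: mD|exact: if_|].
    by apply: integrableZ; [exact: mD|exact: integrable_tail].
  move=> t; rewrite /Rnonneg /= in_itv /= andbT => t0.
  rewrite indicE; have [xt|] := boolP (t \in _).
    rewrite mulr1 ler_wpDl//; apply: ge0_ler_powR => //.
    - by rewrite nnegrE le_min t0 ltW.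
    - by rewrite nnegrE ltW.
    - by rewrite ge_min lexx orbT.
  rewrite notin_setE /= in_itv /= andbT => /negP; rewrite -leNgt => tx.
  rewrite mulr0 addr0 /f !min_l//.
  by apply: le_trans tx _; exact: x_nd.
have K0 : 0 <= K by rewrite mulr_ge0 ?powR_ge0 ?tail_ge0.
have Wle n : W n <= W 0%N + K * (1 - q)^-1.
  apply: (@le_trans _ _ (W 0%N + K * \sum_(i < n) q ^+ i)); last first.
    by rewrite lerD2l ler_wpM2l ?geometric_partial_sum_le.
  elim: n => [|n IH]; first by rewrite big_ord0 mulr0 addr0.
  by rewrite big_ord_recr /= mulrDr addrA; apply: le_trans (Wrec n) _; rewrite lerD2r.
have cv : (\int[l]_(t in D) (f n t)%:E)%E @[n --> \oo] -->
    (\int[l]_(t in D) limn (fun n => (f n t)%:E))%E.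
  apply: (@cvg_monotone_convergence _ _ _ l D mD).
  - by move=> n; apply/measurable_EFinP; apply: measurable_funTS.
  - by move=> n t _; rewrite lee_fin.
  - move=> t; rewrite /Rnonneg /= in_itv /= andbT => t0 m n mn.
    rewrite lee_fin; apply: ge0_ler_powR => //.
    - by rewrite nnegrE le_min t0 ltW.
    - by rewrite nnegrE le_min t0 ltW.
    - by rewrite le_min ge_min lexx /= ge_min x_nd ?orbT.
have -> : (\int[l]_(t in D) (t `^ a)%:E = \int[l]_(t in D) limn (fun n => (f n t)%:E))%E.
  apply: eq_integral => t; rewrite inE /Rnonneg /= in_itv /= andbT => t0.
  apply/esym/cvg_lim => //; apply: cvg_near_cst.
  near=> n; rewrite /f min_l//.
  have := @upper_nthrootP _ (t / x0) n; rewrite ltr_pdivrMr// => H.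
  by apply/ltW/H; near: n; exact: nbhs_infty_ge.
apply: (@le_lt_trans _ _ (W 0%N + K * (1 - q)^-1)%:E); last exact: ltry.
rewrite -(cvg_lim _ cv)//; apply: lime_le; first by apply/cvg_ex; eexists; exact: cv.
apply: nearW => n; apply: (@le_trans _ _ (W n)%:E); last by rewrite lee_fin.
by rewrite /W /Rintegral fineK//; apply: integrable_fin_num; [exact: mD|exact: if_].
Unshelve. all: by end_near. Qed.

(** The [E] of the overview: a majorant, up to a constant, of what is left of [g_l(i y)] once [p]
    powers of [1 / w] are extracted, each of them costing a factor [t / y]. *)
Definition gauge (p : nat) (y : R) := \int[l]_(t in D) (`|t / y| ^+ p * min1 y t).

Lemma gauge_ge0 p y : 0 <= gauge p y.
Proof. by apply: Rintegral_ge0 => t _; rewrite mulr_ge0 ?exprn_ge0 ?min1_ge0. Qed.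

Lemma integrable_exp_powR (a : R) (p : nat) : p%:R <= a ->
  (\int[l]_(t in D) (t `^ a)%:E < +oo)%E ->
  l.-integrable D (EFin \o (fun t => t ^+ p)) /\ l.-integrable D (EFin \o (fun t => t `^ a)).
Proof.
move=> pa fin.
have mp : measurable_fun [set: RT] (fun t : R => t `^ a) by exact: measurable_powR.
have ia : l.-integrable D (EFin \o (fun t => t `^ a)).
  apply/integrableP; split; first by apply/measurable_EFinP; apply: measurable_funTS.
  by under eq_integral do rewrite /= ger0_norm ?powR_ge0//.
split => //.
apply: (@Rintegrable_le _ l D mD _ (fun t => 1 + t `^ a)).
- exact: exprn_measurable.
- apply: integrable_add; [exact: mD| |exact: ia].
  exact: finite_measure_integrable_cst mD.
- move=> t; rewrite /Rnonneg /= in_itv /= andbT => t0.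
  rewrite ger0_norm ?exprn_ge0//.
  have [t1|t1] := leP t 1; first by rewrite ler_wpDr ?powR_ge0// exprn_ile1.
  by rewrite ler_wpDl// -powR_mulrn// ler_powR// ltW.
Qed.

(* The order [p] is chosen so that the products of two error terms of size
   [gauge p y] or [1 / y] are negligible with respect to the tail. *)
Lemma exists_gauge : 0 <= alpha -> exists p : nat,
  [/\ l.-integrable D (EFin \o (fun t => t ^+ p)),
      oinf (fun y => gauge p y ^+ 2) T & oinf (fun y => gauge p y / y) T].
Proof.
(* For [alpha = 0] no moment of positive order need be finite. With [p = 0] the gauge is itself
   [O(T)] and tends to [0], so its square is [o(T)]. *)
rewrite le_eqVlt => /predU1P[a0|a0].
  have J : Oinf (gauge 0) T.
    have := @Rintegral_min1X_Oinf _ l alpha rv 1%N; rewrite -{1}a0 => /(_ ltr01).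
    congr (Oinf _ _); apply/funext => y; apply: eq_Rintegral => t _.
    by rewrite expr1 expr0 mul1r.
  have g0 e : 0 < e -> \forall y \near +oo, gauge 0 y <= e.
    have -> : gauge 0 = fun y => \int[l]_(t in D) min1 y t.
      by apply/funext => y; apply: eq_Rintegral => t _; rewrite expr0 mul1r.
    by move=> e0; apply: cvgr_le e0; exact: Rintegral_min1_cvg0 mD.
  exists 0%N; split.
  - by under [X in EFin \o X]eq_fun do rewrite expr0; exact: finite_measure_integrable_cst mD.
  - apply: oinf_O J => e e0; near=> y.
    rewrite expr2 ger0_norm ?mulr_ge0 ?gauge_ge0// ler_wpM2r ?gauge_ge0//.
    by near: y; exact: g0.
  - apply: oinf_O J => e e0; near=> y.
    have y0 : 0 < y by near: y; exact: nbhs_pinfty_gt.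
    rewrite ger0_norm ?divr_ge0 ?gauge_ge0 ?(ltW y0)// mulrC ler_wpM2r ?gauge_ge0//.
    by near: y; exact: cvg_inv_small.
(* Three constraints: [a < alpha] makes the moment of order [a] finite, [alpha < a + 1] makes
   [gauge / y] negligible, and [alpha < 2 a] does so for the squared gauge. The order [p] is the
   integer part of [a]. *)
pose a := (Num.max (alpha - 1) (alpha / 2) + alpha) / 2.
have m1 : alpha - 1 <= Num.max (alpha - 1) (alpha / 2) by rewrite le_max lexx.
have m2 : alpha / 2 <= Num.max (alpha - 1) (alpha / 2) by rewrite le_max lexx orbT.
have m3 : Num.max (alpha - 1) (alpha / 2) < alpha by rewrite gt_max; apply/andP; split; lra.
have [a_ge0 a_lt a1 a2] : [/\ 0 <= a, a < alpha, alpha < a + 1 & alpha < a + a].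
  by rewrite /a; split; lra.
have /andP[pa ap] := truncn_itv a_ge0.
set p := Num.truncn a in pa ap.
have fin := integral_powR_lty (introT andP (conj a_ge0 a_lt)).
have [ip ia] := integrable_exp_powR pa fin.
pose C := \int[l]_(t in D) t `^ a.
have C0 : 0 <= C by apply: Rintegral_ge0 => t _; exact: powR_ge0.
(* With [s = t / y] and [p <= a < p + 1], one has [s ^ p * min(1, s) <= s ^ a] on either side of
   [s = 1]. *)
have gle (y : R) : 0 < y -> gauge p y <= C * y `^ (- a).
  move=> y0; rewrite -RintegralZr; [|exact: mD|exact: ia].
  apply: le_Rintegral; first exact: mD.
  - apply: (@Rintegrable_le _ l D mD _ (fun t => y^-1 ^+ p * t ^+ p)).
    + apply: measurable_funM; last exact: measurable_min1.
      by apply: measurable_funX; exact: measurable_scale_norm.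
    + exact: integrableZ mD _ _ ip.
    + move=> t; rewrite /Rnonneg /= in_itv /= andbT => t0.
      rewrite ger0_norm ?mulr_ge0 ?exprn_ge0 ?min1_ge0//.
      rewrite [`|t / y|]ger0_norm ?divr_ge0 ?(ltW y0)// exprMn [leRHS]mulrC.
      by rewrite ler_piMr ?min1_le1// mulr_ge0 ?exprn_ge0 ?invr_ge0 ?(ltW y0).
  - under [X in EFin \o X]eq_fun do rewrite mulrC.
    exact: integrableZ mD _ _ ia.
  - move=> t; rewrite /Rnonneg /= in_itv /= andbT => t0.
    rewrite /min1 [`|t / y|]ger0_norm ?divr_ge0 ?(ltW y0)//.
    have -> : t `^ a * y `^ (- a) = (t / y) `^ a.
      by rewrite powRM ?invr_ge0 ?(ltW y0)// -[y^-1]powR_inv1 ?(ltW y0)// -powRrM mulN1r.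
    set s := t / y; have s0 : 0 <= s by rewrite divr_ge0 // ltW.
    have [s1|s1] := leP 1 s.
      by rewrite mulr1 -powR_mulrn// ler_powR.
    rewrite -exprSr; move: s0; rewrite le_eqVlt => /predU1P[<-|s0].
      by rewrite expr0n /= powR_ge0.
    by rewrite -powR_mulrn ?(ltW s0)// ger_powR ?s0 ?(ltW s1)// ltW.
have C1 : 0 < C + 1 by lra.
exists p; split => //.
- apply: (@Oinf_o _ _ (fun y => y `^ (- (a + a)))); last exact: (powRN_oinf_tail (ltW a0) rv).
  exists ((C + 1) ^+ 2); first by rewrite exprn_gt0.
  near=> y; have y0 : 0 < y by near: y; exact: nbhs_pinfty_gt.
  rewrite ger0_norm ?sqr_ge0// opprD powRD; last by apply/implyP => _; rewrite gt_eqF.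
  rewrite -expr2 -exprMn lerXn2r ?nnegrE ?gauge_ge0 ?mulr_ge0 ?powR_ge0 ?(ltW C1)//.
  by apply: le_trans (gle y y0) _; rewrite ler_wpM2r ?powR_ge0// lerDl.
- apply: (@Oinf_o _ _ (fun y => y `^ (- (a + 1)))); last exact: (powRN_oinf_tail (ltW a0) rv).
  exists (C + 1) => //.
  near=> y; have y0 : 0 < y by near: y; exact: nbhs_pinfty_gt.
  rewrite ger0_norm ?divr_ge0 ?gauge_ge0 ?(ltW y0)// opprD powRD; last first.
    by apply/implyP => _; rewrite gt_eqF.
  rewrite powR_inv1 ?(ltW y0)// mulrA ler_wpM2r ?invr_ge0 ?(ltW y0)//.
  by apply: le_trans (gle y y0) _; rewrite ler_wpM2r ?powR_ge0// lerDl.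
Unshelve. all: by end_near. Qed.

End Gauge.

(** * A Tauberian lemma for the moments of t^2/(t^2+y^2) *)

Section SteepPolynomial.
Variable R : realType.
Implicit Types x : R.

(* The probability that a binomial variable with parameters [2 M] and [x] is at least
   [M]: divisible by [x ^ M], it approximates the indicator of [x > 1 / 2]. *)
Definition steep M x : R :=
  \sum_(M <= k < (2 * M).+1) x ^+ k * (1 - x) ^+ (2 * M - k) *+ 'C(2 * M, k).

Lemma steep_compl M x : steep M x +
  \sum_(0 <= k < M) x ^+ k * (1 - x) ^+ (2 * M - k) *+ 'C(2 * M, k) = 1.
Proof.
rewrite addrC /steep -big_cat_nat//=; last by rewrite leqW// leq_pmull.
have := exprDn (1 - x) x (2 * M); rewrite subrK expr1n => E; rewrite [RHS]E {E}.
by rewrite big_mkord; apply: eq_bigr => i _; rewrite mulrC.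
Qed.

Lemma binomial_row_sum_le (m n N : nat) : (n <= N.+1)%N ->
  \sum_(m <= k < n) ('C(N, k)%:R : R) <= 2 ^+ N.
Proof.
move=> nN; have := exprDn (1 : R) 1 N; rewrite -[1 + 1]/(2%:R : R) => E; rewrite [leRHS]E {E}.
under [leRHS]eq_bigr do rewrite !expr1n mulr1.
rewrite -(big_mkord xpredT (fun k => 'C(N, k)%:R : R)).
have [mn|nm] := leqP m n; last first.
  rewrite [leLHS]big_geq; last exact: ltnW.
  by elim/big_ind: _ => // x y; exact: addr_ge0.
rewrite [leRHS](@big_cat_nat _ _ _ n)//= [X in _ <= X + _](@big_cat_nat _ _ _ m)//=.
by rewrite -addrA addrCA lerDl addr_ge0 ?sumr_ge0//.
Qed.

Lemma sum_binomial_le (m n N : nat) (F : nat -> R) (B : R) : (n <= N.+1)%N -> 0 <= B ->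
  (forall k, (m <= k < n)%N -> F k <= B) ->
  \sum_(m <= k < n) F k *+ 'C(N, k) <= 2 ^+ N * B.
Proof.
move=> nN B0 FB; apply: (@le_trans _ _ (\sum_(m <= k < n) B *+ 'C(N, k))).
  by rewrite !big_nat; apply: ler_sum => k mkn; rewrite lerMn2r FB ?orbT.
under eq_bigr do rewrite -mulr_natl.
by rewrite -mulr_suml ler_wpM2r// binomial_row_sum_le.
Qed.

Lemma four_exp (B : R) M : 2 ^+ (2 * M) * B ^+ M = (4 * B) ^+ M.
Proof. by rewrite exprM -exprMn; congr ((_ * _) ^+ _); rewrite expr2; ring. Qed.

(** As [x <= 1 - x], every term with [k >= M] is at most [(x * (1 - x)) ^ M], and the binomial
    coefficients add up to at most [4 ^ M]. The bound below treats the complementary sum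
    symmetrically. *)
Lemma steep_le M x : 0 <= x <= 2^-1 -> steep M x <= (4 * (x * (1 - x))) ^+ M.
Proof.
move=> /andP[x0 x1]; have x2 : 0 <= 1 - x by lra.
rewrite -four_exp; apply: sum_binomial_le => //; first by rewrite exprn_ge0// mulr_ge0.
move=> k /andP[Mk kM].
rewrite -(subnKC Mk) exprD exprMn -mulrA; apply: ler_wpM2l; first exact: exprn_ge0.
apply: (@le_trans _ _ ((1 - x) ^+ (k - M) * (1 - x) ^+ (2 * M - (M + (k - M))))).
  by apply: ler_wpM2r; [exact: exprn_ge0|apply: lerXn2r; rewrite ?nnegrE//; lra].
by rewrite -exprD subnKC// [leLHS](_ : _ = (1 - x) ^+ M)//; congr (_ ^+ _); lia.
Qed.

Lemma steep_ge M x : 2^-1 <= x <= 1 -> 1 - (4 * (x * (1 - x))) ^+ M <= steep M x.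
Proof.
move=> /andP[x1 x2]; have x0 : 0 <= 1 - x by lra.
rewrite -[X in X - _](steep_compl M x).
rewrite -addrA gerDl subr_le0 -four_exp.
apply: sum_binomial_le; [by rewrite leqW// leq_pmull|by rewrite exprn_ge0// mulr_ge0//; lra|].
move=> k /andP[_ kM].
have -> : (2 * M - k = M + (M - k))%N by lia.
rewrite exprD mulrCA exprMn mulrC; apply: ler_wpM2r; first exact: exprn_ge0.
apply: (@le_trans _ _ (x ^+ k * x ^+ (M - k))); last by rewrite -exprD subnKC// ltnW.
by apply: ler_wpM2l; [apply: exprn_ge0; lra|apply: lerXn2r; rewrite ?nnegrE//; lra].
Qed.

Lemma steep_ge0 M x : 0 <= x <= 1 -> 0 <= steep M x.
Proof.
by move=> /andP[x0 x1]; apply: sumr_ge0 => k _; rewrite mulrn_wge0// mulr_ge0// exprn_ge0//; lra.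
Qed.

Lemma steep_le1 M x : 0 <= x <= 1 -> steep M x <= 1.
Proof.
move=> /andP[x0 x1]; rewrite -(steep_compl M x) lerDl.
by apply: sumr_ge0 => k _; rewrite mulrn_wge0// mulr_ge0// exprn_ge0//; lra.
Qed.

End SteepPolynomial.

Section SandwichArithmetic.
Variable R : realType.

(** Bookkeeping for the squeeze at scale [c * x]: [U] is the unknown tail at [x]; [tx], [tcx], [t4]
    are the known tail at [x], [c * x], [c ^ 2 * x]; [s3], [s4] are the integrals of the steep
    polynomial against the unknown and the known measure; [v] is the integral of a power of [xi]
    against the unknown one. *)
Lemma lower_tail_arith (eta eps K th tx tcx t4 s3 s4 U v : R) : 0 < eta <= 8^-1 -> 0 <= eps ->
  eps * (K + 2) <= eta -> th <= eps -> eps <= eta -> 0 <= K -> 0 <= tcx <= tx -> 0 <= t4 ->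
  0 <= v <= (K + 1) * tcx ->
  (1 - th) * t4 <= s4 -> s3 <= U + eps * v -> `|s3 - s4| <= eps * tcx ->
  (1 - eta) * tx <= t4 -> (1 - 8 * eta) * tx <= U.
Proof.
move=> /andP[e0 e1] eps0 epsK the epse K0 /andP[tc0 tct] t40 /andP[v0 vK] h1 h2.
rewrite ler_norml => /andP[h3 _] h4.
have B1 : (1 - eta) * t4 <= s4 by apply: le_trans h1; rewrite ler_wpM2r//; lra.
have B2 : eps * v <= eps * ((K + 1) * tcx) by rewrite ler_wpM2l.
have B4 : eps * (K + 2) * tcx <= eta * tx by apply: ler_pM => //; rewrite mulr_ge0//; lra.
have B5 : (1 - eta) * ((1 - eta) * tx) <= (1 - eta) * t4 by rewrite ler_wpM2l//; lra.
have B6 : (1 - 8 * eta) * tx <= ((1 - eta) * (1 - eta) - eta) * tx.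
  have ee : 0 <= eta * eta by rewrite mulr_ge0// ltW.
  by rewrite ler_wpM2r//; lra.
lra.
Qed.

(** The counterpart at scale [x / c]: [t1], [t2] are the known tail at [x / c] and [x / c ^ 2], and
    [v] now belongs to the known measure. *)
Lemma upper_tail_arith (eta eps K th tx t1 t2 s1 s2 U v : R) : 0 < eta <= 8^-1 -> 0 <= eps ->
  eps * (K + 1) <= eta -> th <= eps -> eps <= eta -> 0 <= K -> 0 <= t1 <= t2 -> 0 <= U ->
  0 <= v <= K * t1 -> 0 <= tx ->
  (1 - th) * U <= s1 -> s2 <= t2 + eps * v -> `|s1 - s2| <= eps * t1 ->
  t2 <= (1 + eta) * tx -> U <= (1 + 8 * eta) * tx.
Proof.
move=> /andP[e0 e1] eps0 epsK the epse K0 /andP[t10 t12] U0 /andP[v0 vK] tx0 h1 h2.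
rewrite ler_norml => /andP[_ h3] h4.
have B1 : (1 - eta) * U <= s1 by apply: le_trans h1; rewrite ler_wpM2r//; lra.
have B2 : eps * v <= eps * (K * t1) by rewrite ler_wpM2l.
have B4 : eps * (K + 1) * t1 <= eta * t2 by apply: ler_pM => //; rewrite mulr_ge0//; lra.
have B5 : (1 + eta) * t2 <= (1 + eta) * ((1 + eta) * tx) by rewrite ler_wpM2l//; lra.
have B6 : (1 + eta) * (1 + eta) * tx <= (1 - eta) * (1 + 8 * eta) * tx.
  have ee : eta * eta <= 8^-1 * eta by rewrite ler_wpM2r// ltW.
  by rewrite ler_wpM2r//; lra.
have B7 : (1 - eta) * U <= (1 - eta) * ((1 + 8 * eta) * tx) by lra.
by move: B7; rewrite ler_pM2l//; lra.
Qed.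

End SandwichArithmetic.

Section Tauber.
Variable R : realType.
Local Notation RT := (measurableTypeR R).
Local Notation D := (@Rnonneg R).
Local Notation mD := (@measurable_Rnonneg R).

Definition xi (y t : R) : R := t ^+ 2 / (t ^+ 2 + y ^+ 2).

Lemma xi_ge0 y t : 0 <= xi y t.
Proof. by rewrite divr_ge0 ?addr_ge0 ?sqr_ge0. Qed.

Lemma xi_le1 y t : xi y t <= 1.
Proof.
have : 0 <= t ^+ 2 + y ^+ 2 by rewrite addr_ge0 ?sqr_ge0.
rewrite le_eqVlt => /predU1P[e|p]; first by rewrite /xi -e invr0 mulr0.
by rewrite ler_pdivrMr// mul1r lerDl sqr_ge0.
Qed.

Lemma xi01 y t : 0 <= xi y t <= 1.
Proof. by rewrite xi_ge0 xi_le1. Qed.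

Lemma measurable_xi y : measurable_fun [set: RT] (xi y).
Proof.
apply: measurable_funM; first exact: exprn_measurable.
apply: measurable_fun_inv_ge0 => [t|]; first by rewrite addr_ge0 ?sqr_ge0.
by apply: measurable_funD; [exact: exprn_measurable|exact: measurable_cst].
Qed.

Lemma xi_min1 y t : 0 < y -> xi y t <= min1 y t ^+ 2.
Proof.
move=> y0; rewrite /min1; have [|_] := leP 1 `|t / y|; first by rewrite expr1n xi_le1.
rewrite real_normK ?num_real// expr_div_n ler_wpM2l ?sqr_ge0//.
by rewrite lef_pV2 ?posrE ?lerDr ?sqr_ge0 ?ltr_wpDl ?sqr_ge0 ?exprn_gt0.
Qed.

Lemma xi_compl y t : 0 < y -> 1 - xi y t = y ^+ 2 / (t ^+ 2 + y ^+ 2).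
Proof.
move=> y0; have : t ^+ 2 + y ^+ 2 != 0 by rewrite gt_eqF// ltr_wpDl ?sqr_ge0 ?exprn_gt0.
by rewrite /xi => H; field.
Qed.

Lemma xi_var_ge0 y t : 0 <= 4 * (xi y t * (1 - xi y t)).
Proof. by rewrite mulr_ge0// mulr_ge0 ?xi_ge0// subr_ge0 xi_le1. Qed.

Lemma integrable_xi_comp (l : {finite_measure set RT -> \bar R}) (f : R -> R) C y :
  measurable_fun [set: RT] f -> (forall x, 0 <= x <= 1 -> `|f x| <= C) ->
  l.-integrable D (EFin \o (fun t => f (xi y t))).
Proof.
move=> mf fC; apply: (@bounded_integrable _ _ _ _ C); first exact: mD.
- by apply: measurableT_comp => //; exact: measurable_xi.
- by move=> t _; apply: fC; exact: xi01.
Qed.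

(* The value of [4 xi (1 - xi)] at [t = c y]. *)
Definition theta (c : R) := 4 * c ^+ 2 / (1 + c ^+ 2) ^+ 2.

Lemma theta_ge0 c : 0 <= theta c.
Proof. by rewrite divr_ge0 ?sqr_ge0// mulr_ge0 ?sqr_ge0. Qed.

Lemma theta_lt1 c : 1 < c -> theta c < 1.
Proof.
move=> c1; have c2 : 1 < c ^+ 2 by rewrite exprn_egt1.
rewrite ltr_pdivrMr ?mul1r; last by rewrite exprn_gt0//; lra.
have : 0 < (c ^+ 2 - 1) ^+ 2 by rewrite exprn_gt0//; lra.
by rewrite !expr2; lra.
Qed.

(** Since [xi * (1 - xi) = (t * y / (t ^ 2 + y ^ 2)) ^ 2], the claim amounts to
    [(c * t - y) * (t - c * y) >= 0], which holds off the window between [y / c] and [c * y]. *)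
Lemma xi_theta (c y t : R) : 1 < c -> 0 < y -> 0 <= t -> (c * t <= y) || (c * y <= t) ->
  4 * (xi y t * (1 - xi y t)) <= theta c.
Proof.
move=> c1 y0 t0 H; rewrite xi_compl// /xi /theta.
have c_ge0 : 0 <= c by lra.
have s0 : 0 < t ^+ 2 + y ^+ 2 by rewrite ltr_wpDl ?sqr_ge0 ?exprn_gt0.
have c0 : 0 < 1 + c ^+ 2 by rewrite ltr_pwDl ?sqr_ge0.
have -> : 4 * (t ^+ 2 / (t ^+ 2 + y ^+ 2) * (y ^+ 2 / (t ^+ 2 + y ^+ 2))) =
    4 * (t * y / (t ^+ 2 + y ^+ 2)) ^+ 2 by field; rewrite gt_eqF.
have -> : 4 * c ^+ 2 / (1 + c ^+ 2) ^+ 2 = 4 * (c / (1 + c ^+ 2)) ^+ 2.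
  by field; rewrite gt_eqF.
rewrite ler_wpM2l// lerXn2r ?nnegrE ?divr_ge0 ?mulr_ge0 ?(ltW s0) ?(ltW c0) ?(ltW y0)//.
rewrite ler_pdivrMr// mulrAC ler_pdivlMr//.
have : 0 <= (c * t - y) * (t - c * y).
  have tct : t <= c * t by rewrite ler_peMl// ltW.
  have ycy : y <= c * y by rewrite ler_peMl// ltW.
  case/orP: H => H; first by rewrite mulr_le0//; lra.
  by rewrite mulr_ge0//; lra.
by rewrite !expr2; lra.
Qed.

Lemma measurable_steep M : measurable_fun [set: RT] (@steep R M).
Proof.
rewrite /steep; elim: (index_iota _ _) => [|k s IH].
  by under eq_fun do rewrite big_nil; exact: measurable_cst.
under eq_fun do rewrite big_cons -mulr_natl.
apply: measurable_funD => //; apply: measurable_funM; first exact: measurable_cst.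
apply: measurable_funM; first exact: exprn_measurable.
by apply: measurable_funX; apply: measurable_funB => //; exact: measurable_cst.
Qed.

Section Sandwich.
Variables (h : {finite_measure set RT -> \bar R}) (M n : nat) (c y : R).

Let ist : h.-integrable D (EFin \o (fun t => steep M (xi y t))).
Proof.
apply: (@integrable_xi_comp h _ 1); [exact: measurable_steep|move=> x x01].
by rewrite ger0_norm ?steep_ge0 ?steep_le1.
Qed.

Let ixi : h.-integrable D (EFin \o (fun t => xi y t ^+ n)).
Proof.
apply: (@integrable_xi_comp h (fun x => x ^+ n) 1); first exact: exprn_measurable.
by move=> x /andP[x0 x1]; rewrite ger0_norm ?exprn_ge0// exprn_ile1.
Qed.

(** Below [y / c] the bound [theta c ^ M] alone would leave an error proportional to the total mass,
    far larger than the tail. Keeping [n] of the [M] factors as powers of [xi] makes the error a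
    small multiple of an integral that is [O] of the tail. *)
Lemma steep_integral_le : 1 < c -> 0 < y -> (n <= M)%N -> \int[h]_(t in D) steep M (xi y t) <=
  tail h (y / c) + theta c ^+ (M - n) * 4 ^+ n * \int[h]_(t in D) xi y t ^+ n.
Proof.
move=> c1 y0 nM; have c0 : 0 < c by lra.
rewrite -Rintegral_tail ?divr_ge0 ?(ltW y0) ?(ltW c0)// -RintegralZl//; last exact: mD.
rewrite -RintegralD; [|exact: mD|exact: integrable_tail|exact: integrableZ mD _ _ ixi].
apply: le_Rintegral; [exact: mD|exact: ist| |].
  by apply: integrable_add; [exact: mD|exact: integrable_tail|exact: integrableZ mD _ _ ixi].
move=> t; rewrite /Rnonneg /= in_itv /= andbT => t0.
rewrite indicE; have [_|] := boolP (t \in _).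
  rewrite ler_wpDr ?steep_le1 ?xi01// !mulr_ge0 ?exprn_ge0 ?theta_ge0 ?xi_ge0//.
rewrite notin_setE /= in_itv /= andbT => /negP; rewrite -leNgt => ty.
have cty : c * t <= y by move: ty; rewrite ler_pdivlMr// mulrC.
have ty' : t <= y by apply: le_trans cty; rewrite ler_peMl// ltW.
have x2 : xi y t <= 2^-1.
  rewrite ler_pdivrMr ?ltr_wpDl ?sqr_ge0 ?exprn_gt0//.
  have : t ^+ 2 <= y ^+ 2 by rewrite lerXn2r ?nnegrE// ltW.
  lra.
rewrite add0r; apply: le_trans (steep_le _ _) _; first by rewrite xi_ge0.
have B := xi_theta c1 y0 t0 (introT orP (or_introl cty)).
rewrite -{1}(subnK nM) exprD -mulrA; apply: ler_pM.
- by rewrite exprn_ge0// xi_var_ge0.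
- by rewrite exprn_ge0// xi_var_ge0.
- by rewrite lerXn2r ?nnegrE ?theta_ge0 ?xi_var_ge0.
- rewrite -exprMn lerXn2r ?nnegrE ?xi_var_ge0//; first by rewrite mulr_ge0 ?xi_ge0.
  by rewrite ler_wpM2l// ler_piMr ?xi_ge0// gerBl xi_ge0.
Qed.

Lemma steep_integral_ge : 1 < c -> 0 < y ->
  (1 - theta c ^+ M) * tail h (c * y) <= \int[h]_(t in D) steep M (xi y t).
Proof.
move=> c1 y0; have c0 : 0 < c by lra.
rewrite -Rintegral_tail ?mulr_ge0 ?(ltW y0) ?(ltW c0)// -RintegralZl; [|exact: mD|exact: integrable_tail].
apply: le_Rintegral; [exact: mD| |exact: ist|].
  by apply: integrableZ; [exact: mD|exact: integrable_tail].
move=> t; rewrite /Rnonneg /= in_itv /= andbT => t0.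
rewrite indicE; have [|_] := boolP (t \in _); last by rewrite mulr0 steep_ge0 ?xi01.
rewrite inE /= in_itv /= andbT => /ltW cyt.
rewrite mulr1; apply: le_trans (steep_ge _ _); last first.
  rewrite xi_le1 andbT /xi ler_pdivlMr ?ltr_wpDl ?sqr_ge0 ?exprn_gt0//.
  have : y ^+ 2 <= t ^+ 2.
    by rewrite lerXn2r ?nnegrE ?(ltW y0)// (le_trans _ cyt)// ler_peMl ?ltW.
  lra.
have B := xi_theta c1 y0 t0 (introT orP (or_intror cyt)).
by rewrite lerD2l lerN2 lerXn2r ?nnegrE ?theta_ge0 ?xi_var_ge0.
Qed.

End Sandwich.

Variables (l r : {finite_measure set RT -> \bar R}) (m : nat).
Local Notation T := (tail l).

(** Measurability and boundedness are included so that integrals split and the class is closed under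
    linear combinations. *)
Definition same_moments (f : R -> R) :=
  [/\ measurable_fun [set: RT] f, exists C : R, forall x : R, 0 <= x <= 1 -> `|f x| <= C &
   oinf (fun y => \int[r]_(t in D) f (xi y t) - \int[l]_(t in D) f (xi y t)) T].

Lemma same_moments_ext f g : f =1 g -> same_moments f -> same_moments g.
Proof. by move=> /funext ->. Qed.

Lemma same_moments_int f y : same_moments f ->
  r.-integrable D (EFin \o (fun t => f (xi y t))) /\
  l.-integrable D (EFin \o (fun t => f (xi y t))).
Proof. by move=> [mf [C fC] _]; split; exact: integrable_xi_comp fC. Qed.

Lemma same_momentsD f g : same_moments f -> same_moments g ->
  same_moments (fun x => f x + g x).
Proof.
move=> fm gm; have [mf [C fC] fo] := fm; have [mg [C' gC'] go] := gm; split.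
- exact: measurable_funD.
- exists (C + C') => x x01; apply: le_trans (ler_normD _ _) _.
  by rewrite lerD ?fC ?gC'.
- apply: oinf_ext (oinfD fo go) => y.
  have [rf lf] := same_moments_int y fm; have [rg lg] := same_moments_int y gm.
  by rewrite !RintegralD; try exact: mD; try by []; rewrite opprD addrACA.
Qed.

Lemma same_momentsZ (c : R) f : same_moments f -> same_moments (fun x => c * f x).
Proof.
move=> fm; have [mf [C fC] fo] := fm; split.
- by apply: measurable_funM => //; exact: measurable_cst.
- by exists (`|c| * C) => x x01; rewrite normrM ler_wpM2l// fC.
- apply: oinf_ext (oinfZ c fo) => y; have [rf lf] := same_moments_int y fm.
  by rewrite mulrBr !RintegralZl; try exact: mD.
Qed.

Hypothesis xiX : forall k, (m <= k)%N ->
  oinf (fun y => \int[r]_(t in D) xi y t ^+ k - \int[l]_(t in D) xi y t ^+ k) T.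

(** A factor [1 - x] is expanded as a difference, which only raises the exponent of [x]: the
    induction never leaves the exponents [k >= m] for which the comparison is known. *)
Lemma same_momentsX k j : (m <= k)%N -> same_moments (fun x => x ^+ k * (1 - x) ^+ j).
Proof.
elim: j k => [|j IH] k mk.
  apply: (@same_moments_ext (fun x => x ^+ k)); first by move=> x; rewrite mulr1.
  split; [exact: exprn_measurable| |exact: xiX].
  by exists 1 => x /andP[x0 x1]; rewrite ger0_norm ?exprn_ge0// exprn_ile1.
apply: same_moments_ext (same_momentsD (IH k mk) (same_momentsZ (-1) (IH k.+1 (leqW mk)))) => x.
by rewrite !exprS; ring.
Qed.

Lemma same_moments_sum I (s : seq I) (f : I -> R -> R) :
  (forall i, same_moments (f i)) -> same_moments (fun x => \sum_(i <- s) f i x).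
Proof.
move=> sf; elim: s => [|i s IH].
  apply: same_moments_ext (same_momentsZ 0 (same_momentsX 0 (leqnn m))) => x.
  by rewrite mul0r big_nil.
by apply: same_moments_ext (same_momentsD (sf i) IH) => x; rewrite big_cons.
Qed.

Lemma same_moments_steep M : (m <= M)%N -> same_moments (@steep R M).
Proof.
move=> mM.
have : same_moments (fun x => \sum_(0 <= k < (2 * M).+1 - M)
    'C(2 * M, k + M)%:R * (x ^+ (k + M) * (1 - x) ^+ (2 * M - (k + M)))).
  apply: same_moments_sum => k; apply: same_momentsZ; apply: same_momentsX.
  exact: leq_trans mM (leq_addl _ _).
apply: same_moments_ext => x.
have := big_addn 0 (2 * M).+1 M xpredT
  (fun k => x ^+ k * (1 - x) ^+ (2 * M - k) *+ 'C(2 * M, k)).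
rewrite add0n => E; rewrite /steep [RHS]E.
by apply: eq_bigr => k _; rewrite mulr_natl.
Qed.

Lemma exists_theta_exp (c e : R) n : 1 < c -> 0 < e ->
  exists2 M, (n <= M)%N & theta c ^+ M <= e /\ theta c ^+ (M - n) * 4 ^+ n <= e.
Proof.
move=> c1 e0; have t1 : `|theta c| < 1 by rewrite ger0_norm ?theta_ge0 ?theta_lt1.
have e4 : 0 < e / 4 ^+ n by rewrite divr_gt0 ?exprn_gt0.
have [N _ HN] := cvgr_le _ (cvg_expr t1) _ e4.
exists (n + N)%N; first exact: leq_addr.
have := HN N (leqnn N); rewrite /= ler_pdivlMr ?exprn_gt0// => H.
have -> : (n + N - n = N)%N by lia.
split => //; apply: le_trans H; rewrite exprD mulrC ler_wpM2l ?exprn_ge0 ?theta_ge0//.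
apply: (@le_trans _ _ 1); first by rewrite exprn_ile1 ?theta_ge0 ?ltW ?theta_lt1.
by rewrite exprn_ege1// ler1n.
Qed.

Lemma tail_asymp_of_moments (alpha : R) : 0 <= alpha ->
  regularly_varying_tail l (- alpha) ->
  Oinf (fun y => \int[l]_(t in D) xi y t ^+ m) T ->
  asymp_equiv (tail r) T.
Proof.
move=> a0 rv [K K0 HK].
apply/cvgrPdist_le => e e0.
(* The two bookkeeping lemmas lose [8 * eta] and require [eta <= 8^-1]. *)
pose eta := Num.min e 1 / 8.
have m0 : 0 < Num.min e 1 by rewrite lt_min e0 ltr01.
have m1 : Num.min e 1 <= 1 by rewrite ge_min lexx orbT.
have me : Num.min e 1 <= e by rewrite ge_min lexx.
have eta0 : 0 < eta by rewrite /eta; lra.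
have eta1 : eta <= 8^-1 by rewrite /eta; lra.
have eta8 : 8 * eta <= e by rewrite /eta; lra.
clearbody eta.
(* With this exponent [(c ^ 2) ^ alpha] is [1 + eta] to the power [2 alpha / (2 alpha + 1) < 1],
   also when [alpha = 0]: across a window of ratio [c ^ 2] the known tail changes by a factor within
   [eta] of [1]. *)
pose g := (2 * alpha + 1)^-1.
pose c := (1 + eta) `^ g.
have g0 : 0 < g by rewrite invr_gt0; lra.
have c0 : 0 < c by rewrite powR_gt0; lra.
have powlt (u v : R) : u < v -> (1 + eta) `^ u < (1 + eta) `^ v.
  move=> uv; rewrite /powR ifF; last by apply/negbTE; lra.
  rewrite ifF; last by apply/negbTE; lra.
  by rewrite ltr_expR ltr_pM2r// ln_gt0//; lra.
have c1 : 1 < c by rewrite -(powRr0 (1 + eta)); exact: powlt.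
have cB : (c ^+ 2) `^ alpha < 1 + eta.
  rewrite /c -powR_mulrn ?powR_ge0// -!powRrM -[X in _ < X]powRr1; last lra.
  apply: powlt; rewrite /g mulrC ltr_pdivrMr ?mul1r; lra.
have cB0 : 0 < (c ^+ 2) `^ alpha by apply: powR_gt0; exact: exprn_gt0.
have cBV : 1 - eta < ((c ^+ 2) `^ alpha)^-1.
  apply: (@lt_trans _ _ (1 + eta)^-1); last by rewrite ltf_pV2 ?posrE// addr_gt0.
  rewrite -[X in _ < X]mul1r ltr_pdivlMr ?addr_gt0//.
  by rewrite -subr_sqr expr1n ltrBlDr ltrDl exprn_gt0.
pose eps := eta / (K + 3).
have eps0 : 0 < eps by rewrite divr_gt0//; lra.
have epsK : eps * (K + 3) = eta by rewrite divfK//; lra.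
have epsK1 : eps * (K + 1) <= eta by rewrite -epsK ler_wpM2l ?(ltW eps0)//; lra.
have epsK2 : eps * (K + 2) <= eta by rewrite -epsK ler_wpM2l ?(ltW eps0)//; lra.
have eps_eta : eps <= eta by rewrite -epsK -[X in X <= _]mulr1 ler_wpM2l ?(ltW eps0)//; lra.
have [M mM [th1 th2]] := exists_theta_exp m c1 eps0.
have [_ _ Sm] := same_moments_steep mM.
have [x0 x00 H] : exists2 x0 : R, 0 < x0 & forall y, x0 <= y ->
   [/\ `|\int[r]_(t in D) steep M (xi y t) - \int[l]_(t in D) steep M (xi y t)| <= eps * T y,
      \int[l]_(t in D) xi y t ^+ m <= K * T y &
      \int[r]_(t in D) xi y t ^+ m <= (K + 1) * T y].
  apply: near_pinfty_ge; near=> y.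
  have A1 : `|\int[l]_(t in D) xi y t ^+ m| <= K * T y by near: y.
  have A2 : `|\int[r]_(t in D) xi y t ^+ m - \int[l]_(t in D) xi y t ^+ m| <= 1 * T y.
    by near: y; exact: xiX.
  split; first by near: y; exact: Sm.
    exact: le_trans (ler_norm _) A1.
  by move: A1 A2; clear; rewrite !ler_norml => /andP[? ?] /andP[? ?]; lra.
near=> x.
have xc : x0 * c <= x by near: x; apply: nbhs_pinfty_ge; exact: num_real.
have xx : x0 <= x by near: x; apply: nbhs_pinfty_ge; exact: num_real.
have Tx : 0 < T x by near: x; exact: tail_gt0 rv.
have xgt0 : 0 < x by exact: lt_le_trans x00 xx.
have R1 : T ((c ^+ 2)^-1 * x) <= (1 + eta) * T x.
  near: x; apply: (tail_ratio_le rv); first by rewrite invr_gt0 exprn_gt0.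
  by rewrite -powR_inv1 ?exprn_ge0 ?(ltW c0)// -powRrM mulrNN mul1r.
have R2 : (1 - eta) * T x <= T (c ^+ 2 * x).
  near: x; apply: (tail_ratio_ge rv); first by rewrite exprn_gt0.
  by rewrite powRN.
have U0 : 0 <= tail r x by exact: tail_ge0.
have xic : x0 <= x / c by rewrite ler_pdivlMr.
have xcx : x <= c * x by exact: ler_peMl (ltW xgt0) (ltW c1).
have [P1 P2 P3] := H _ xic.
have [Q1 Q2 Q3] := H (c * x) (le_trans xx xcx).
(* The scale [x / c], with window from [x / c ^ 2] to [x], bounds the unknown tail from above; the
   scale [c * x], with window from [x] to [c ^ 2 * x], bounds it from below. *)
have I1 := @steep_integral_ge r M c (x / c) c1 (divr_gt0 xgt0 c0).
have I2 := @steep_integral_le l M m c (x / c) c1 (divr_gt0 xgt0 c0) mM.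
have J1 := @steep_integral_ge l M c (c * x) c1 (mulr_gt0 c0 xgt0).
have J2 := @steep_integral_le r M m c (c * x) c1 (mulr_gt0 c0 xgt0) mM.
move: I1 I2 J1 J2.
have -> : c * (x / c) = x by rewrite mulrCA mulfV ?mulr1// gt_eqF.
have -> : x / c / c = (c ^+ 2)^-1 * x by rewrite -mulrA -invfM mulrC expr2.
have -> : c * (c * x) = c ^+ 2 * x by rewrite mulrA expr2.
have -> : c * x / c = x by rewrite mulrAC mulfV ?mul1r// gt_eqF.
move: P1 P2 P3 Q1 Q2 Q3.
have Txc : T (x / c) <= T ((c ^+ 2)^-1 * x).
  apply: tail_nonincreasing; rewrite [leRHS]mulrC ler_wpM2r ?(ltW xgt0)//.
  by rewrite lef_pV2 ?posrE ?exprn_gt0// expr2 ler_peMl ?ltW.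
have Tcx : T (c * x) <= T x by exact: tail_nonincreasing.
have Tc0 := tail_ge0 l (c * x).
have Tc1 := tail_ge0 l (x / c).
have Tc2 := tail_ge0 l (c ^+ 2 * x).
have V1 : 0 <= \int[l]_(t in D) xi (x / c) t ^+ m.
  by apply: Rintegral_ge0 => t _; rewrite exprn_ge0 ?xi_ge0.
have V2 : 0 <= \int[r]_(t in D) xi (c * x) t ^+ m.
  by apply: Rintegral_ge0 => t _; rewrite exprn_ge0 ?xi_ge0.
set s1 := \int[r]_(t in D) steep M _; set s2 := \int[l]_(t in D) steep M _.
set s3 := \int[r]_(t in D) steep M _; set s4 := \int[l]_(t in D) steep M _.
move: V1 V2.
set v1 := \int[l]_(t in D) _; set v2 := \int[l]_(t in D) _.
set v3 := \int[r]_(t in D) _; set v4 := \int[r]_(t in D) _.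
move=> V1 V4 P1 P2 P3 Q1 Q2 Q3 I1 I2 J1 J2.
have e01 : 0 < eta <= 8^-1 by rewrite eta0 eta1.
have lo : (1 - 8 * eta) * T x <= tail r x.
  apply: (lower_tail_arith e01 (ltW eps0) epsK2 th1 eps_eta (ltW K0) _ _ _ J1 _ Q1 R2).
  - by rewrite Tc0 Tcx.
  - exact: Tc2.
  - by apply/andP; split; [exact: V4|exact: Q3].
  - by apply: le_trans J2 _; rewrite lerD2l ler_wpM2r.
have hi : tail r x <= (1 + 8 * eta) * T x.
  apply: (upper_tail_arith e01 (ltW eps0) epsK1 th1 eps_eta (ltW K0) _ U0 _ (ltW Tx) I1 _ P1 R1).
  - by rewrite Tc1 Txc.
  - by apply/andP; split; [exact: V1|exact: P2].
  - by apply: le_trans I2 _; rewrite lerD2l ler_wpM2r.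
clear -lo hi eta8 Tx.
rewrite distrC ler_norml; apply/andP; split.
  rewrite lerBrDr ler_pdivlMr//; apply: le_trans lo.
  by rewrite ler_wpM2r ?(ltW Tx)//; lra.
rewrite lerBlDr ler_pdivrMr//; apply: le_trans hi _.
by rewrite ler_wpM2r ?(ltW Tx)//; lra.
Unshelve. all: by end_near. Qed.

End Tauber.

(** * From the first moment to all high moments *)

(** Multiplying by [Y] before taking the difference shortens the range of exponents by one: [Y ^ -1]
    disappears, and [Y ^ -(k + 1)] leaves only the powers [a ^ -1, ..., a ^ -k], to which the
    induction on the number of nodes applies. *)
Lemma divided_difference_expV (F : fieldType) (a b : F) k : a != 0 -> b != 0 -> a - b != 0 ->
  (a * a^-1 ^+ k.+1 - b * b^-1 ^+ k.+1) / (a - b) =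
  - \sum_(i < k) b^-1 ^+ i.+1 * a^-1 ^+ (k - i).
Proof.
move=> a0 b0 ab0; rewrite !exprS !mulVKf// subrXX.
have -> : a^-1 - b^-1 = - (a - b) * (a^-1 * b^-1) by field; rewrite a0 b0.
have -> : \sum_(i < k) b^-1 ^+ i.+1 * a^-1 ^+ (k - i) =
    (a^-1 * b^-1) * \sum_(i < k) a^-1 ^+ (k.-1 - i) * b^-1 ^+ i.
  rewrite mulr_sumr; apply: eq_bigr => i _.
  have -> : (k - i = (k.-1 - i).+1)%N by have := ltn_ord i; lia.
  by rewrite !exprS; ring.
by field; rewrite ab0 a0 b0.
Qed.

Section DividedDifferences.
Variable R : realType.
Variable th : nat -> R.
Hypothesis th0 : forall j, 0 < th j.
Hypothesis thI : injective th.

(* The weights of the [n]-th divided difference at the nodes [th], applied to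
   [Y |-> Y ^ n f(Y)]: they annihilate [Y^-1, ..., Y^-n]. *)
Lemma exists_divided_difference n : exists c : nat -> R,
  (forall k, (0 < k <= n)%N -> \sum_(j < n.+1) c j * (th j)^-1 ^+ k = 0) /\
  (forall v, 0 <= v -> \sum_(j < n.+1) c j * (v / (v + th j)) =
     v ^+ n.+1 / \prod_(j < n.+1) (v + th j)).
Proof.
have vth v j : 0 <= v -> v + th j != 0 by move=> v0; rewrite gt_eqF// ltr_wpDl.
have thN j : th j != 0 by rewrite gt_eqF.
elim: n => [|n [c [c1 c2]]].
  exists (fun=> 1); split; first by case.
  by move=> v v0; rewrite !big_ord1 mul1r expr1.
have thD (j : 'I_n.+1) : th j - th n.+1 != 0.
  by rewrite subr_eq0; apply/negP => /eqP/thI E; have := ltn_ord j; rewrite E ltnn.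
pose w := th n.+1.
(* Applying [d] to [F] means applying [c] to the first divided difference of [Y * F(Y)] between each
   old node and the new node [w]. *)
pose d j := if (j < n.+1)%N then c j * th j / (th j - w)
            else - \sum_(i < n.+1) c i * w / (th i - w).
have dE (F : nat -> R) : \sum_(j < n.+2) d j * F j =
    \sum_(j < n.+1) c j * ((th j * F j - w * F n.+1) / (th j - w)).
  rewrite big_ord_recr /= {2}/d ltnn mulNr mulr_suml -sumrB.
  apply: eq_bigr => j _; rewrite /d ltn_ord /w; field.
  exact: thD.
exists d; split.
  move=> k /andP[k0 kn]; rewrite (dE (fun j => (th j)^-1 ^+ k)).
  case: k k0 kn => // k _; rewrite ltnS => kn.
  have E (j : 'I_n.+1) := divided_difference_expV k (thN j) (thN n.+1) (thD j).
  under eq_bigr do rewrite E mulrN mulr_sumr.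
  rewrite sumrN exchange_big /= big1 ?oppr0// => i _.
  under eq_bigr do rewrite mulrCA.
  rewrite -mulr_sumr c1 ?mulr0//; have := ltn_ord i; lia.
move=> v v0; rewrite (dE (fun j => v / (v + th j))).
(* The same operation on [v / (v + Y)] merely extracts the factor [v / (v + w)], so each new node
   contributes one factor to the product. *)
have E (j : 'I_n.+1) : (th j * (v / (v + th j)) - w * (v / (v + th n.+1))) / (th j - w) =
    v / (v + w) * (v / (v + th j)).
  rewrite /w; field; rewrite !vth//= thD//.
under eq_bigr do rewrite E mulrCA.
rewrite -mulr_sumr c2// [in RHS]big_ord_recr /= [in RHS]exprS -/w.
have : \prod_(j < n.+1) (v + th j) != 0 by apply/prodf_neq0 => j _; exact: vth.
set P := \prod_(j < n.+1) _ => P0.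
by field; rewrite P0 vth.
Qed.

End DividedDifferences.

Lemma inv_sqr_le (R : realType) (e : R) : 0 < e -> \forall y \near +oo, y^-1 ^+ 2 <= e.
Proof.
move=> e0; near=> y; have y0 : 0 < y by near: y; exact: nbhs_pinfty_gt.
have y1 : y^-1 <= Num.min 1 e by near: y; apply: cvg_inv_small; rewrite lt_min ltr01.
move: y1; rewrite le_min => /andP[y1 ye].
by rewrite expr2 (le_trans _ ye)// ler_piMl// invr_ge0 ltW.
Unshelve. all: by end_near. Qed.

Section KernelBounds.
Variable R : realType.
Implicit Types e y t c : R.

Lemma oinf_scale (f T : R -> R) (c : R) : 1 <= c ->
  (forall x y, x <= y -> T y <= T x) -> oinf f T -> oinf (fun y => f (c * y)) T.
Proof.
move=> c1 Tm fT e e0; have [x0 x00 H] := near_pinfty_ge (fT e e0).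
near=> y; have xy : x0 <= y by near: y; apply: nbhs_pinfty_ge; exact: num_real.
have ycy : y <= c * y by rewrite ler_peMl//; lra.
apply: le_trans (H _ (le_trans xy ycy)) _.
by rewrite ler_wpM2l ?(ltW e0)// Tm.
Unshelve. all: by end_near. Qed.

Lemma oinf_sum I (s : seq I) (f : I -> R -> R) (T : R -> R) : (forall y, 0 <= T y) ->
  (forall i, oinf (f i) T) -> oinf (fun y => \sum_(i <- s) f i y) T.
Proof.
move=> T0 fT; elim: s => [|i s IH].
  by move=> e e0; apply: nearW => y; rewrite big_nil normr0 mulr_ge0 ?(ltW e0).
apply: oinf_ext (oinfD (fT i) IH) => y.
by rewrite big_cons.
Qed.

(** Divided differences need distinct nodes, whereas a pure power of [xi] would need all of them
    equal to [1]. Within distance [e] of [1], the kernel with [n + 1] nodes is [xi ^ (n + 1)] up to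
    the factor [1 - (n + 1) * e]. *)
Definition node (e : R) (j : nat) : R := 1 + e / j.+1%:R.

Lemma node_inj e : 0 < e -> injective (node e).
Proof.
move=> e0 i j /addrI /(mulfI (lt0r_neq0 e0)) /invr_inj /eqP.
by rewrite eqr_nat eqSS => /eqP.
Qed.

Lemma node_itv e j : 0 < e -> 1 <= node e j <= 1 + e.
Proof.
move=> e0; rewrite /node lerDl divr_ge0 ?(ltW e0)//= lerD2l.
by rewrite ler_pdivrMr// ler_peMr ?(ltW e0)// ler1n.
Qed.

Lemma bernoulli_exp (e : R) n : 0 <= e <= 1 -> 1 - n%:R * e <= (1 - e) ^+ n.
Proof.
move=> /andP[e0 e1]; elim: n => [|n IH]; first by rewrite mul0r subr0.
rewrite exprS; apply: (@le_trans _ _ ((1 - e) * (1 - n%:R * e))); last by rewrite ler_wpM2l//; lra.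
have ne : 0 <= n%:R * (e * e) by rewrite !mulr_ge0.
by rewrite -natr1; lra.
Qed.

Definition kern (e : R) n (y t : R) := ((t / y) ^+ 2) ^+ n.+1 /
  \prod_(j < n.+1) ((t / y) ^+ 2 + node e j).

(** One power of [(t / y) ^ 2] fewer than in [kern]: this is what the divided difference makes of
    the term of [moment_gap] carrying [y ^ -2]. *)
Definition kern' (e : R) n (y t : R) := ((t / y) ^+ 2) ^+ n /
  \prod_(j < n.+1) ((t / y) ^+ 2 + node e j).

Lemma xi_div y t : 0 < y -> xi y t = (t / y) ^+ 2 / ((t / y) ^+ 2 + 1).
Proof.
move=> y0; have y1 : y != 0 by rewrite gt_eqF.
have H : t ^+ 2 + y ^+ 2 != 0 by rewrite gt_eqF// ltr_wpDl ?sqr_ge0 ?exprn_gt0.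
by rewrite /xi; field; rewrite H y1.
Qed.

Lemma xi_scale (c y t : R) : 0 < y -> 0 < c ->
  xi (Num.sqrt c * y) t = (t / y) ^+ 2 / ((t / y) ^+ 2 + c).
Proof.
move=> y0 c0; have y1 : y != 0 by rewrite gt_eqF.
have H : t ^+ 2 + c * y ^+ 2 != 0 by rewrite gt_eqF// ltr_wpDl ?sqr_ge0 ?mulr_gt0 ?exprn_gt0.
by rewrite /xi exprMn sqr_sqrtr ?(ltW c0)//; field; rewrite H y1.
Qed.

Lemma kernE e n y t : kern e n y t =
  \prod_(j < n.+1) ((t / y) ^+ 2 / ((t / y) ^+ 2 + node e j)).
Proof. by rewrite /kern prodf_div prodr_const card_ord. Qed.

Lemma node_gt0 e j : 0 < e -> 0 < node e j.
Proof. by move=> /(node_itv j) /andP[+ _]; lra. Qed.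

Lemma kern_ge0 e n y t : 0 < e -> 0 <= kern e n y t.
Proof.
move=> e0; rewrite kernE; apply: prodr_ge0 => j _.
by rewrite divr_ge0 ?sqr_ge0// addr_ge0 ?sqr_ge0// ltW// node_gt0.
Qed.

Lemma kern'_ge0 e n y t : 0 < e -> 0 <= kern' e n y t.
Proof.
move=> e0; apply: divr_ge0; first by rewrite exprn_ge0// sqr_ge0.
apply: prodr_ge0 => j _.
by rewrite addr_ge0 ?sqr_ge0// ltW// node_gt0.
Qed.

Lemma frac_node_le (v c : R) : 0 <= v -> 1 <= c -> 0 <= v / (v + c) <= v / (v + 1).
Proof.
move=> v0 c1; have vc : 0 < v + c by lra.
have v1 : 0 < v + 1 by lra.
rewrite divr_ge0 ?(ltW vc)//= ler_wpM2l// lef_pV2 ?posrE//; lra.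
Qed.

Lemma frac_node_ge (v c e : R) : 0 <= v -> 0 <= e <= 1 -> 1 <= c <= 1 + e ->
  0 <= (1 - e) * (v / (v + 1)) <= v / (v + c).
Proof.
move=> v0 /andP[e0 e1] /andP[c1 c2]; have vc : 0 < v + c by lra.
have v1 : 0 < v + 1 by lra.
have e2 : 0 <= 1 - e by lra.
rewrite mulr_ge0 ?divr_ge0 ?(ltW v1)//= mulrCA ler_wpM2l// ler_pdivrMr//.
rewrite mulrC ler_pdivlMr//.
have ev : 0 <= e * v by exact: mulr_ge0.
have ee : 0 <= e * e by exact: mulr_ge0.
apply: (@le_trans _ _ ((1 - e) * (v + (1 + e)))); last lra.
by rewrite ler_wpM2l//; lra.
Qed.

Lemma kern_le e n y t : 0 < e -> 0 < y -> kern e n y t <= xi y t ^+ n.+1.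
Proof.
move=> e0 y0; rewrite kernE xi_div// -[n.+1 in X in _ <= X]card_ord -prodr_const.
apply: ler_prod => j _; have /andP[n1 _] := node_itv j e0.
exact: frac_node_le (sqr_ge0 _) n1.
Qed.

Lemma kern'_le e n y t : 0 < e -> 0 < y -> kern' e n y t <= xi y t ^+ n.
Proof.
move=> e0 y0; rewrite /kern' big_ord_recr /= invfM mulrA xi_div//.
have v0 : 0 <= (t / y) ^+ 2 := sqr_ge0 _.
have pr : ((t / y) ^+ 2) ^+ n / \prod_(j < n) ((t / y) ^+ 2 + node e j) =
    \prod_(j < n) ((t / y) ^+ 2 / ((t / y) ^+ 2 + node e j)).
  by rewrite prodf_div prodr_const card_ord.
rewrite pr; apply: (@le_trans _ _ (\prod_(j < n) ((t / y) ^+ 2 / ((t / y) ^+ 2 + node e j)))).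
  have /andP[n1 _] := node_itv n e0.
  have vn : 1 <= (t / y) ^+ 2 + node e n by rewrite ler_wpDl.
  rewrite ler_piMr ?invf_le1 ?(lt_le_trans _ vn)//.
  apply: prodr_ge0 => j _; have /andP[j1 _] := node_itv j e0.
  by have /andP[] := frac_node_le v0 j1.
rewrite -[n in X in _ <= X]card_ord -prodr_const.
apply: ler_prod => j _; have /andP[n1 _] := node_itv j e0.
exact: frac_node_le v0 n1.
Qed.

Lemma kern_ge e n y t : 0 < e <= 1 -> 0 < y ->
  (1 - n.+1%:R * e) * xi y t ^+ n.+1 <= kern e n y t.
Proof.
move=> /andP[e0 e1] y0; apply: (@le_trans _ _ ((1 - e) ^+ n.+1 * xi y t ^+ n.+1)).
  by rewrite ler_wpM2r ?exprn_ge0 ?xi_ge0// bernoulli_exp// e1 ltW.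
rewrite -exprMn kernE xi_div// -[n.+1 in X in X <= _]card_ord -prodr_const.
by apply: ler_prod => j _; apply: frac_node_ge; [exact: sqr_ge0|rewrite e1 ltW|exact: node_itv].
Qed.

Lemma measurable_kern_factor e j y : 0 < e ->
  measurable_fun [set: measurableTypeR R] (fun t => ((t / y) ^+ 2 + node e j)^-1).
Proof.
move=> e0; apply: measurable_fun_inv_ge0 => [t|].
  by rewrite addr_ge0 ?sqr_ge0// ltW// node_gt0.
apply: measurable_funD; last exact: measurable_cst.
by apply: measurable_funX; exact: mulrr_measurable.
Qed.

Lemma measurable_kern_prod e n y : 0 < e ->
  measurable_fun [set: measurableTypeR R]
    (fun t => (\prod_(j < n) ((t / y) ^+ 2 + node e j))^-1).
Proof.
move=> e0; elim: n => [|n IH].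
  by under eq_fun do rewrite big_ord0; exact: measurable_cst.
under eq_fun do rewrite big_ord_recr invfM.
by apply: measurable_funM => //; exact: measurable_kern_factor.
Qed.

Lemma measurable_kern e n y : 0 < e -> measurable_fun [set: measurableTypeR R] (kern e n y).
Proof.
move=> e0; apply: measurable_funM; last exact: measurable_kern_prod.
by do 2 apply: measurable_funX; exact: mulrr_measurable.
Qed.

Lemma measurable_kern' e n y : 0 < e -> measurable_fun [set: measurableTypeR R] (kern' e n y).
Proof.
move=> e0; apply: measurable_funM; last exact: measurable_kern_prod.
by do 2 apply: measurable_funX; exact: mulrr_measurable.
Qed.

End KernelBounds.

(** * Comparison of the high moments of xi *)

Section MomentComparison.
Variable R : realType.
Local Notation RT := (measurableTypeR R).
Local Notation D := (@Rnonneg R).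
Local Notation mD := (@measurable_Rnonneg R).

Section Integrals.
Variable l : {finite_measure set RT -> \bar R}.

Lemma integrable_xiX y n : l.-integrable D (EFin \o (fun t => xi y t ^+ n)).
Proof.
apply: (@integrable_xi_comp _ l (fun x => x ^+ n) 1); first exact: exprn_measurable.
by move=> x /andP[x0 x1]; rewrite ger0_norm ?exprn_ge0// exprn_ile1.
Qed.

Lemma integrable_xi y : l.-integrable D (EFin \o xi y).
Proof. exact: (integrable_xiX y 1). Qed.

Lemma integrable_kern e n y : 0 < e -> 0 < y -> l.-integrable D (EFin \o kern e n y).
Proof.
move=> e0 y0; apply: (@Rintegrable_le _ l D mD _ (fun t => xi y t ^+ n.+1)).
- exact: measurable_kern.
- exact: integrable_xiX.
- by move=> t _; rewrite ger0_norm ?kern_ge0// kern_le.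
Qed.

Lemma integrable_kern' e n y : 0 < e -> 0 < y -> l.-integrable D (EFin \o kern' e n y).
Proof.
move=> e0 y0; apply: (@Rintegrable_le _ l D mD _ (fun t => xi y t ^+ n)).
- exact: measurable_kern'.
- exact: integrable_xiX.
- by move=> t _; rewrite ger0_norm ?kern'_ge0// kern'_le.
Qed.

Lemma Rintegral_sum I (s : seq I) (F : I -> R -> R) :
  (forall i, l.-integrable D (EFin \o F i)) ->
  l.-integrable D (EFin \o (fun t => \sum_(i <- s) F i t)) /\
  \int[l]_(t in D) (\sum_(i <- s) F i t) = \sum_(i <- s) \int[l]_(t in D) F i t.
Proof.
move=> iF; elim: s => [|i s [IH1 IH2]].
  split; first by under [X in EFin \o X]eq_fun do rewrite big_nil; exact: integrable0.
  rewrite big_nil; under eq_Rintegral do rewrite big_nil.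
  by rewrite Rintegral_cst ?mul0r//; exact: mD.
split.
  under [X in EFin \o X]eq_fun do rewrite big_cons.
  by apply: integrable_add => //; exact: mD.
rewrite big_cons -IH2 -RintegralD//; last exact: mD.
by apply: eq_Rintegral => t _; rewrite big_cons.
Qed.

Lemma Rintegral_kern_bounds e n y : 0 < e <= 1 -> 0 < y ->
  [/\ (1 - n.+1%:R * e) * \int[l]_(t in D) xi y t ^+ n.+1 <= \int[l]_(t in D) kern e n y t,
      \int[l]_(t in D) kern e n y t <= \int[l]_(t in D) xi y t ^+ n.+1,
      0 <= \int[l]_(t in D) kern' e n y t &
      \int[l]_(t in D) kern' e n y t <= \int[l]_(t in D) xi y t ^+ n].
Proof.
move=> /[dup] e01 /andP[e0 e1] y0.
have ix m : l.-integrable D (EFin \o (fun t => xi y t ^+ m)) by exact: integrable_xiX.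
have ik := integrable_kern n e0 y0; have ik' := integrable_kern' n e0 y0.
split.
- rewrite -RintegralZl//; last exact: mD.
  apply: le_Rintegral => //; [exact: mD|exact: integrableZ mD _ _ (ix _)|].
  by move=> t _; exact: kern_ge.
- by apply: le_Rintegral => //; [exact: mD|move=> t _; exact: kern_le].
- by apply: Rintegral_ge0 => t _; exact: kern'_ge0.
- by apply: le_Rintegral => //; [exact: mD|move=> t _; exact: kern'_le].
Qed.

(** A node [c] enters through the scale [sqrt c * y], which turns [xi] into [v / (v + c)] with
    [v = (t / y) ^ 2]. The extra weight [c ^ -1] in the second identity is the one that [y ^ -2]
    acquires at that scale. *)
Lemma Rintegral_divided_difference e n (c : nat -> R) y : 0 < e -> 0 < y -> (0 < n)%N ->
  (forall k, (0 < k <= n)%N -> \sum_(j < n.+1) c j * (node e j)^-1 ^+ k = 0) ->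
  (forall v, 0 <= v -> \sum_(j < n.+1) c j * (v / (v + node e j)) =
     v ^+ n.+1 / \prod_(j < n.+1) (v + node e j)) ->
  \sum_(j < n.+1) c j * (\int[l]_(t in D) xi (Num.sqrt (node e j) * y) t) =
    \int[l]_(t in D) kern e n y t /\
  \sum_(j < n.+1) c j * ((node e j)^-1 * \int[l]_(t in D) xi (Num.sqrt (node e j) * y) t) =
    - \int[l]_(t in D) kern' e n y t.
Proof.
move=> e0 y0 n0 c1 c2.
have n0' j : 0 < node e j by exact: node_gt0.
have iZ (a : R) z : l.-integrable D (EFin \o (fun t => a * xi z t)).
  exact: integrableZ mD _ _ (integrable_xi z).
split.
  under eq_bigr do rewrite -(RintegralZl _ mD (integrable_xi _)).
  rewrite -(Rintegral_sum _ (fun j => iZ _ _)).2.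
  apply: eq_Rintegral => t _; rewrite /kern -c2 ?sqr_ge0//.
  by apply: eq_bigr => j _; rewrite xi_scale.
under eq_bigr do rewrite mulrA -(RintegralZl _ mD (integrable_xi _)).
rewrite -(Rintegral_sum _ (fun j => iZ _ _)).2 -[RHS]mulN1r.
rewrite -(RintegralZl _ mD (integrable_kern' n e0 y0)).
apply: eq_Rintegral => t _; rewrite mulN1r /kern'.
under eq_bigr do rewrite xi_scale//.
set v := (t / y) ^+ 2.
have v0 : 0 <= v by exact: sqr_ge0.
have E j : v + node e j != 0 by rewrite gt_eqF// ltr_wpDl.
(* For [v != 0], [v / (c * (v + c)) = 1 / c - 1 / (v + c)], and the terms [1 / c] are annihilated by
   the weights, which takes [0 < n]. *)
have [v1|v1] := eqVneq v 0.
  by rewrite v1 expr0n -(prednK n0) /= mul0r oppr0 big1// => j _; rewrite mul0r mulr0.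
have -> : v ^+ n / \prod_(j < n.+1) (v + node e j) =
    v^-1 * \sum_(j < n.+1) c j * (v / (v + node e j)).
  by rewrite c2// exprS mulrA mulKf.
rewrite mulr_sumr -[RHS]add0r -[X in _ = X - _](c1 1%N); last by rewrite n0.
rewrite -sumrB; apply: eq_bigr => j _.
by field; rewrite v1 E gt_eqF.
Qed.

End Integrals.

Section Comparison.
Variables (mu sg : {finite_measure set RT -> \bar R}) (T : R -> R) (p : {poly R}).

(* The factor [1 - y ^ -2] is that of [g_sigma (i y)] in [phi (i y) / (i y)]. *)
Definition moment_gap y := \int[mu]_(t in D) xi y t -
  (1 - y^-1 ^+ 2) * \int[sg]_(t in D) xi y t.

Definition kern_gap e n y := \int[mu]_(t in D) kern e n y t -
  \int[sg]_(t in D) kern e n y t - y^-1 ^+ 2 * \int[sg]_(t in D) kern' e n y t.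

Hypothesis T0 : forall y, 0 <= T y.
Hypothesis Tm : forall x y, x <= y -> T y <= T x.
Hypothesis p0 : p`_0 = 0.
Hypothesis gap : oinf (fun y => moment_gap y - p.[y^-1 ^+ 2]) T.

Lemma sum_divided_difference_poly e n (c : nat -> R) z : 0 < e -> (size p <= n.+1)%N ->
  (forall k, (0 < k <= n)%N -> \sum_(j < n.+1) c j * (node e j)^-1 ^+ k = 0) ->
  \sum_(j < n.+1) c j * p.[(node e j)^-1 * z] = 0.
Proof.
move=> e0 pn c1.
under eq_bigr do rewrite horner_coef mulr_sumr.
rewrite exchange_big /= big1// => k _.
have [->|k0] := eqVneq (k : nat) 0%N; first by rewrite big1// => j _; rewrite p0 mul0r mulr0.
have kn : (0 < k <= n)%N.
  by rewrite lt0n k0 /= -ltnS (leq_trans (ltn_ord k)).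
transitivity (p`_k * z ^+ k * \sum_(j < n.+1) c j * (node e j)^-1 ^+ k); last by rewrite c1// mulr0.
by rewrite mulr_sumr; apply: eq_bigr => j _; rewrite exprMn; ring.
Qed.

(** At scale [sqrt(node) * y] the argument of [p] is [node ^ -1 * y ^ -2]; as [p] has no constant
    term and degree at most [n], the weights annihilate it. The scales being at least [1],
    monotonicity of [T] keeps the errors [o(T y)]. *)
Lemma kern_gap_oinf e n : 0 < e -> (0 < n)%N -> (size p <= n.+1)%N ->
  oinf (kern_gap e n) T.
Proof.
move=> e0 n0 pn.
have [c [c1 c2]] := exists_divided_difference (fun j => node_gt0 j e0) (node_inj e0) n.
pose tau j := Num.sqrt (node e j).
have tau1 j : 1 <= tau j.
  by rewrite -[1]sqrtr1 ler_wsqrtr//; have /andP[] := node_itv j e0.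
have tau2 j : tau j ^+ 2 = node e j by rewrite sqr_sqrtr// ltW// node_gt0.
have H : oinf (fun y => \sum_(j < n.+1)
    c j * (moment_gap (tau j * y) - p.[(tau j * y)^-1 ^+ 2])) T.
  by apply: oinf_sum => // j; apply: oinfZ; exact: oinf_scale (tau1 j) Tm gap.
apply: oinf_near_eq H; near=> y.
have y0 : 0 < y by near: y; exact: nbhs_pinfty_gt.
have tauE j : (tau j * y)^-1 ^+ 2 = (node e j)^-1 * y^-1 ^+ 2.
  by rewrite invfM exprMn [(tau j)^-1 ^+ 2]exprVn tau2.
under eq_bigr do rewrite mulrBr.
rewrite sumrB [X in _ - X](_ : _ = 0) ?subr0; last first.
  under eq_bigr do rewrite tauE.
  exact: sum_divided_difference_poly c1.
have [M1 _] := Rintegral_divided_difference mu e0 y0 n0 c1 c2.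
have [S1 S2] := Rintegral_divided_difference sg e0 y0 n0 c1 c2.
rewrite /kern_gap -M1 -S1 -[\int[sg]_(t in D) kern' e n y t]opprK -S2 mulrN opprK mulr_sumr.
rewrite -sumrB -big_split; apply: eq_bigr => j _ /=.
by rewrite /moment_gap tauE /tau; ring.
Unshelve. all: by end_near. Qed.

Hypothesis known : exists k0, (forall k, (k0 <= k)%N -> Oinf (fun y => \int[mu]_(t in D) xi y t ^+ k) T) \/
  (forall k, (k0 <= k)%N -> Oinf (fun y => \int[sg]_(t in D) xi y t ^+ k) T).

Let X k y := \int[mu]_(t in D) xi y t ^+ k.
Let S k y := \int[sg]_(t in D) xi y t ^+ k.

Lemma xiX_int_ge0 (l : {finite_measure set RT -> \bar R}) k y :
  0 <= \int[l]_(t in D) xi y t ^+ k.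
Proof. by apply: Rintegral_ge0 => t _; rewrite exprn_ge0 ?xi_ge0. Qed.

Lemma xiX_int_Oinf : exists k0, forall k, (k0 <= k)%N -> Oinf (X k) T /\ Oinf (S k) T.
Proof.
have [k0 kn] := known.
pose K := (k0 + size p + 1).+1.
exists K => k Kk.
have k0k : (k0 <= k.-1)%N by rewrite /K in Kk; lia.
have k0k' : (k0 <= k)%N by rewrite /K in Kk; lia.
(* Then [1 - k * e] is [1 / 2], and the integrals of [kern] and [xi ^ k] are comparable for both
   measures. *)
pose e : R := (2 * k%:R)^-1.
have kp : 0 < k%:R :> R by rewrite ltr0n; rewrite /K in Kk; lia.
have k1 : 1 <= k%:R :> R by rewrite ler1n; rewrite /K in Kk; lia.
have e0 : 0 < e by rewrite invr_gt0 mulr_gt0.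
have e1 : 0 < e <= 1 by rewrite e0 invf_le1 ?mulr_gt0//; lra.
have kk : k.-1.+1 = k by rewrite prednK//; rewrite /K in Kk; lia.
have ke : 1 - k%:R * e = 2^-1 by rewrite /e; field; rewrite gt_eqF.
have /(_ _ ltr01) G : oinf (kern_gap e k.-1) T.
  by apply: kern_gap_oinf => //; rewrite /K in Kk; lia.
case: kn => [kn|kn]; split; try exact: kn.
- have [C C0 HC] := kn k k0k'.
  exists (2 * (C + 1)); first lra.
  near=> y; have y0 : 0 < y by near: y; exact: nbhs_pinfty_gt.
  rewrite ger0_norm ?xiX_int_ge0//.
  have Gy : `|kern_gap e k.-1 y| <= 1 * T y by near: y.
  have Xy : `|X k y| <= C * T y by near: y.
  have [_ M2 _ _] := Rintegral_kern_bounds mu k.-1 e1 y0.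
  have [S1 S2 S3 S4] := Rintegral_kern_bounds sg k.-1 e1 y0.
  rewrite kk ke in M2 S1 S2.
  have y3 : 0 <= y^-1 ^+ 2 * \int[sg]_(t in D) kern' e k.-1 y t by rewrite mulr_ge0 ?sqr_ge0.
  rewrite -/(X k y) in M2; rewrite -/(S k y) in S1 *.
  move: Gy Xy; rewrite /kern_gap !ler_norml => /andP[G1 G2] /andP[X1 X2].
  clear -G1 G2 X1 X2 M2 S1 y3; lra.
(* The term with [kern'] now works against the estimate and is bounded by the moment of order
   [k - 1]. *)
- have [C C0 HC] := kn k k0k'; have [C' C'0 HC'] := kn k.-1 k0k.
  exists (2 * (C + C' + 1)); first lra.
  near=> y; have y0 : 0 < y by near: y; exact: nbhs_pinfty_gt.
  rewrite ger0_norm ?xiX_int_ge0//.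
  have Gy : `|kern_gap e k.-1 y| <= 1 * T y by near: y.
  have Sy : `|S k y| <= C * T y by near: y.
  have Sy' : `|S k.-1 y| <= C' * T y by near: y.
  have [M1 _ _ _] := Rintegral_kern_bounds mu k.-1 e1 y0.
  have [_ S2 S3 S4] := Rintegral_kern_bounds sg k.-1 e1 y0.
  rewrite kk ke in M1 S2.
  have y1 : y^-1 ^+ 2 <= 1 by near: y; exact: inv_sqr_le.
  have y3 : y^-1 ^+ 2 * \int[sg]_(t in D) kern' e k.-1 y t <= S k.-1 y.
    by apply: le_trans S4; rewrite ler_piMl.
  rewrite -/(X k y) in M1 *; rewrite -/(S k y) in S2.
  move: Gy Sy Sy'; rewrite /kern_gap !ler_norml => /andP[G1 G2] /andP[X1 X2] /andP[X3 X4].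
  clear -G1 G2 X1 X2 X3 X4 M1 S2 y3; lra.
Unshelve. all: by end_near. Qed.

(** The spread of the nodes causes a relative error [k * e], which becomes a small multiple of [T]
    only because both moments are already known to be [O(T)]. The spread can therefore be chosen
    after the tolerance. *)
Lemma xiX_int_oinf : exists m, forall k, (m <= k)%N ->
  [/\ Oinf (X k) T, Oinf (S k) T & oinf (fun y => X k y - S k y) T].
Proof.
have [k1 kn] := xiX_int_Oinf.
pose K := (k1 + size p + 1).+1.
exists K => k Kk.
have [Xk Sk] := kn k ltac:(rewrite /K in Kk; lia).
have [_ Sk'] := kn k.-1 ltac:(rewrite /K in Kk; lia).
split => // d d0.
have [C1 C10 H1] := Xk; have [C2 C20 H2] := Sk; have [C3 C30 H3] := Sk'.
have kp : 0 < k%:R :> R by rewrite ltr0n; rewrite /K in Kk; lia.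
(* One third of the tolerance [d] goes to replacing [kern] by [xi ^ k], one to [kern_gap], and one
   to the term with [kern']. *)
pose e := Num.min 1 (d / (3 * k%:R * (C1 + C2))).
have e0 : 0 < e by rewrite lt_min ltr01 divr_gt0// !mulr_gt0//; lra.
have e1 : 0 < e <= 1 by rewrite e0 ge_min lexx.
have ek : k%:R * e * (C1 + C2) <= d / 3.
  have : e <= d / (3 * k%:R * (C1 + C2)) by rewrite ge_min lexx orbT.
  rewrite ler_pdivlMr; last by rewrite !mulr_gt0//; lra.
  by move=> H; lra.
have kk : k.-1.+1 = k by rewrite prednK//; rewrite /K in Kk; lia.
have d3 : 0 < d / 3 by lra.
have [k0 kp'] : (0 < k.-1)%N /\ (size p <= k.-1.+1)%N by rewrite /K in Kk; clear -Kk; lia.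
have G := kern_gap_oinf e0 k0 kp'.
near=> y; have y0 : 0 < y by near: y; exact: nbhs_pinfty_gt.
have Gy : `|kern_gap e k.-1 y| <= d / 3 * T y by near: y; exact: G.
have Xy : `|X k y| <= C1 * T y by near: y.
have Sy : `|S k y| <= C2 * T y by near: y.
have Sy' : `|S k.-1 y| <= C3 * T y by near: y.
have [M1 M2 _ _] := Rintegral_kern_bounds mu k.-1 e1 y0.
have [S1 S2 S3 S4] := Rintegral_kern_bounds sg k.-1 e1 y0.
rewrite kk in M1 M2 S1 S2.
have y1 : y^-1 ^+ 2 <= d / 3 / C3 by near: y; apply: inv_sqr_le; exact: divr_gt0.
have y3 : 0 <= y^-1 ^+ 2 * \int[sg]_(t in D) kern' e k.-1 y t by rewrite mulr_ge0 ?sqr_ge0.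
have y4 : y^-1 ^+ 2 * \int[sg]_(t in D) kern' e k.-1 y t <= d / 3 * T y.
  apply: (@le_trans _ _ (d / 3 / C3 * (C3 * T y))); last by rewrite mulrA divfK ?gt_eqF.
  by apply: ler_pM => //; [exact: sqr_ge0|exact: le_trans S4 (le_trans (ler_norm _) Sy')].
have X0 : 0 <= X k y by exact: xiX_int_ge0.
have S0 : 0 <= S k y by exact: xiX_int_ge0.
have E1 : k%:R * e * X k y <= k%:R * e * (C1 * T y).
  by rewrite ler_wpM2l ?mulr_ge0 ?(ltW kp) ?(ltW e0)// (le_trans (ler_norm _)).
have E2 : k%:R * e * S k y <= k%:R * e * (C2 * T y).
  by rewrite ler_wpM2l ?mulr_ge0 ?(ltW kp) ?(ltW e0)// (le_trans (ler_norm _)).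
have E3 : k%:R * e * (C1 + C2) * T y <= d / 3 * T y by rewrite ler_wpM2r.
have E4 : 0 <= k%:R * e * X k y by rewrite !mulr_ge0// ltW.
have E5 : 0 <= k%:R * e * S k y by rewrite !mulr_ge0// ltW.
move: Gy; rewrite /kern_gap !ler_norml => /andP[G1 G2].
rewrite -/(X k y) in M1 M2; rewrite -/(S k y) in S1 S2.
clear -G1 G2 M1 M2 S1 S2 y3 y4 E1 E2 E3 E4 E5.
by apply/andP; split; lra.
Unshelve. all: by end_near. Qed.

End Comparison.

End MomentComparison.

(** * Asymptotic expansion of the transform at infinity *)

Section Expansion.
Variable R : realType.
Local Notation RT := (measurableTypeR R).
Local Notation D := (@Rnonneg R).
Local Notation mD := (@measurable_Rnonneg R).
Implicit Types (y t : R) (q z w : R[i]).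

Definition ci y : R[i] := 0 +i* y.

Lemma ci_neq0 y : 0 < y -> ci y != 0.
Proof. by move=> y0; apply: Im_neq0; rewrite /= gt_eqF. Qed.

Lemma nc_ci y : 0 < y -> nc (ci y) = y.
Proof. by move=> y0; rewrite /= expr0n add0r sqrtr_sqr gtr0_norm. Qed.

Lemma nc_ciB_ge y t : 0 < y -> y <= nc (ci y - t%:C) /\ `|t| <= nc (ci y - t%:C).
Proof.
move=> y0; split.
  by apply: le_trans (Im_nc _); rewrite ImD ImN /= oppr0 addr0 ler_norm.
by apply: le_trans (Re_nc _); rewrite ReD ReN /= sub0r normrN.
Qed.

Lemma nc_q q : nc (q - 1) <= 2^-1 -> 2^-1 <= nc q <= 3 / 2.
Proof.
move=> q1; have := ncD (q - 1) 1; rewrite subrK nc1.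
have := ncB 1 q; rewrite nc1 ncBC => h1 h2.
by apply/andP; split; lra.
Qed.

(** Moving [i y] to [i y * q] displaces it by at most [y / 2], hence by at most half its distance to
    the real point [t]. *)
Lemma nc_cone_ge q y t : 0 < y -> nc (q - 1) <= 2^-1 ->
  nc (ci y - t%:C) / 2 <= nc (ci y * q - t%:C).
Proof.
move=> y0 q1; have [yl _] := nc_ciB_ge t y0.
have -> : ci y * q - t%:C = (ci y - t%:C) - ci y * (1 - q) by ring.
apply: le_trans (ncB _ _); rewrite ncM nc_ci// [nc (1 - q)]ncBC.
have : y * nc (q - 1) <= y * 2^-1 by rewrite ler_wpM2l ?(ltW y0).
lra.
Qed.

Lemma nc_cone_gt0 q y t : 0 < y -> nc (q - 1) <= 2^-1 -> 0 < nc (ci y * q - t%:C).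
Proof.
move=> y0 q1; have [yl _] := nc_ciB_ge t y0.
by apply: lt_le_trans (nc_cone_ge t y0 q1); rewrite divr_gt0//; lra.
Qed.

Lemma nc_kernel_le q y t : 0 < y -> nc (q - 1) <= 2^-1 ->
  nc (t%:C / (ci y * q - t%:C)) <= 2 * min1 y t.
Proof.
move=> y0 q1; have [yl tl] := nc_ciB_ge t y0.
have H := nc_cone_ge t y0 q1; have P := nc_cone_gt0 t y0 q1.
rewrite ncM ncV nc_real ler_pdivrMr//.
have [h|h] := leP 1 `|t / y|; rewrite /min1.
  by rewrite (min_idPl h) mulr1; lra.
rewrite (min_idPr (ltW h)) normrM normfV (gtr0_norm y0).
have -> : 2 * (`|t| / y) * nc (ci y * q - t%:C) = `|t| * (2 * nc (ci y * q - t%:C) / y) by ring.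
by rewrite ler_peMr// ler_pdivlMr// mul1r; lra.
Qed.

Lemma cmeas_kernel w : cmeas (fun t => t%:C / (w - t%:C)).
Proof.
apply: cmeasM; first exact: cmeas_id.
by apply: cmeasV; apply: cmeasB; [exact: cmeas_cst|exact: cmeas_id].
Qed.

Lemma nc_ratio_le q y t : 0 < y -> nc (q - 1) <= 2^-1 ->
  nc (t%:C / (ci y * q)) <= 2 * `|t / y|.
Proof.
move=> y0 q1; have /andP[ql _] := nc_q q1.
have q0 : 0 < nc q by lra.
rewrite !ncM ncV ncM nc_ci// nc_real normrM normfV (gtr0_norm y0).
rewrite invfM mulrA mulrC ler_wpM2r//; first by rewrite divr_ge0 ?(ltW y0).
by rewrite -[leRHS]invrK lef_pV2 ?posrE.
Qed.

(** The remainder of the geometric series of [t / (w - t)] in powers of [t / w], after [p] terms. *)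
Definition rem_kernel p w t : R[i] := (t%:C / w) ^+ p * (t%:C / (w - t%:C)).

Lemma cmeas_rem_kernel p w : cmeas (rem_kernel p w).
Proof.
apply: cmeasM; last exact: cmeas_kernel.
by apply: cmeasX; apply: cmeasM; [exact: cmeas_id|exact: cmeas_cst].
Qed.

Lemma nc_rem_kernel_le p q y t : 0 < y -> nc (q - 1) <= 2^-1 ->
  nc (rem_kernel p (ci y * q) t) <= 2 ^+ p.+1 * (`|t / y| ^+ p * min1 y t).
Proof.
move=> y0 q1; rewrite ncM ncX.
have -> : 2 ^+ p.+1 * (`|t / y| ^+ p * min1 y t) = (2 * `|t / y|) ^+ p * (2 * min1 y t).
  by rewrite exprMn exprS; ring.
apply: ler_pM; rewrite ?exprn_ge0 ?nc_ge0 ?nc_kernel_le//.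
by rewrite lerXn2r ?nnegrE ?nc_ge0 ?mulr_ge0// nc_ratio_le.
Qed.

Lemma nc_expVB1 q p : nc (q - 1) <= 2^-1 -> nc (q^-1 ^+ p - 1) <= 2 * 4 ^+ p * nc (q - 1).
Proof.
move=> q1; have /andP[ql _] := nc_q q1.
have q0 : 0 < nc q by lra.
have qi : nc q^-1 <= 2 by rewrite ncV -[leRHS]invrK lef_pV2 ?posrE.
have qd : nc (q^-1 - 1) <= 2 * nc (q - 1).
  have -> : q^-1 - 1 = q^-1 * (1 - q) by rewrite mulrBr mulr1 mulVf// nc_neq0.
  by rewrite ncM [nc (1 - q)]ncBC ler_wpM2r ?nc_ge0.
elim: p => [|p IH]; first by rewrite !expr0 subrr nc0 mulr1 mulr_ge0 ?nc_ge0.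
have -> : q^-1 ^+ p.+1 - 1 = q^-1 * (q^-1 ^+ p - 1) + (q^-1 - 1) by rewrite exprS; ring.
apply: le_trans (ncD _ _) _; rewrite ncM.
have H1 : nc q^-1 * nc (q^-1 ^+ p - 1) <= 2 * (2 * 4 ^+ p * nc (q - 1)).
  by apply: ler_pM; rewrite ?nc_ge0.
have H2 : nc (q - 1) <= 4 ^+ p * nc (q - 1) by rewrite ler_peMl ?nc_ge0// exprn_ege1// ler1n.
have d0 := nc_ge0 (q - 1).
by rewrite exprS; lra.
Qed.

(** The remainder appears in the functional equation at a perturbed point [i y * q] and has to be
    brought back to [i y]; the factor [nc (q - 1)] makes this move negligible. *)
Lemma nc_rem_kernelB_le p q y t : 0 < y -> nc (q - 1) <= 2^-1 ->
  nc (rem_kernel p (ci y * q) t - rem_kernel p (ci y) t) <=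
    6 * 4 ^+ p * nc (q - 1) * (`|t / y| ^+ p * min1 y t).
Proof.
move=> y0 q1; have /andP[ql _] := nc_q q1.
have q0 : 0 < nc q by lra.
have qn := nc_neq0 q0; have yn := ci_neq0 y0.
have one : nc (1 - 1 : R[i]) <= 2^-1 by rewrite subrr nc0 invr_ge0.
have d1 := nc_neq0 (nc_cone_gt0 t y0 q1).
have d2 := nc_cone_gt0 t y0 one; rewrite mulr1 in d2.
have [yl tl] := nc_ciB_ge t y0.
have -> : rem_kernel p (ci y * q) t - rem_kernel p (ci y) t = (t%:C / ci y) ^+ p *
    (q^-1 ^+ p * (t%:C / (ci y * q - t%:C)) * ((1 - q) * (ci y / (ci y - t%:C))) +
     (q^-1 ^+ p - 1) * (t%:C / (ci y - t%:C))).
  rewrite /rem_kernel; have -> : t%:C / (ci y * q) = t%:C / ci y * q^-1 by rewrite invfM mulrA.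
  rewrite exprMn; field; rewrite d1 (nc_neq0 d2)//.
have k1 := nc_kernel_le t y0 q1.
have k2 := nc_kernel_le t y0 one; rewrite mulr1 in k2.
have e1 := nc_expVB1 p q1.
have s1 : nc (t%:C / ci y) = `|t / y|.
  by rewrite ncM ncV nc_ci// nc_real normrM normfV (gtr0_norm y0).
have s2 : nc (ci y / (ci y - t%:C)) <= 1 by rewrite ncM ncV nc_ci// ler_pdivrMr// mul1r.
have s3 : nc (q^-1 ^+ p) <= 4 ^+ p.
  by rewrite ncX lerXn2r ?nnegrE ?nc_ge0// ncV -[leRHS]invrK lef_pV2 ?posrE//; lra.
rewrite ncM ncX s1 [leRHS]mulrCA; apply: ler_wpM2l; first exact: exprn_ge0.
apply: le_trans (ncD _ _) _; rewrite !ncM -ncM -[nc (ci y) * _]ncM -[nc t%:C * _]ncM.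
have m0 := min1_ge0 y t.
have A1 : nc (q^-1 ^+ p) * nc (t%:C / (ci y * q - t%:C)) <= 4 ^+ p * (2 * min1 y t).
  by apply: ler_pM; rewrite ?nc_ge0.
have A2 : nc (1 - q) * nc (ci y / (ci y - t%:C)) <= nc (q - 1).
  by rewrite ncBC ler_piMr ?nc_ge0.
have A3 : nc (q^-1 ^+ p - 1) * nc (t%:C / (ci y - t%:C)) <=
    2 * 4 ^+ p * nc (q - 1) * (2 * min1 y t) by apply: ler_pM; rewrite ?nc_ge0.
have A4 : nc (q^-1 ^+ p) * nc (t%:C / (ci y * q - t%:C)) * (nc (1 - q) * nc (ci y / (ci y - t%:C)))
    <= 4 ^+ p * (2 * min1 y t) * nc (q - 1).
  by apply: ler_pM => //; rewrite mulr_ge0 ?nc_ge0.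
lra.
Qed.

Section Remainder.
Variables (l : {finite_measure set RT -> \bar R}) (p : nat).
Hypothesis ip : l.-integrable D (EFin \o (fun t => t ^+ p)).

Lemma integrable_gauge y : 0 < y ->
  l.-integrable D (EFin \o (fun t => `|t / y| ^+ p * min1 y t)).
Proof.
move=> y0; apply: (@Rintegrable_le _ l D mD _ (fun t => y^-1 ^+ p * t ^+ p)).
- apply: measurable_funM; last exact: measurable_min1.
  by apply: measurable_funX; exact: measurable_scale_norm.
- exact: integrableZ mD _ _ ip.
- move=> t; rewrite /Rnonneg /= in_itv /= andbT => t0.
  rewrite ger0_norm ?mulr_ge0 ?exprn_ge0 ?min1_ge0//.
  rewrite [`|t / y|]ger0_norm ?divr_ge0 ?(ltW y0)// exprMn [leRHS]mulrC.
  by rewrite ler_piMr ?min1_le1// mulr_ge0 ?exprn_ge0 ?invr_ge0 ?(ltW y0).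
Qed.

Definition gfun_rem w := cintegral l D (rem_kernel p w).

Lemma cintegrable_rem q y : 0 < y -> nc (q - 1) <= 2^-1 ->
  cintegrable l D (rem_kernel p (ci y * q)).
Proof.
move=> y0 q1; apply: (cintegrable_le mD (cmeas_rem_kernel p _)
  (integrableZ mD (2 ^+ p.+1) (integrable_gauge y0))) => t _.
exact: nc_rem_kernel_le.
Qed.

Lemma nc_rem_le q y : 0 < y -> nc (q - 1) <= 2^-1 ->
  nc (gfun_rem (ci y * q)) <= 2 ^+ p.+2 * gauge l p y.
Proof.
move=> y0 q1; apply: le_trans (nc_cintegral_le mD (cmeas_rem_kernel p _)
  (integrableZ mD (2 ^+ p.+1) (integrable_gauge y0)) _) _.
  by move=> t _; exact: nc_rem_kernel_le.
by rewrite (RintegralZl _ mD (integrable_gauge y0)) mulrA -exprS.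
Qed.

Lemma nc_remB_le q y : 0 < y -> nc (q - 1) <= 2^-1 ->
  nc (gfun_rem (ci y * q) - gfun_rem (ci y)) <= 12 * 4 ^+ p * nc (q - 1) * gauge l p y.
Proof.
move=> y0 q1.
have one : nc (1 - 1 : R[i]) <= 2^-1 by rewrite subrr nc0 invr_ge0.
have i1 := cintegrable_rem y0 q1; have := cintegrable_rem y0 one; rewrite mulr1 => i2.
rewrite /gfun_rem -(cintegralB mD i1 i2).
apply: le_trans (nc_cintegral_le mD (cmeasB (cmeas_rem_kernel p _) (cmeas_rem_kernel p _))
  (integrableZ mD (6 * 4 ^+ p * nc (q - 1)) (integrable_gauge y0)) _) _.
  by move=> t _; exact: nc_rem_kernelB_le.
by rewrite (RintegralZl _ mD (integrable_gauge y0)) /gauge; lra.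
Qed.

Lemma integrable_moment j : (j <= p)%N -> l.-integrable D (EFin \o (fun t => t ^+ j)).
Proof.
move=> jp; apply: (@Rintegrable_le _ l D mD _ (fun t => 1 + t ^+ p)).
- exact: exprn_measurable.
- apply: integrable_add; [exact: mD| |exact: ip].
  exact: finite_measure_integrable_cst mD.
- move=> t; rewrite /Rnonneg /= in_itv /= andbT => t0.
  rewrite ger0_norm ?exprn_ge0//.
  have [t1|t1] := leP t 1; first by rewrite ler_wpDr ?exprn_ge0// exprn_ile1.
  by rewrite ler_wpDl// ler_weXn2l// ltW.
Qed.

Definition moment_poly : {poly R} :=
  \sum_(j < p) (\int[l]_(t in D) t ^+ j.+1) *: 'X^(j.+1).

Lemma moment_poly0 : moment_poly`_0 = 0.
Proof.
by rewrite coef_sum big1// => j _; rewrite coefZ coefXn mulr0.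
Qed.

(** The measure and the domain are left free: the law is integrated over the whole line until its
    positivity is known, and the Levy measure may be infinite. *)
Definition gfun (A : set R) (h : {measure set RT -> \bar R}) w :=
  cintegral h A (fun t => t%:C / (w - t%:C)).

Lemma gfun_expansion q y : 0 < y -> nc (q - 1) <= 2^-1 ->
  gfun D l (ci y * q) =
    (map_poly (real_complex R) moment_poly).[(ci y * q)^-1] + gfun_rem (ci y * q).
Proof.
move=> y0 q1; set w := ci y * q.
have /andP[ql _] := nc_q q1.
have w0 : w != 0 by rewrite mulf_neq0 ?ci_neq0// nc_neq0//; lra.
have ic j : (j <= p)%N -> cintegrable l D (fun t => w^-1 ^+ j * (t ^+ j)%:C).
  move=> jp; apply: cintegrableZ; first exact: mD.
  exact: cintegrableC (integrable_moment jp).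
have E t : D t -> t%:C / (w - t%:C) =
    \sum_(j < p) w^-1 ^+ j.+1 * (t ^+ j.+1)%:C + rem_kernel p w t.
  move=> _; have d : w - t%:C != 0 := nc_neq0 (nc_cone_gt0 t y0 q1).
  rewrite /rem_kernel.
  have -> : \sum_(j < p) w^-1 ^+ j.+1 * (t ^+ j.+1)%:C = \sum_(j < p) (t%:C / w) ^+ j.+1.
    by apply: eq_bigr => j _; rewrite exprMn rmorphXn mulrC.
  elim: (p) => [|n IH]; first by rewrite big_ord0 add0r expr0 mul1r.
  rewrite big_ord_recr /= {1}IH -addrA; congr (_ + _).
  by rewrite exprS; field; rewrite ?d ?w0.
pose F (j : 'I_p) t := w^-1 ^+ j.+1 * (t ^+ j.+1)%:C.
have iF j : cintegrable l D (F j) by exact: ic.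
rewrite /gfun (eq_cintegral l E) (cintegralD mD (cintegrable_sum mD _ iF) (cintegrable_rem y0 q1)).
congr (_ + _); rewrite (cintegral_sum mD _ iF) /moment_poly raddf_sum /= horner_sum.
apply: eq_bigr => j _; rewrite map_polyZ map_polyXn hornerZ hornerXn mulrC.
rewrite /F cintegralZ ?cintegralC//; [exact: mD|exact: cintegrableC (integrable_moment (ltn_ord j))].
Qed.

End Remainder.
End Expansion.

(** * Fixed points of perturbed polynomial equations *)

Section PolynomialBounds.
Variable R : realType.
Local Notation toC P := (map_poly (real_complex R) P).

Lemma horner_bounded (P : {poly R}) (B : R) : 0 <= B ->
  exists2 L, 0 <= L & forall a : R[i], nc a <= B -> nc (toC P).[a] <= L.
Proof.
move=> B0; elim/poly_ind: P => [|P c [L L0 HL]].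
  by exists 0 => // a _; rewrite rmorph0 horner0 nc0.
exists (L * B + `|c|); first by rewrite addr_ge0 ?mulr_ge0.
move=> a aB; rewrite rmorphD rmorphM /= map_polyX map_polyC /= hornerMXaddC.
apply: le_trans (ncD _ _) _; rewrite ncM (nc_real c) lerD2r.
by apply: ler_pM; rewrite ?nc_ge0// HL.
Qed.

Lemma horner_lipschitz (P : {poly R}) (B : R) : 0 <= B ->
  exists2 L, 0 <= L & forall a b : R[i], nc a <= B -> nc b <= B ->
    nc ((toC P).[a] - (toC P).[b]) <= L * nc (a - b).
Proof.
move=> B0; elim/poly_ind: P => [|P c [L L0 HL]].
  by exists 0 => // a b _ _; rewrite rmorph0 !horner0 subrr nc0 mul0r.
have [K K0 HK] := horner_bounded P B0.
exists (L * B + K); first by rewrite addr_ge0 ?mulr_ge0.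
move=> a b aB bB; rewrite rmorphD rmorphM /= map_polyX map_polyC /= !hornerMXaddC.
have -> : (toC P).[a] * a + c%:C - ((toC P).[b] * b + c%:C) =
   ((toC P).[a] - (toC P).[b]) * a + (toC P).[b] * (a - b) by ring.
apply: le_trans (ncD _ _) _; rewrite !ncM mulrDl; apply: lerD.
  rewrite mulrAC; apply: ler_pM; rewrite ?nc_ge0//; exact: HL.
by rewrite ler_wpM2r ?nc_ge0 ?HK.
Qed.

End PolynomialBounds.

Section PerturbedFixedPoint.
Variable R : realType.
Local Notation toC P := (map_poly (real_complex R) P).
Variables (P S : {poly R}) (N : nat) (C : R).
Hypothesis P0 : P`_0 = 0.
Hypothesis N0 : (0 < N)%N.
Hypothesis C0 : 0 <= C.

(* [u] solves [u = P(x S(u)) + small]; [s] is the exact factor of which [S(u)]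
   is a Taylor polynomial, and [r0] is the value at [u = 0] of the remainder [r]. *)
Record perturbed (x u s r r0 : R[i]) (E F : R) : Prop := Perturbed {
  pert_x : nc x = F;
  pert_F : F <= 1;
  pert_E : 0 <= E <= 1;
  pert_u : nc u <= 2^-1;
  pert_s : nc s <= 2;
  pert_eq : u = (toC P).[x * s] + r;
  pert_sS : nc (s - (toC S).[u]) <= C * nc u ^+ N;
  pert_r : nc r <= C * E;
  pert_r0 : nc (r - r0) <= C * E * nc u }.

(** Picard iteration for [u = P(x * S(u))]; the factor [x] makes each step gain one power of [x]. *)
Fixpoint iterate k : {poly R} :=
  if k is k'.+1 then P \Po ('X * (S \Po iterate k')) else 0.

Lemma iterate0 k : (iterate k)`_0 = 0.
Proof.
case: k => [|k]; first by rewrite coef0.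
rewrite -horner_coef0 /= horner_comp hornerM hornerX mul0r.
by rewrite horner_coef0.
Qed.

Lemma horner_iterate k x : (toC (iterate k.+1)).[x] =
  (toC P).[x * (toC S).[(toC (iterate k)).[x]]].
Proof.
by rewrite /= map_comp_poly horner_comp rmorphM /= map_polyX hornerM hornerX map_comp_poly horner_comp.
Qed.

Lemma pert_F0 x u s r r0 E F : perturbed x u s r r0 E F -> 0 <= F.
Proof. by case=> <- *; exact: nc_ge0. Qed.

Lemma perturbed_u : exists2 K, 0 <= K & forall x u s r r0 E F,
  perturbed x u s r r0 E F -> nc u <= K * (E + F).
Proof.
have [L L0 HL] := @horner_lipschitz R P 2 (ler0n _ 2).
exists (L * 2 + C); first by rewrite addr_ge0 ?mulr_ge0.
move=> x u s r r0 E F h; have F0 := pert_F0 h.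
have [xF F1 /andP[E0 E1] u2 s2 ue _ rE _] := h.
have xs : nc (x * s) <= F * 2 by rewrite ncM xF ler_wpM2l.
have B1 := HL (x * s) 0; rewrite subr0 nc0 in B1.
have H0 : (toC P).[0] = 0 by rewrite horner_coef0 coef_map P0.
rewrite H0 subr0 in B1.
rewrite {1}ue; apply: le_trans (ncD _ _) _.
have B2 : nc (toC P).[x * s] <= L * (F * 2).
  apply: le_trans (B1 _ _) _; [lra|lra|by rewrite ler_wpM2l].
have K1 : 0 <= L * 2 * E by rewrite !mulr_ge0.
have K2 : 0 <= C * F by rewrite mulr_ge0.
lra.
Qed.

Lemma exprD_le (a b : R) n : 0 <= a -> 0 <= b -> (a + b) ^+ n <= 2 ^+ n * (a ^+ n + b ^+ n).
Proof.
move=> a0 b0; have [ab|ba] := leP a b.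
  apply: (@le_trans _ _ ((2 * b) ^+ n)); first by rewrite lerXn2r ?nnegrE ?addr_ge0 ?mulr_ge0//; lra.
  by rewrite exprMn ler_wpM2l ?exprn_ge0// lerDr exprn_ge0.
apply: (@le_trans _ _ ((2 * a) ^+ n)); first by rewrite lerXn2r ?nnegrE ?addr_ge0 ?mulr_ge0//; lra.
by rewrite exprMn ler_wpM2l ?exprn_ge0// lerDl exprn_ge0.
Qed.

(** Replacing [s] by [S(u)] costs [F * nc u ^ N] and replacing [r] by [r0] costs [E * nc u], up to
    constants. As [u] is [O(E + F)], both are [O(E * (E + F) + F ^ N)]. *)
Lemma perturbed_defect : exists2 K, 0 <= K & forall x u s r r0 E F,
  perturbed x u s r r0 E F ->
  nc (u - (toC P).[x * (toC S).[u]] - r0) <= K * (E * (E + F) + F ^+ N).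
Proof.
have [M M0 HM] := @horner_bounded R S 1 ler01.
have [L L0 HL] := @horner_lipschitz R P (2 + M) (addr_ge0 (ler0n _ 2) M0).
have [K K0 HK] := perturbed_u.
have K2 : 0 <= (2 * K) ^+ N by rewrite exprn_ge0// mulr_ge0.
exists (L * C * (2 * K) ^+ N + C * K); first by rewrite addr_ge0 ?mulr_ge0.
move=> x u s r r0 E F h; have F0 := pert_F0 h; have uK := HK _ _ _ _ _ _ _ h.
have [xF F1 /andP[E0 E1] u2 s2 ue sS rE rr] := h.
have -> : u - (toC P).[x * (toC S).[u]] - r0 =
    ((toC P).[x * s] - (toC P).[x * (toC S).[u]]) + (r - r0) by rewrite {1}ue; ring.
apply: le_trans (ncD _ _) _.
have b1 : nc (x * s) <= 2 + M.
  have : nc (x * s) <= 1 * 2 by rewrite ncM xF; apply: ler_pM; rewrite ?nc_ge0.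
  lra.
have b2 : nc (x * (toC S).[u]) <= 2 + M.
  have : nc (x * (toC S).[u]) <= 1 * M.
    by rewrite ncM xF; apply: ler_pM; rewrite ?nc_ge0 ?HM//; lra.
  lra.
have uN : nc u ^+ N <= (2 * K) ^+ N * (E + F ^+ N).
  apply: (@le_trans _ _ ((K * (E + F)) ^+ N)).
    by rewrite lerXn2r ?nnegrE ?nc_ge0 ?mulr_ge0 ?addr_ge0.
  rewrite exprMn [(2 * K) ^+ N]exprMn [2 ^+ N * _]mulrC -mulrA; apply: ler_wpM2l; first exact: exprn_ge0.
  apply: le_trans (exprD_le N E0 F0) _.
  rewrite ler_wpM2l ?exprn_ge0// lerD2r.
  by rewrite -[leRHS]expr1 ler_wiXn2l.
have B1 : nc ((toC P).[x * s] - (toC P).[x * (toC S).[u]]) <=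
    L * (F * (C * ((2 * K) ^+ N * (E + F ^+ N)))).
  apply: le_trans (HL _ _ b1 b2) _; apply: ler_wpM2l => //.
  rewrite -mulrBr ncM xF ler_wpM2l//; apply: le_trans sS _.
  by rewrite ler_wpM2l.
have B2 : nc (r - r0) <= C * E * (K * (E + F)).
  by apply: le_trans rr _; rewrite ler_wpM2l ?mulr_ge0.
have FN : F * F ^+ N <= F ^+ N by rewrite ler_piMl ?exprn_ge0.
have EE : 0 <= E * E by rewrite mulr_ge0.
have B3 : L * (F * (C * ((2 * K) ^+ N * (E + F ^+ N)))) <=
    L * C * (2 * K) ^+ N * (E * (E + F) + F ^+ N).
  have -> : L * (F * (C * ((2 * K) ^+ N * (E + F ^+ N)))) =
    L * C * (2 * K) ^+ N * (E * F + F * F ^+ N) by ring.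
  by rewrite ler_wpM2l ?mulr_ge0//; lra.
have B4 : C * E * (K * (E + F)) <= C * K * (E * (E + F) + F ^+ N).
  have -> : C * E * (K * (E + F)) = C * K * (E * (E + F)) by ring.
  by rewrite ler_wpM2l ?mulr_ge0// lerDl exprn_ge0.
lra.
Qed.

Lemma perturbed_step (G : {poly R}) : exists2 L, 0 <= L &
  forall x u s r r0 E F, perturbed x u s r r0 E F ->
  nc ((toC P).[x * (toC S).[u]] - (toC P).[x * (toC S).[(toC G).[x]]]) <=
    L * (F * nc (u - (toC G).[x])).
Proof.
have [M M0 HM] := @horner_bounded R G 1 ler01.
have M1 : 0 <= 1 + M by rewrite addr_ge0.
have [A A0 HA] := horner_bounded S M1.
have [L L0 HL] := horner_lipschitz S M1.
have [L' L'0 HL'] := horner_lipschitz P A0.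
exists (L' * L); first exact: mulr_ge0.
move=> x u s r r0 E F h; have F0 := pert_F0 h.
have [xF F1 /andP[E0 E1] u2 s2 ue sS rE rr] := h.
have x1 : nc x <= 1 by rewrite xF.
have b1 : nc u <= 1 + M by lra.
have b2 : nc (toC G).[x] <= 1 + M by have := HM x x1; lra.
have b3 a : nc a <= 1 + M -> nc (x * (toC S).[a]) <= A.
  move=> aM; have := HA a aM; rewrite ncM => H.
  by apply: le_trans H; rewrite ler_piMl ?nc_ge0.
apply: le_trans (HL' _ _ (b3 _ b1) (b3 _ b2)) _.
rewrite -mulrBr ncM xF -mulrA ler_wpM2l// mulrCA ler_wpM2l//; exact: HL.
Qed.

Lemma perturbed_iterate k : (k <= N)%N -> exists2 K, 0 <= K &
  forall x u s r r0 E F, perturbed x u s r r0 E F ->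
    nc (u - (toC (iterate k)).[x]) <= K * (E + F ^+ k).
Proof.
elim: k => [_|k IH kN].
  exists 1 => // x u s r r0 E F h; have [_ _ /andP[E0 E1] u2 _ _ _ _ _] := h.
  by rewrite rmorph0 horner0 subr0 expr0 mul1r; lra.
have [K K0 HK] := IH (ltnW kN).
have [L L0 HL] := perturbed_step (iterate k).
have [M M0 HM] := perturbed_defect.
exists (L * K + 2 * M + 2 * C); first by rewrite !addr_ge0 ?mulr_ge0.
move=> x u s r r0 E F h; have F0 := pert_F0 h; have uK := HK _ _ _ _ _ _ _ h.
have uL := HL _ _ _ _ _ _ _ h; have uM := HM _ _ _ _ _ _ _ h.
have [xF F1 /andP[E0 E1] u2 s2 ue sS rE rr] := h.
rewrite horner_iterate.
set a := (toC P).[_]; set b := (toC P).[_] in uM uL.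
have -> : u - a = (u - b - r0) + (b - a) + (r - (r - r0)) by ring.
have T1 := ncD (u - b - r0 + (b - a)) (r - (r - r0)).
have T2 := ncD (u - b - r0) (b - a).
have T3 := ncBD r (r - r0).
have Fk : F ^+ N <= F ^+ k.+1 by rewrite ler_wiXn2l.
have FE : F * (E + F ^+ k) <= E + F ^+ k.+1.
  by rewrite mulrDr -exprS lerD2r ler_piMl.
have B1 : nc (b - a) <= L * K * (E + F ^+ k.+1).
  apply: le_trans uL _; rewrite -mulrA ler_wpM2l//.
  apply: (@le_trans _ _ (F * (K * (E + F ^+ k)))); first by rewrite ler_wpM2l.
  by rewrite mulrCA ler_wpM2l.
have Fk0 : 0 <= F ^+ k.+1 by rewrite exprn_ge0.
have B2 : nc (u - b - r0) <= 2 * M * (E + F ^+ k.+1).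
  apply: le_trans uM _; rewrite [2 * M]mulrC -mulrA ler_wpM2l//.
  have : E * (E + F) <= E * 2 by rewrite ler_wpM2l//; lra.
  lra.
have B3 : nc (r - r0) <= C * E.
  by apply: le_trans rr _; rewrite ler_piMr ?mulr_ge0//; lra.
have B4 : C * E + C * E <= 2 * C * (E + F ^+ k.+1).
  have : 0 <= 2 * C * F ^+ k.+1 by rewrite !mulr_ge0.
  lra.
lra.
Qed.

(** The [N]-th iterate determines [u] only up to [E + F ^ N]. One more step multiplies this error by
    [F], turning [E] into the admissible product [E * F], and only then is [r0] split off. *)
Lemma perturbed_solution : exists2 K, 0 <= K & forall x u s r r0 E F,
  perturbed x u s r r0 E F ->
  nc (u - (toC (iterate N.+1)).[x] - r0) <= K * (E * (E + F) + F ^+ N).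
Proof.
have [K K0 HK] := perturbed_iterate (leqnn N).
have [L L0 HL] := perturbed_step (iterate N).
have [M M0 HM] := perturbed_defect.
exists (L * K + M); first by rewrite !addr_ge0 ?mulr_ge0.
move=> x u s r r0 E F h; have F0 := pert_F0 h; have uK := HK _ _ _ _ _ _ _ h.
have uL := HL _ _ _ _ _ _ _ h; have uM := HM _ _ _ _ _ _ _ h.
have [xF F1 /andP[E0 E1] u2 s2 ue sS rE rr] := h.
rewrite horner_iterate.
set a := (toC P).[_]; set b := (toC P).[_] in uM uL.
have -> : u - a - r0 = (u - b - r0) + (b - a) by ring.
apply: le_trans (ncD _ _) _.
have FN : 0 <= F ^+ N by rewrite exprn_ge0.
have EE : 0 <= E * E by rewrite mulr_ge0.
have FN1 : F * F ^+ N <= F ^+ N by rewrite ler_piMl.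
have B1 : nc (b - a) <= L * K * (E * (E + F) + F ^+ N).
  apply: le_trans uL _; rewrite -mulrA ler_wpM2l//.
  apply: (@le_trans _ _ (F * (K * (E + F ^+ N)))); first by rewrite ler_wpM2l.
  by rewrite mulrCA ler_wpM2l//; lra.
lra.
Qed.

End PerturbedFixedPoint.

(** * The Voiculescu transform as a compositional inverse *)

Section Transforms.
Variable R : realType.
Local Notation RT := (measurableTypeR R).
Local Notation D := (@Rnonneg R).
Local Notation mD := (@measurable_Rnonneg R).
Implicit Types (y t : R) (z w q : R[i]).

Lemma nc_upper_ge w t : 0 < Im w -> Im w <= nc (w - t%:C).
Proof.
move=> w0; apply: le_trans (Im_nc _); rewrite ImD ImN /= oppr0 addr0.
exact: ler_norm.
Qed.

Lemma upper_neq w t : 0 < Im w -> w - t%:C != 0.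
Proof. by move=> w0; apply: nc_neq0; exact: lt_le_trans w0 (nc_upper_ge t w0). Qed.

(** The minimum is what a Levy measure of a free regular law integrates. For large [t] it comes from
    [t / (w - t) = w / (w - t) - 1]. *)
Lemma nc_upper_kernel w t : 0 < Im w -> nc (t%:C / (w - t%:C)) <=
  (1 + nc w / Im w) * Num.max 1 (Im w)^-1 * Num.min 1 `|t|.
Proof.
move=> w0; have H := nc_upper_ge t w0; have P := lt_le_trans w0 H.
have m1 : 1 <= Num.max 1 (Im w)^-1 by rewrite le_max lexx.
have m2 : (Im w)^-1 <= Num.max 1 (Im w)^-1 by rewrite le_max lexx orbT.
have c0 : 0 <= nc w / Im w by rewrite divr_ge0 ?nc_ge0 ?(ltW w0).
have [t1|t1] := leP 1 `|t|.
  have -> : t%:C / (w - t%:C) = w / (w - t%:C) - 1 by field; exact: upper_neq.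
  rewrite mulr1; apply: le_trans (ncBD _ _) _; rewrite nc1 ncM ncV.
  apply: (@le_trans _ _ (1 + nc w / Im w)); last by rewrite ler_peMr ?addr_ge0.
  by rewrite addrC lerD2l ler_wpM2l ?nc_ge0// lef_pV2 ?posrE.
rewrite ncM ncV nc_real mulrC ler_wpM2r//.
apply: (@le_trans _ _ (Im w)^-1); first by rewrite lef_pV2 ?posrE.
by apply: le_trans m2 _; rewrite ler_peMl ?(le_trans ler01 m1)// lerDl.
Qed.

Lemma cmeas_resolvent w : cmeas (fun t => 1 / (w - t%:C)).
Proof.
apply: cmeasM; first exact: cmeas_cst.
by apply: cmeasV; apply: cmeasB; [exact: cmeas_cst|exact: cmeas_id].
Qed.

Section Finite.
Variables (l : {finite_measure set RT -> \bar R}) (A : set R).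
Hypothesis mA : measurable (A : set RT).

Lemma cintegrable_bounded (f : R -> R[i]) (K : R) : cmeas f ->
  (forall t, A t -> nc (f t) <= K) -> cintegrable l A f.
Proof.
move=> mf fK; apply: (cintegrable_le mA mf (B := cst K)) => //.
exact: finite_measure_integrable_cst.
Qed.

Lemma cintegrable_resolvent w : 0 < Im w -> cintegrable l A (fun t => 1 / (w - t%:C)).
Proof.
move=> w0; apply: (@cintegrable_bounded _ (Im w)^-1); first exact: cmeas_resolvent.
move=> t _; have H := nc_upper_ge t w0.
by rewrite ncM nc1 mul1r ncV lef_pV2 ?posrE// (lt_le_trans w0 H).
Qed.

Lemma cintegrable_kernel w : 0 < Im w -> cintegrable l A (fun t => t%:C / (w - t%:C)).
Proof.
move=> w0; apply: (@cintegrable_bounded _ ((1 + nc w / Im w) * Num.max 1 (Im w)^-1)).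
  exact: cmeas_kernel.
move=> t _; apply: le_trans (nc_upper_kernel t w0) _.
rewrite ler_piMr ?ge_min ?lexx//.
by rewrite mulr_ge0 ?addr_ge0 ?divr_ge0 ?nc_ge0 ?(ltW w0)// le_max ler01.
Qed.

Lemma gfun_resolvent w : 0 < Im w ->
  gfun A l w = w * cintegral l A (fun t => 1 / (w - t%:C)) - (fine (l A))%:C.
Proof.
move=> w0.
have ic : cintegrable l A (fun=> 1).
  apply: (@cintegrable_bounded _ 1); first exact: cmeas_cst.
  by move=> t _; rewrite nc1.
have -> : (fine (l A))%:C = cintegral l A (fun=> 1).
  by rewrite (cintegralC l A (fun=> 1)) Rintegral_cst// mul1r.
have ir := cintegrable_resolvent w0.
rewrite -(cintegralZ mA w ir) -(cintegralB mA (cintegrableZ mA w ir) ic).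
by apply: eq_cintegral => t _; field; exact: upper_neq.
Qed.

Lemma gfun_cvg0 (e : R) : 0 < e -> \forall y \near +oo, nc (gfun A l (ci y)) <= e.
Proof.
move=> e0; near=> y; have y0 : 0 < y by near: y; exact: nbhs_pinfty_gt.
have one : nc (1 - 1 : R[i]) <= 2^-1 by rewrite subrr nc0 invr_ge0.
have i1 : l.-integrable A (EFin \o (fun t => 2 * min1 y t)).
  apply: integrableZ => //; exact: (integrable_min1X l y 1 mA).
apply: (@le_trans _ _ (2 * \int[l]_(t in A) (2 * min1 y t))).
  apply: (nc_cintegral_le mA (cmeas_kernel _) i1) => t _.
  by have := nc_kernel_le t y0 one; rewrite mulr1.
rewrite RintegralZl//; last exact: (integrable_min1X l y 1 mA).
have : \int[l]_(t in A) min1 y t <= e / 4.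
  by near: y; apply: (cvgr_le _ (Rintegral_min1_cvg0 l mA)); lra.
by lra.
Unshelve. all: by end_near. Qed.

End Finite.

Variable mu : probability RT R.
Local Notation g := (gfun setT mu).

Lemma F_transformE w : 0 < Im w -> F_transform mu w = w / (1 + g w).
Proof.
move=> w0; rewrite (gfun_resolvent mu measurableT w0).
have E : fine (mu setT) = 1 := congr1 fine (probability_setT mu).
rewrite E.
rewrite addrC subrK /F_transform /G_transform.
by rewrite invfM mulrA mulfV ?Im_neq0 ?gt_eqF// mul1r.
Qed.

(** For [q = 1 / (1 + G)] the real part is at least [1 - d] and the imaginary part at most [d] in
    modulus; the aperture condition [d < eta * (1 - d)] is the hypothesis [d * (1 + eta) < eta]. *)
Lemma small_cone (G : R[i]) (y d eta M : R) : 0 < d <= 2^-1 -> 0 < eta -> d * (1 + eta) < eta ->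
  0 < y -> 2 * M < y -> nc G <= d / 2 -> let w := ci y / (1 + G) in
  [/\ nc ((1 + G)^-1 - 1) <= 2^-1, 1 + G != 0, 0 < Im w & truncated_cone eta M w].
Proof.
move=> /andP[d0 d1] eta0 d2 y0 yM gd w.
have G1 : 2^-1 <= nc (1 + G).
  by have := ncB 1 (- G); rewrite opprK ncN nc1; lra.
have G0 : 1 + G != 0 by apply: nc_neq0; lra.
pose q := (1 + G)^-1.
have qd : nc (q - 1) <= d.
  have -> : q - 1 = - (q * G) by rewrite /q; field.
  rewrite ncN ncM ncV ler_pdivrMl; last lra.
  apply: (@le_trans _ _ (2^-1 * d)); first lra.
  by rewrite ler_wpM2r// ltW.
have wq : w = ci y * q by [].
have rq : 1 - d <= Re q.
  have R1 : Re (q - 1) = Re q - 1 by rewrite ReD ReN.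
  by have := Re_nc (q - 1); rewrite ler_norml R1 => /andP[H _]; lra.
have iq : `|Im q| <= d.
  have I1 : Im (q - 1) = Im q by rewrite ImD ImN /= oppr0 addr0.
  have := Im_nc (q - 1); rewrite I1 => H; exact: le_trans H qd.
have Imw : Im w = y * Re q by rewrite wq Im_mulc /=; ring.
have Rew : Re w = - (y * Im q) by rewrite wq Re_mulc /=; ring.
have w0 : 0 < Im w by rewrite Imw mulr_gt0//; lra.
split => //; first lra.
split => //.
  rewrite Imw Rew normrN normrM gtr0_norm// mulrCA ltr_pM2l//.
  have : eta * (1 - d) <= eta * Re q by rewrite ler_wpM2l// ltW.
  lra.
rewrite nc_normr ltcR; apply: (@lt_le_trans _ _ (Im w)).
  have : y * 2^-1 <= y * Re q by rewrite ler_wpM2l ?(ltW y0)//; lra.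
  by rewrite Imw; lra.
exact: le_trans (ler_norm _) (Im_nc _).
Qed.

Variable phi : R[i] -> R[i].
Hypothesis mu_phi : voiculescu_transform mu phi.

(* [F] maps [i y] into the small cone on which [phi] is a right inverse of [F],
   so injectivity of [F] on the large cone makes it a left inverse at [i y]. *)
Lemma voiculescu_left_inverse : \forall y \near +oo,
  let w := ci y / (1 + g (ci y)) in
  [/\ nc ((1 + g (ci y))^-1 - 1) <= 2^-1, 1 + g (ci y) != 0, 0 < Im w & w + phi w = ci y].
Proof.
have [_ [eta [M [eta' [M' [[eta0 M0 eta'0 M'0] inj inv]]]]]] := mu_phi.
pose d := Num.min (2^-1) (eta' / (2 * (1 + eta'))).
have d0 : 0 < d by rewrite lt_min invr_gt0 ltr0n /= divr_gt0 ?mulr_gt0//; lra.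
have d1 : d <= 2^-1 by rewrite ge_min lexx.
have d2 : d * (1 + eta') < eta'.
  have : d <= eta' / (2 * (1 + eta')) by rewrite ge_min lexx orbT.
  rewrite ler_pdivlMr; last by rewrite mulr_gt0//; lra.
  lra.
near=> y => w.
have y0 : 0 < y by near: y; exact: nbhs_pinfty_gt.
have yM : M < y by near: y; apply: nbhs_pinfty_gt; exact: num_real.
have yM' : 2 * M' < y by near: y; apply: nbhs_pinfty_gt; exact: num_real.
have gd : nc (g (ci y)) <= d / 2 by near: y; apply: gfun_cvg0 => //; lra.
have [q1 G0 w0 cone_w] := small_cone (introT andP (conj d0 d1)) eta'0 d2 y0 yM' gd.
split => //.
have [cone_H FH] := inv _ cone_w.
apply: inj; rewrite ?inE//.
  split => /=; [exact: y0|by rewrite normr0 mulr_gt0|].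
  by rewrite nc_normr ltcR nc_ci.
by rewrite FH F_transformE.
Unshelve. all: by end_near. Qed.

Lemma voiculescu_right_inverse : \forall y \near +oo,
  0 < Im (ci y + phi (ci y)) /\ g (ci y + phi (ci y)) = phi (ci y) / ci y.
Proof.
have [_ [eta [M [eta' [M' [[eta0 M0 eta'0 M'0] inj inv]]]]]] := mu_phi.
near=> y; have y0 : 0 < y by near: y; exact: nbhs_pinfty_gt.
have yM : M' < y by near: y; apply: nbhs_pinfty_gt; exact: num_real.
have cone_y : truncated_cone eta' M' (ci y).
  split => /=; [exact: y0|by rewrite normr0 mulr_gt0|].
  by rewrite nc_normr ltcR nc_ci.
have [[H0 _ _] FH] := inv _ cone_y; split => //.
set H := ci y + _ in H0 FH *.
rewrite F_transformE// in FH.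
have y1 := ci_neq0 y0.
(* Division by zero yields [0], so a vanishing denominator would make [F_mu] vanish, against its
   value [i y]. *)
have G0 : 1 + g H != 0.
  by apply: contraNneq y1 => E; rewrite -FH E invr0 mulr0.
have : H = ci y * (1 + g H) by rewrite -[in RHS]FH divfK.
move=> E; apply: (mulfI y1); rewrite mulrCA mulfV// mulr1.
apply: (addrI (ci y)); rewrite -/H [RHS]E; ring.
Unshelve. all: by end_near. Qed.

End Transforms.

(** * Free regular laws live on the half-line *)

Section Positivity.
Variable R : realType.
Local Notation RT := (measurableTypeR R).
Local Notation D := (@Rnonneg R).
Local Notation mD := (@measurable_Rnonneg R).
(* Inside a ring expression [_^*] would be read as [Num.conj], not [conjc]. *)
Local Notation cj := (@conjc R).
Implicit Types (y t : R) (z w : R[i]).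

Lemma cjD z w : cj (z + w) = cj z + cj w.
Proof. exact: rmorphD. Qed.

Lemma cjN z : cj (- z) = - cj z.
Proof. exact: rmorphN. Qed.

Lemma cjB z w : cj (z - w) = cj z - cj w.
Proof. by rewrite cjD cjN. Qed.

Lemma cjM z w : cj (z * w) = cj z * cj w.
Proof. exact: rmorphM. Qed.

Lemma cjV z : cj z^-1 = (cj z)^-1.
Proof. exact: conjc_inv. Qed.

Lemma cjC (x : R) : cj x%:C = x%:C.
Proof. exact: conjc_real. Qed.

Lemma cj_sum n (a : 'I_n -> R[i]) : cj (\sum_i a i) = \sum_i cj (a i).
Proof. exact: rmorph_sum. Qed.

Lemma mulcJ_nc z : z * cj z = (nc z ^+ 2)%:C.
Proof.
apply: complex_eq; rewrite ?Re_mulc ?Im_mulc ReC ImC /= ?nc_sqr; first by rewrite !expr2; ring.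
by rewrite mulrN addrC mulrC subrr.
Qed.

Lemma sum_mulcJ n (a : 'I_n -> R[i]) :
  \sum_i \sum_j a i * (cj (a j)) = (nc (\sum_i a i) ^+ 2)%:C.
Proof.
rewrite -mulcJ_nc cj_sum mulr_suml; apply: eq_bigr => i _.
by rewrite mulr_sumr.
Qed.

Section Resolvent.
Variables (l : {measure set RT -> \bar R}) (A : set R).
Hypothesis mA : measurable (A : set RT).
Hypothesis ik : forall w, 0 < Im w -> cintegrable l A (fun t => t%:C / (w - t%:C)).

(** Its integrals form the Gram matrix of the resolvents for the weight [t dl(t)], which is signed a
    priori. By [gfunBJ] this is, up to sign, the Pick matrix of [gfun]. *)
Definition gram_kernel w w' t : R[i] := t%:C * (1 / (w - t%:C) * (cj (1 / (w' - t%:C)))).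

Lemma conj_inv_sub w t : (cj ((w - t%:C)^-1)) = ((cj w) - t%:C)^-1.
Proof. by rewrite cjV cjB cjC. Qed.

Lemma conj_resolvent w t : (cj (1 / (w - t%:C))) = 1 / ((cj w) - t%:C).
Proof. by rewrite !mul1r conj_inv_sub. Qed.

Lemma conj_upper_neq w t : 0 < Im w -> (cj w) - t%:C != 0.
Proof.
by move=> w0; apply: Im_neq0; rewrite ImD ImN ImC /= oppr0 addr0 oppr_eq0 gt_eqF.
Qed.

Lemma subJ_neq0 w w' : 0 < Im w -> 0 < Im w' -> w - (cj w') != 0.
Proof.
move=> w0 w'0; apply: Im_neq0; rewrite ImD ImN ImC opprK gt_eqF//.
exact: addr_gt0.
Qed.

Lemma cintegrable_conj f : cintegrable l A f -> cintegrable l A (fun t => (cj (f t))).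
Proof.
move=> [f1 f2]; split; first by under [X in EFin \o X]eq_fun do rewrite ReC.
under [X in EFin \o X]eq_fun do rewrite ImC -mulN1r.
exact: integrableZ.
Qed.

Lemma gram_kernelE w w' t : 0 < Im w -> 0 < Im w' ->
  t%:C / (w - t%:C) - (cj (t%:C / (w' - t%:C))) = - (w - (cj w')) * gram_kernel w w' t.
Proof.
move=> w0 w'0; rewrite /gram_kernel conj_resolvent cjM cjC conj_inv_sub.
by field; rewrite conj_upper_neq// upper_neq.
Qed.

Lemma cintegrable_gram w w' : 0 < Im w -> 0 < Im w' -> cintegrable l A (gram_kernel w w').
Proof.
move=> w0 w'0.
have i1 := cintegrableD mA (ik w0) (cintegrableZ mA (-1) (cintegrable_conj (ik w'0))).
have := cintegrableZ mA (- (w - (cj w')))^-1 i1; congr (cintegrable _ _ _).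
apply/funext => t; rewrite mulN1r gram_kernelE// mulKf// oppr_eq0; exact: subJ_neq0.
Qed.

Lemma gfunBJ w w' : 0 < Im w -> 0 < Im w' ->
  gfun A l w - (cj (gfun A l w')) = - (w - (cj w')) * cintegral l A (gram_kernel w w').
Proof.
move=> w0 w'0; rewrite -(cintegralZ mA _ (cintegrable_gram w0 w'0)).
have -> : (cj (gfun A l w')) = cintegral l A (fun t => (cj (t%:C / (w' - t%:C)))).
  exact: esym (cintegral_conj mA (ik w'0)).
rewrite /gfun -(cintegralB mA (ik w0) (cintegrable_conj (ik w'0))).
by apply: eq_cintegral => t _; exact: gram_kernelE.
Qed.

Lemma gram_sum n (w : 'I_n -> R[i]) (c : 'I_n -> R[i]) t :
  \sum_i \sum_j c i * (cj (c j)) * gram_kernel (w i) (w j) t =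
    (t * nc (\sum_i c i * (1 / (w i - t%:C))) ^+ 2)%:C.
Proof.
rewrite rmorphM /= -sum_mulcJ mulr_sumr; apply: eq_bigr => i _.
rewrite mulr_sumr; apply: eq_bigr => j _.
by rewrite /gram_kernel [cj (c j * _)]cjM; ring.
Qed.

Lemma cintegral_gram_sum n (w : 'I_n -> R[i]) (c : 'I_n -> R[i]) :
  (forall i, 0 < Im (w i)) ->
  \sum_i \sum_j c i * (cj (c j)) * cintegral l A (gram_kernel (w i) (w j)) =
    (\int[l]_(t in A) (t * nc (\sum_i c i * (1 / (w i - t%:C))) ^+ 2))%:C.
Proof.
move=> w0; rewrite -cintegralC.
have iF i j : cintegrable l A (fun t => c i * (cj (c j)) * gram_kernel (w i) (w j) t).
  by apply: cintegrableZ => //; exact: cintegrable_gram.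
have iS i : cintegrable l A (fun t => \sum_j c i * (cj (c j)) * gram_kernel (w i) (w j) t).
  by apply: cintegrable_sum.
under eq_bigr do under eq_bigr do rewrite -(cintegralZ mA _ (cintegrable_gram (w0 _) (w0 _))).
under eq_bigr do rewrite -(cintegral_sum mA _ (iF _)).
rewrite -(cintegral_sum mA _ iS); apply: eq_cintegral => t _.
exact: gram_sum.
Qed.

End Resolvent.

Variable mu : probability RT R.
Hypothesis mu_free : free_regular mu.
Local Notation g := (gfun setT mu).

(** With [w = F_mu(i y)], the inverse relation gives [phi w = i y - w = w * g(i y)]. The cumulant
    transform at [1 / w] is [phi w / w], and its integrand becomes [t / (w - t)] there. *)
Lemma free_regular_subordination : exists (eta : R) (nu : {measure set RT -> \bar R}),
  [/\ 0 <= eta, forall w, 0 < Im w -> cintegrable nu D (fun t => t%:C / (w - t%:C)) &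
   \forall y \near +oo, let w := ci y / (1 + g (ci y)) in
     [/\ 1 + g (ci y) != 0, 0 < Im w & g (ci y) = eta%:C / w + gfun D nu w]].
Proof.
have [eta [nu [C [eta0 [_ _ nufin] [phi mu_phi Cphi] CE]]]] := mu_free.
exists eta, nu.
have i1 : nu.-integrable D (EFin \o (fun t => Num.min 1 `|t|)).
  apply/integrableP; split.
    by apply: measurable_EFin_comp; apply: measurable_minr => //.
  apply: le_lt_trans nufin; rewrite le_eqVlt; apply/orP; left; apply/eqP.
  apply: eq_integral => t; rewrite inE /Rnonneg /= in_itv /= andbT => t0.
  by rewrite (ger0_norm t0) ger0_norm// le_min ler01 t0.
have ik w : 0 < Im w -> cintegrable nu D (fun t => t%:C / (w - t%:C)).
  move=> w0; apply: (cintegrable_le mD (cmeas_kernel w) (integrableZ mD _ i1)) => t _.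
  exact: nc_upper_kernel.
split => //.
near=> y.
have : let w := ci y / (1 + g (ci y)) in
    [/\ nc ((1 + g (ci y))^-1 - 1) <= 2^-1, 1 + g (ci y) != 0, 0 < Im w & w + phi w = ci y].
  by near: y; exact: voiculescu_left_inverse.
set w := ci y / (1 + g (ci y)) => -[_ G0 w0 H].
split => //.
have wn : w != 0 by apply: Im_neq0; rewrite gt_eqF.
have lw : lower_half (1 / w).
  have -> : 1 / w = w^-1 by rewrite mul1r.
  rewrite /lower_half /mkset ImV.
  by rewrite mulNr oppr_lt0 divr_gt0// exprn_gt0// nc_gt0.
have := CE _ lw; rewrite Cphi// mul1r invrK.
have -> : cintegral nu D (fun t => 1 / (1 - w^-1 * t%:C) - 1) = gfun D nu w.
  apply: eq_cintegral => t _; have d := upper_neq t w0.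
  by field; rewrite wn d.
rewrite mul1r => <-.
have -> : phi w = ci y - w by rewrite -H addrC addKr.
rewrite [X in X - w](_ : _ = w * (1 + g (ci y))); last by rewrite /w divfK.
by field.
Unshelve. all: by end_near. Qed.

(* Schur's product theorem: the Gram matrix of [mu] at the points [i y_j] is the
   entrywise product of two positive semidefinite Gram matrices. *)
Lemma free_regular_gram_ge0 : \forall Y \near +oo, forall n (y : 'I_n -> R) (c : 'I_n -> R[i]),
  (forall i, Y <= y i) ->
  0 <= \int[mu]_t (t * nc (\sum_i c i * (1 / (ci (y i) - t%:C))) ^+ 2).
Proof.
have [eta [nu [eta0 ik nearF]]] := free_regular_subordination.
have [x0 x00 HF] := near_pinfty_ge nearF.
near=> Y => n y c Yy.
have x0Y : x0 <= Y by near: Y; apply: nbhs_pinfty_ge; exact: num_real.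
pose z i := ci (y i); pose F i := z i / (1 + g (z i)).
have y0 i : 0 < y i by apply: lt_le_trans x00 (le_trans x0Y (Yy i)).
have z0 i : 0 < Im (z i) by exact: y0.
have H i := HF _ (le_trans x0Y (Yy i)).
have F0 i : 0 < Im (F i) by have [] := H i.
have Fn i : F i != 0 by apply: Im_neq0; rewrite gt_eqF.
have zn i : z i != 0 by apply: Im_neq0; rewrite gt_eqF.
have imu w : 0 < Im w -> cintegrable mu setT (fun t => t%:C / (w - t%:C)).
  exact: cintegrable_kernel measurableT _.
pose b i t := 1 / (z i - t%:C).
have ib i : cintegrable mu setT (b i) by exact: cintegrable_resolvent measurableT _ (z0 i).
(* The Gram matrix of [t dnu] at the points [F i], with the drift as a rank-one term; it is positive
   semidefinite because [nu] is integrated over the nonnegative half-line. *)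
pose A i j := eta%:C / (F i * (cj (F j))) + cintegral nu D (gram_kernel (F i) (F j)).
have Gb i : (F i)^-1 = cintegral mu setT (b i).
  have := gfun_resolvent mu measurableT (z0 i).
  have -> : fine (mu setT) = 1 := congr1 fine (probability_setT mu).
  move=> E; rewrite /F invf_div E addrC subrK mulrC mulKf//.
have ibb i j : cintegrable mu setT (fun t => b i t * (cj (b j t))).
  apply: (@cintegrable_bounded _ mu setT measurableT _ ((y i)^-1 * (y j)^-1)).
    by apply: cmeasM; [|apply: cmeas_conj]; exact: cmeas_resolvent.
  move=> t _; rewrite ncM nc_conj !ncM nc1 !mul1r !ncV.
  by apply: ler_pM; rewrite ?invr_ge0 ?nc_ge0// lef_pV2 ?posrE ?(lt_le_trans _ (nc_upper_ge _ _))//; exact: nc_upper_ge (z0 _).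
have e3 i j : (F i)^-1 - (cj ((F j)^-1)) =
    - (z i - (cj (z j))) * cintegral mu setT (fun t => b i t * (cj (b j t))).
  rewrite !Gb.
  have -> : (cj (cintegral mu setT (b j))) = cintegral mu setT (fun t => (cj (b j t))).
    exact: esym (cintegral_conj measurableT (ib j)).
  rewrite -(cintegralB measurableT (ib i) (cintegrable_conj measurableT (ib j))).
  rewrite -(cintegralZ measurableT _ (ibb i j)); apply: eq_cintegral => t _.
  rewrite /b conj_resolvent; field.
  by rewrite conj_upper_neq// upper_neq.
(* Subordination writes the difference of [g] at two points as a multiple of [F i - cj (F j)], and
   the difference of [1 / F] writes the latter as a multiple of [z i - cj (z j)], which then
   cancels. *)
have AE i j : cintegral mu setT (gram_kernel (z i) (z j)) =
    A i j * (F i * (cj (F j))) * cintegral mu setT (fun t => b i t * (cj (b j t))).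
  have e1 := gfunBJ measurableT imu (z0 i) (z0 j).
  have e2 := gfunBJ mD ik (F0 i) (F0 j).
  have [_ _ hi] := H i; have [_ _ hj] := H j.
  rewrite -/(z i) -/(F i) in hi; rewrite -/(z j) -/(F j) in hj.
  have Fjn : (cj (F j)) != 0 by rewrite conjc_eq0.
  have zd := subJ_neq0 (z0 i) (z0 j).
  have := e3 i j; rewrite cjV.
  set B := cintegral mu setT (fun t => b i t * (cj (b j t))) => E3.
  have FE : F i - (cj (F j)) = (F i * (cj (F j))) * ((z i - (cj (z j))) * B).
    rewrite -[(z i - (cj (z j))) * B]opprK -mulNr -E3; field.
    by rewrite Fn Fjn.
  apply: (mulfI zd); rewrite -[LHS]opprK -mulNr -e1 hi hj cjD cjM cjV cjC.
  have -> : eta%:C / F i + gfun D nu (F i) - (eta%:C / (cj (F j)) + (cj (gfun D nu (F j)))) =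
      - (F i - (cj (F j))) * A i j.
    rewrite /A mulrDr -e2; field.
    by rewrite Fn Fjn.
  by rewrite FE; ring.
have psd (x : 'I_n -> R[i]) : 0 <= Re (\sum_i \sum_j x i * (cj (x j)) * A i j).
  have -> : \sum_i \sum_j x i * (cj (x j)) * A i j =
      eta%:C * (\sum_i \sum_j (x i / F i) * (cj (x j / F j))) +
      \sum_i \sum_j x i * (cj (x j)) * cintegral nu D (gram_kernel (F i) (F j)).
    rewrite mulr_sumr -big_split; apply: eq_bigr => i _ /=.
    rewrite mulr_sumr -big_split; apply: eq_bigr => j _ /=.
    rewrite /A cjM cjV invfM; ring.
  rewrite sum_mulcJ (cintegral_gram_sum mD ik _ F0) -rmorphM -rmorphD /=.
  rewrite addr_ge0//; first by rewrite mulr_ge0 ?sqr_ge0.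
  apply: Rintegral_ge0 => t.
  by rewrite /Rnonneg /= in_itv /= andbT => t0; rewrite mulr_ge0 ?sqr_ge0.
have <- : Re (\sum_i \sum_j c i * (cj (c j)) * cintegral mu setT (gram_kernel (z i) (z j))) =
    \int[mu]_t (t * nc (\sum_i c i * (1 / (ci (y i) - t%:C))) ^+ 2).
  by rewrite (cintegral_gram_sum measurableT imu _ z0).
have iT i j : cintegrable mu setT
    (fun t => (c i * F i * b i t) * (cj (c j * F j * b j t)) * A i j).
  have := cintegrableZ measurableT (c i * F i * (cj (c j * F j)) * A i j) (ibb i j).
  congr (cintegrable _ _ _); apply/funext => t.
  by rewrite [cj (_ * b j t)]cjM; ring.
(* The second factor is an average of rank-one matrices: with the sums under the integral, each [t]
   contributes the form [A] at the vector [c i * F i * b i t]. *)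
have -> : \sum_i \sum_j c i * (cj (c j)) * cintegral mu setT (gram_kernel (z i) (z j)) =
   cintegral mu setT (fun t => \sum_i \sum_j (c i * F i * b i t) * (cj (c j * F j * b j t)) * A i j).
  rewrite cintegral_sum//; last first.
    by move=> i; apply: cintegrable_sum => // j; exact: iT.
  apply: eq_bigr => i _; rewrite cintegral_sum//; apply: eq_bigr => j _.
  rewrite AE mulrA -(cintegralZ measurableT _ (ibb i j)).
  by apply: eq_cintegral => t _; rewrite [cj (_ * b j t)]cjM [cj (c j * _)]cjM; ring.
by apply: Rintegral_ge0 => t _; exact: psd.
Unshelve. all: by end_near. Qed.

End Positivity.

(** Positivity is known for linear combinations of resolvents, whereas growth comes from products;
    with simple distinct poles the products are such combinations. *)
Lemma partial_fractions (K : fieldType) (z d : nat -> K) n : injective z ->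
  exists c : nat -> K, forall t, (forall i, z i - t != 0) ->
    \sum_(i < n.+1) c i / (z i - t) = (z 0 - t)^-1 * \prod_(i < n) (1 + d i.+1 / (z i.+1 - t)).
Proof.
move=> zinj; elim: n => [|n [c IH]].
  by exists (fun=> 1) => t _; rewrite big_ord1 big_ord0 mul1r mulr1.
exists (fun i => if (i < n.+1)%N then c i * (1 + d n.+1 / (z n.+1 - z i))
  else - \sum_(j < n.+1) c j * d n.+1 / (z n.+1 - z j)) => t zt.
rewrite big_ord_recr [in RHS]big_ord_recr /= ltnn mulrA -IH// mulNr mulr_suml mulr_suml -sumrB.
apply: eq_bigr => i _ /=; rewrite ltn_ord.
have zi : z n.+1 - z i != 0.
  by rewrite subr_eq0; apply/eqP => /zinj E; have := ltn_ord i; rewrite -E ltnn.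
by field; rewrite zi !zt.
Qed.

(** * Absence of negative mass *)

Section Positivity.
Variable R : realType.
Local Notation RT := (measurableTypeR R).
Implicit Types (y t Y : R) (z w : R[i]).

Lemma nc_sqr_ci_sub y t : nc (ci y - t%:C) ^+ 2 = t ^+ 2 + y ^+ 2.
Proof. by rewrite nc_sqr ReD ImD ReN ImN /= oppr0 addr0 add0r sqrrN. Qed.

(** The coefficient is chosen to make the factor [(y - t) / (i y - t)], of modulus at most [1] for
    [t >= 0] and greater than [1] for [t < 0]. *)
Lemma nc_sqr_factor y t : 0 < y ->
  nc (1 + (y%:C - ci y) / (ci y - t%:C)) ^+ 2 = 1 - 2 * t * y / (t ^+ 2 + y ^+ 2).
Proof.
move=> y0; have d : ci y - t%:C != 0 by exact: upper_neq.
have -> : 1 + (y%:C - ci y) / (ci y - t%:C) = (y - t)%:C / (ci y - t%:C).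
  by rewrite rmorphB /=; field.
rewrite ncM ncV exprMn exprVn nc_sqr_ci_sub nc_real real_normK ?num_real//.
have : 0 < t ^+ 2 + y ^+ 2 by rewrite ltr_wpDl ?sqr_ge0 ?exprn_gt0.
by move=> H; field; rewrite gt_eqF.
Qed.

Definition node_grid (Y : R) (i : nat) : R := Y * (1 + i.+1%:R^-1).

Lemma node_grid_ge Y i : 0 < Y -> Y <= node_grid Y i <= 2 * Y.
Proof.
move=> Y0; have H : 0 <= (i.+1%:R^-1 : R) <= 1 by rewrite invr_ge0 ler0n invf_le1// ler1n.
move: H => /andP[H1 H2]; rewrite /node_grid mulrDr mulr1 lerDl mulr_ge0 ?(ltW Y0)//=.
by rewrite mulr_natl mulr2n lerD2l ger_pMr.
Qed.

Lemma node_grid_inj Y : 0 < Y -> injective (fun i => ci (node_grid Y i)).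
Proof.
move=> Y0 i j [] /(mulfI (lt0r_neq0 Y0)) /addrI /invr_inj /eqP.
by rewrite eqr_nat => /eqP[].
Qed.

(** On the set under the indicator each factor is at least [1 + 2 * Y * delta] and [t] is negative.
    For [t > 0] the factors lie in [[0, 1]] and [t / (t ^ 2 + y ^ 2) <= 1 / Y]. At the remaining
    points the left side is nonpositive. *)
Lemma sqr_interpolant_le (t : R) (y : nat -> R) (Y delta : R) n : 0 < Y -> 0 <= delta ->
  (forall i, Y <= y i <= 2 * Y) ->
  t * ((t ^+ 2 + y 0%N ^+ 2)^-1 * \prod_(i < n) (1 - 2 * t * y i.+1 / (t ^+ 2 + y i.+1 ^+ 2)))
  <= Y^-1 - delta * (1 + 2 * Y * delta) ^+ n *
     \1_([set t | delta * (t ^+ 2 + 4 * Y ^+ 2) <= - t]) t.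
Proof.
move=> Y0 delta0 yY.
have dn (i : nat) : 0 < t ^+ 2 + y i ^+ 2.
  have /andP[H _] := yY i; rewrite ltr_wpDl ?sqr_ge0 ?exprn_gt0//; exact: lt_le_trans H.
have Yi : 0 < Y^-1 by rewrite invr_gt0.
rewrite indicE; have [|_] := boolP (_ \in _).
  rewrite inE /= => At; rewrite mulr1.
  have D0 : 0 < t ^+ 2 + 4 * Y ^+ 2 by rewrite ltr_wpDl ?sqr_ge0// mulr_gt0 ?exprn_gt0.
  have t0 : t <= 0 by have := mulr_ge0 delta0 (ltW D0); lra.
  have key (i : nat) : delta <= - t / (t ^+ 2 + y i ^+ 2).
    rewrite ler_pdivlMr//; apply: le_trans At; rewrite ler_wpM2l// lerD2l.
    have /andP[H1 H2] := yY i; nra.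
  have P1 : (1 + 2 * Y * delta) ^+ n <= \prod_(i < n) (1 - 2 * t * y i.+1 / (t ^+ 2 + y i.+1 ^+ 2)).
    rewrite -[X in _ ^+ X]card_ord -prodr_const; apply: ler_prod => i _.
    have /andP[H1 H2] := yY i.+1; have := key i.+1.
    set X := _ / _ => HX; rewrite !addr_ge0 ?mulr_ge0 ?(ltW Y0)//=.
    have -> : 1 - 2 * t * y i.+1 / (t ^+ 2 + y i.+1 ^+ 2) = 1 + 2 * y i.+1 * X by rewrite /X; ring.
    rewrite lerD2l -!mulrA ler_wpM2l//; apply: ler_pM => //; exact: ltW.
  have P0 : 0 <= (1 + 2 * Y * delta) ^+ n by rewrite exprn_ge0// !addr_ge0 ?mulr_ge0 ?(ltW Y0).
  have := ler_pM delta0 P0 (key 0%N) P1.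
  set A := \prod_(i < n) _; rewrite -mulrA => H; lra.
rewrite mulr0 subr0; have [t0|t0] := leP t 0.
  apply: le_trans (ltW Yi); rewrite -oppr_ge0 -mulNr mulr_ge0 ?oppr_ge0//.
  rewrite mulr_ge0 ?invr_ge0 ?(ltW (dn _))// prodr_ge0// => i _.
  have /andP[H1 H2] := yY i.+1; have := dn i.+1 => H3.
  have : 0 <= - t * y i.+1 / (t ^+ 2 + y i.+1 ^+ 2).
    by rewrite divr_ge0 ?(ltW H3)// mulr_ge0 ?oppr_ge0// (le_trans (ltW Y0) H1).
  lra.
have P1 : \prod_(i < n) (1 - 2 * t * y i.+1 / (t ^+ 2 + y i.+1 ^+ 2)) <= 1.
  apply: prodr_ile1 => i _; have /andP[H1 H2] := yY i.+1; have H3 := dn i.+1.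
  have yi : 0 < y i.+1 by exact: lt_le_trans H1.
  rewrite subr_ge0 ler_pdivrMr// mul1r gerBl divr_ge0 ?(ltW H3) ?mulr_ge0 ?(ltW t0) ?(ltW yi)//.
  by rewrite andbT -subr_ge0; have := sqr_ge0 (t - y i.+1); congr (0 <= _); ring.
rewrite mulrA; apply: (@le_trans _ _ (t * (t ^+ 2 + y 0%N ^+ 2)^-1)).
  by rewrite ler_piMr// divr_ge0 ?(ltW t0) ?(ltW (dn _)).
rewrite ler_pdivrMr// mulrC ler_pdivlMr//.
have /andP[H1 _] := yY 0%N.
have := ler_wpM2l (ltW t0) H1; have := sqr_ge0 (t - y 0%N); have := mulr_ge0 (ltW t0) (ltW (lt_le_trans Y0 H1)).
rewrite sqrrB -mulr_natl => U1 U2 U3; lra.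
Qed.

Lemma free_regular_nonneg (mu : probability RT R) :
  free_regular mu -> mu (`]-oo, 0[%classic : set R) = 0%E.
Proof.
move=> mu_free.
have [Y0 Y00 HY] := near_pinfty_ge (free_regular_gram_ge0 mu_free).
have {}HY := HY _ (lexx Y0); set Y := Y0 in Y00 HY.
(* The factors tend to [1] at [0] and at minus infinity, so growth is uniform only on such sets;
   those with [delta = 1 / (k + 1)] exhaust the negative half-line. *)
pose A (delta : R) : set R := [set t | delta * (t ^+ 2 + 4 * Y ^+ 2) <= - t].
have mA delta : measurable (A delta : set RT).
  have mf : measurable_fun setT (fun t : RT => delta * (t ^+ 2 + 4 * Y ^+ 2) + t).
    apply: measurable_funD => //; apply: measurable_funM => //.
    by apply: measurable_funD => //; exact: measurable_funX.
  have := mf measurableT _ (measurable_itv `]-oo, (0 : R)]).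
  rewrite setTI; congr measurable; apply/seteqP; split => t /=; rewrite in_itv /= /A /=; lra.
pose y := node_grid Y.
have yY i : Y <= y i <= 2 * Y by exact: node_grid_ge.
have y0 i : 0 < y i by have /andP[H _] := yY i; exact: lt_le_trans H.
(* [Y] stays fixed while the number of factors is arbitrary: positive mass on [A delta] would make
   the left side grow geometrically in [n]. *)
have bound (delta : R) n : 0 < delta ->
    delta * (1 + 2 * Y * delta) ^+ n * fine (mu (A delta)) <= Y^-1.
  move=> delta0.
  have [c cE] := @partial_fractions _ _ (fun i => (y i)%:C - ci (y i)) n (node_grid_inj Y00).
  pose Q t := \sum_(i < n.+1) c i * (1 / (ci (y i) - t%:C)).
  have QE t : nc (Q t) ^+ 2 = (t ^+ 2 + y 0%N ^+ 2)^-1 *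
      \prod_(i < n) (1 - 2 * t * y i.+1 / (t ^+ 2 + y i.+1 ^+ 2)).
    have -> : Q t = \sum_(i < n.+1) c i / (ci (y i) - t%:C).
      by apply: eq_bigr => i _; rewrite mul1r.
    rewrite cE; last by move=> i; apply: upper_neq; exact: y0.
    rewrite ncM ncV exprMn exprVn nc_sqr_ci_sub; congr (_ * _).
    elim/big_ind2 : _ => [|z1 r1 z2 r2 <- <-|i _]; first by rewrite nc1 expr1n.
      by rewrite ncM exprMn.
    exact: nc_sqr_factor.
  have iQ : mu.-integrable setT (EFin \o (fun t => t * nc (Q t) ^+ 2)).
    have ik w : 0 < Im w -> cintegrable mu setT (fun t => t%:C / (w - t%:C)).
      exact: cintegrable_kernel measurableT _.
    have : cintegrable mu setT (fun t => \sum_(i < n.+1) \sum_(j < n.+1)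
        c i * conjc (c j) * gram_kernel (ci (y i)) (ci (y j)) t).
      apply: cintegrable_sum => // i; apply: cintegrable_sum => // j.
      apply: cintegrableZ => //; apply: cintegrable_gram => //; exact: y0.
    move=> [+ _]; congr (_.-integrable _ _); apply/funext => t /=.
    by rewrite (gram_sum (fun i => ci (y (nat_of_ord i)))).
  have i1 : mu.-integrable setT (EFin \o (cst Y^-1 : R -> R)).
    exact: finite_measure_integrable_cst.
  have iA : mu.-integrable setT (EFin \o (fun t =>
      (delta * (1 + 2 * Y * delta) ^+ n) * (\1_(A delta) t : R))).
    by apply: integrableZ => //; exact: integrable_indic.
  have := HY n.+1 (fun i => y i) (fun i => c i) (fun i => proj1 (andP (yY i))).
  move=> ge0; rewrite -subr_ge0; apply: le_trans ge0 _.
  have <- : \int[mu]_t (Y^-1 - delta * (1 + 2 * Y * delta) ^+ n * (\1_(A delta) t : R)) =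
      Y^-1 - delta * (1 + 2 * Y * delta) ^+ n * fine (mu (A delta)).
    rewrite (RintegralB measurableT i1 iA) RintegralZl//; last exact: integrable_indic.
    rewrite Rintegral_cst// (congr1 fine (probability_setT mu)) mulr1.
    by rewrite [X in _ * X]/Rintegral integral_indic// setIT.
  apply: le_Rintegral => //; first exact: integrable_sub.
  move=> t _; rewrite [X in _ * X]QE.
  by apply: sqr_interpolant_le => //; exact: ltW.
have A0 (delta : R) : 0 < delta -> mu (A delta) = 0%E.
  move=> delta0; set m := fine (mu (A delta)).
  have m0 : 0 <= m by exact: fine_ge0.
  suff : m <= 0.
    move=> m0'; have E : m = 0 by apply/eqP; rewrite eq_le m0 m0'.
    by rewrite -[mu _]fineK ?fin_num_measure// -/m E.
  rewrite leNgt; apply/negP => mpos.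
  pose x := 2 * Y * delta; have x0 : 0 < x by rewrite !mulr_gt0.
  pose K := Y^-1 / (delta * m * x).
  have K0 : 0 <= K by apply: divr_ge0; [rewrite invr_ge0; exact: ltW|rewrite !mulr_ge0//; exact: ltW].
  have := bound delta (Num.bound K) delta0; rewrite -/m -/x.
  have Bn (n : nat) : n%:R * x <= (1 + x) ^+ n.
    elim: n => [|n IH]; first by rewrite mul0r expr0.
    rewrite exprS -natr1; have : 1 <= (1 + x) ^+ n by rewrite exprn_ege1// lerDl ltW.
    move=> E1; have := ltW x0; nra.
  have := archi_boundP K0; rewrite ltr_pdivrMr ?mulr_gt0// => H1 H2.
  have H3 := ler_wpM2l (mulr_ge0 (ltW delta0) m0) (Bn (Num.bound K)).
  lra.
apply: measure_negligible; first exact: measurable_itv.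
have nA : mu.-negligible (\bigcup_k A k.+1%:R^-1).
  by apply: negligible_bigcup => k; apply/negligibleP => //; apply: A0; rewrite invr_gt0.
apply: negligibleS nA.
move=> t; rewrite /= in_itv /= => t0.
pose K := (t ^+ 2 + 4 * Y ^+ 2) / - t.
have t0' : 0 < - t by rewrite oppr_gt0.
have K0 : 0 <= K by rewrite divr_ge0 ?(ltW t0')// addr_ge0 ?sqr_ge0// mulr_ge0// sqr_ge0.
exists (Num.bound K) => //=; rewrite /A /= mulrC ler_pdivrMr//.
have := archi_boundP K0; rewrite /K ltr_pdivrMr// => H.
by apply: ltW; apply: lt_le_trans H _; rewrite mulrC ler_pM2l// ler_nat.
Qed.

End Positivity.

(** * Comparison of the tails *)

Section TailEquivalence.
Variable R : realType.
Implicit Types f g : R -> R.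

Lemma asymp_equiv_sym f g : asymp_equiv f g -> asymp_equiv g f.
Proof.
move=> fg.
have H : (f x / g x)^-1 @[x --> +oo] --> (1 : R) by rewrite -[X in _ --> X]invr1; exact: cvgV.
by apply: cvg_trans H; apply: near_eq_cvg; near=> x; rewrite invf_div.
Unshelve. all: by end_near. Qed.

Lemma cvg_pinfty_scale (t : R) : 0 < t -> (t * x) @[x --> +oo] --> +oo.
Proof.
move=> t0; apply/cvgryPge => A; near=> x.
by rewrite -ler_pdivrMl//; near: x; apply: nbhs_pinfty_ge; exact: num_real.
Unshelve. all: by end_near. Qed.

Lemma regularly_varying_equiv f g (beta : R) : measurable_fun (@Rnonneg R) f ->
  asymp_equiv f g -> regularly_varying g beta -> regularly_varying f beta.
Proof.
move=> mf fg [_ g0 gv].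
have f0 : \forall x \near +oo, 0 < f x.
  near=> x.
  have gx : 0 < g x by near: x.
  have : 0 < f x / g x by near: x; apply: (cvgr_gt _ fg); exact: ltr01.
  by rewrite pmulr_lgt0// invr_gt0.
split => // t t0.
have gf := asymp_equiv_sym fg.
have ft : f (t * x) / g (t * x) @[x --> +oo] --> (1 : R).
  exact: (cvg_comp (fun x => t * x) (fun x => f x / g x) (cvg_pinfty_scale t0) fg).
have gt0 : \forall x \near +oo, 0 < g (t * x).
  exact: (cvg_pinfty_scale t0 g0).
have lim : (f (t * x) / g (t * x)) * (g (t * x) / g x) * (g x / f x) @[x --> +oo] --> t `^ beta.
  by rewrite -[t `^ beta]mulr1 -[t `^ beta]mul1r; exact: cvgM (cvgM ft (gv t t0)) gf.
apply: cvg_trans lim; apply: near_eq_cvg; near=> x => /=.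
have gx : 0 < g x by near: x.
have gtx : 0 < g (t * x) by near: x.
have fx : 0 < f x by near: x.
by field; rewrite ?gt_eqF.
Unshelve. all: by end_near. Qed.

End TailEquivalence.

(** * The functional equation on the imaginary axis and the conclusion *)

Section Assembly.
Variable R : realType.
Local Notation RT := (measurableTypeR R).
Local Notation D := (@Rnonneg R).
Local Notation mD := (@measurable_Rnonneg R).
Local Notation toC P := (map_poly (real_complex R) P).
Implicit Types (y t : R) (l : {finite_measure set RT -> \bar R}).

Lemma measurable_tail l : measurable_fun D (tail l).
Proof. by apply: nonincreasing_measurable; [exact: mD|exact: tail_nonincreasing]. Qed.

Lemma gfun_nonneg (mu : probability RT R) (w : R[i]) :
  mu (`]-oo, 0[%classic : set R) = 0%E -> 0 < Im w -> gfun setT mu w = gfun D mu w.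
Proof.
move=> mu0 w0; have [i1 i2] := cintegrable_kernel mu measurableT w0.
have DE : D = setT `\` `]-oo, 0[.
  apply/seteqP; split => t; rewrite /Rnonneg /= !in_itv /= ?andbT.
    by move=> t0; split => //; apply/negP; rewrite -leNgt.
  by move=> [_ /negP]; rewrite -leNgt.
by apply: complex_eq; rewrite /gfun /cintegral /= /Rintegral; congr fine; rewrite DE;
  apply: negligible_integral => //; exact: measurable_itv.
Qed.

Lemma Re_kernel y t : Re (t%:C / (ci y - t%:C)) = -1 * xi y t.
Proof.
rewrite Re_mulc ReV nc_sqr_ci_sub ReD ReN mul0r subr0 /xi /=.
by rewrite expr2; ring.
Qed.

Lemma Re_gfun l y : 0 < y -> Re (gfun D l (ci y)) = - \int[l]_(t in D) xi y t.
Proof.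
move=> y0; rewrite -[RHS]mulN1r -RintegralZl; [|exact: mD|exact: integrable_xi].
apply: eq_Rintegral => t _; exact: Re_kernel.
Qed.

Lemma inv_ci y : (ci y)^-1 = 0 +i* (- y^-1).
Proof.
apply: complex_eq; rewrite (ReV, ImV) nc_sqr /= expr0n add0r ?mul0r//.
by rewrite mulNr expr2 invfM; have [->|y0] := eqVneq y 0; [rewrite invr0 !mul0r|field].
Qed.

Lemma sqr_inv_ci y : (ci y)^-1 ^+ 2 = (- y^-1 ^+ 2)%:C.
Proof.
rewrite inv_ci expr2; apply: complex_eq; rewrite (Re_mulc, Im_mulc) /=; ring.
Qed.

(** Even powers of [1 / (i y)] are real and odd ones imaginary, so the real part of a real
    polynomial in [1 / (i y)] is a polynomial in [y ^ -2]. *)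
Lemma horner_inv_ci (P : {poly R}) : exists p q : {poly R}, p`_0 = P`_0 /\
  forall y, (toC P).[(ci y)^-1] = p.[y^-1 ^+ 2] +i* (y^-1 * q.[y^-1 ^+ 2]).
Proof.
elim/poly_ind: P => [|P c [p [q [_ E]]]].
  by exists 0, 0; split=> // y; rewrite rmorph0 !horner0 mulr0.
exists (q * 'X + c%:P), (- p); split; first by rewrite !coefD !coefMX.
move=> y; rewrite rmorphD rmorphM /= map_polyX map_polyC /= !hornerMXaddC E hornerN inv_ci.
apply: complex_eq; rewrite (ReD, ImD) (Re_mulc, Im_mulc) /=; ring.
Qed.

Lemma xiX_Oinf_tail l (alpha : R) k : regularly_varying_tail l (- alpha) ->
  alpha < k%:R -> Oinf (fun y => \int[l]_(t in D) xi y t ^+ k) (tail l).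
Proof.
move=> rv ak; have ak2 : alpha < (2 * k)%:R by apply: lt_le_trans ak _; rewrite ler_nat; lia.
apply: Oinf_le (Rintegral_min1X_Oinf rv ak2).
near=> y; have y0 : 0 < y by near: y; exact: nbhs_pinfty_gt.
rewrite ger0_norm; last by apply: Rintegral_ge0 => t _; rewrite exprn_ge0 ?xi_ge0.
apply: le_Rintegral; [exact: mD| |exact: integrable_min1X mD|].
  apply: (@bounded_integrable _ _ _ _ 1); first exact: mD.
    by apply: measurable_funX; exact: measurable_xi.
  by move=> t _; rewrite ger0_norm ?exprn_ge0 ?xi_ge0// exprn_ile1 ?xi_ge0 ?xi_le1.
by move=> t _; rewrite exprM lerXn2r ?nnegrE ?xi_ge0 ?sqr_ge0 ?xi_min1.
Unshelve. all: by end_near. Qed.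

(** Here [E] is the gauge and [F] is [1 / y]. The requirement [E <= 1] holds eventually, since the
    squared gauge is [o(T)] and [T] tends to [0]. *)
Lemma perturbed_oinf l (alpha : R) p (P S : {poly R}) N C (x u s r r0 : R -> R[i]) :
  0 <= alpha -> regularly_varying_tail l (- alpha) -> alpha < N%:R ->
  oinf (fun y => gauge l p y ^+ 2) (tail l) -> oinf (fun y => gauge l p y / y) (tail l) ->
  P`_0 = 0 -> 0 <= C ->
  (\forall y \near +oo, gauge l p y <= 1 ->
     perturbed P S N C (x y) (u y) (s y) (r y) (r0 y) (gauge l p y) y^-1) ->
  oinf (fun y => nc (u y - (toC (iterate P S N.+1)).[x y] - r0 y)) (tail l).
Proof.
move=> alpha0 rv aN g2 gy P0 C0 Hp.
have N0 : (0 < N)%N by rewrite -(ltr_nat R); exact: le_lt_trans aN.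
have [K K0 HK] := perturbed_solution S P0 N0 C0.
apply: oinf_le (oinfZ K (oinfD (oinfD g2 gy) (expVn_oinf_tail alpha0 rv aN))).
near=> y; rewrite ger0_norm ?nc_ge0//.
have g2y : `|gauge l p y ^+ 2| <= 1 * tail l y by near: y; exact: g2.
have T1 : tail l y <= 1 by near: y; exact: tail_cvg0.
have gle1 : gauge l p y <= 1.
  rewrite -(@expr_le1 _ 2) ?gauge_ge0//.
  by apply: le_trans (ler_norm _) _; apply: le_trans g2y _; rewrite mul1r.
have Hy : gauge l p y <= 1 ->
    perturbed P S N C (x y) (u y) (s y) (r y) (r0 y) (gauge l p y) y^-1 by near: y.
by have := HK _ _ _ _ _ _ _ (Hy gle1); rewrite [X in K * (X + _)]mulrDr -expr2.
Unshelve. all: by end_near. Qed.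

Lemma weighted_rem_bounds l p y (u : R[i]) :
  l.-integrable D (EFin \o (fun t => t ^+ p)) -> 0 < y -> y^-1 <= 1 ->
  nc u <= 2^-1 -> 1 + u != 0 -> nc ((1 + u)^-1 - 1) <= 2^-1 ->
  let rr w := (1 + w^-1 ^+ 2) * gfun_rem l p w in
  nc (rr (ci y / (1 + u))) <= 60 * 4 ^+ p * gauge l p y /\
  nc (rr (ci y / (1 + u)) - rr (ci y)) <= 60 * 4 ^+ p * gauge l p y * nc u.
Proof.
move=> ip y0 y1 u1 un q1 rr; set w := ci y / (1 + u); set x := (ci y)^-1.
have E0 := gauge_ge0 l p y.
have U0 := nc_ge0 u.
have Xx : nc x = y^-1 by rewrite ncV nc_ci.
have x0 : 0 < y^-1 by rewrite invr_gt0.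
have x2 : nc (x ^+ 2) <= 1 by rewrite ncX Xx exprn_ile1// ltW.
have wV : w^-1 = x * (1 + u) by rewrite invfM invrK.
have U1 : nc (1 + u) <= 3 / 2 by have := ncD 1 u; rewrite nc1; lra.
have w2 : nc (w^-1 ^+ 2) <= 9 / 4.
  rewrite wV exprMn ncM (ncX (1 + u)).
  have : nc (1 + u) ^+ 2 <= (3 / 2) ^+ 2 by rewrite lerXn2r ?nnegrE ?nc_ge0.
  move=> H; apply: (@le_trans _ _ (1 * (3 / 2) ^+ 2)); last lra.
  by apply: ler_pM; rewrite ?nc_ge0 ?exprn_ge0 ?nc_ge0.
have r1 : nc (gfun_rem l p w) <= 4 * 4 ^+ p * gauge l p y.
  apply: le_trans (nc_rem_le ip y0 q1) _; rewrite ler_wpM2r//.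
  have : 2 ^+ p <= 4 ^+ p :> R by rewrite lerXn2r ?nnegrE ?ler_nat.
  by rewrite !exprS; lra.
have P0 : 0 <= 4 ^+ p * gauge l p y by rewrite mulr_ge0// exprn_ge0.
split.
  rewrite ncM; apply: (@le_trans _ _ (4 * (4 * 4 ^+ p * gauge l p y))); last lra.
  apply: ler_pM; rewrite ?nc_ge0//; have := ncD 1 (w^-1 ^+ 2); rewrite nc1; lra.
have qu : nc ((1 + u)^-1 - 1) <= 2 * nc u.
  have -> : (1 + u)^-1 - 1 = - ((1 + u)^-1 * u) by field.
  by rewrite ncN ncM ler_wpM2r//; have /andP[] := nc_q q1; lra.
have r2 : nc (gfun_rem l p w - gfun_rem l p (ci y)) <= 24 * nc u * (4 ^+ p * gauge l p y).
  apply: le_trans (nc_remB_le ip y0 q1) _.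
  have := ler_wpM2r P0 qu; lra.
(* The second term is the variation of [w ^ -2], as [(1 + u) ^ 2 - 1 = (2 + u) * u]. The two terms
   contribute [48] and [12], whence the constant [60]. *)
have -> : rr w - rr (ci y) = (1 + x ^+ 2) * (gfun_rem l p w - gfun_rem l p (ci y)) +
    x ^+ 2 * ((2 + u) * u) * gfun_rem l p w.
  by rewrite /rr wV -/x; ring.
apply: le_trans (ncD _ _) _; rewrite !ncM.
have T1 : nc (1 + x ^+ 2) * nc (gfun_rem l p w - gfun_rem l p (ci y)) <=
    2 * (24 * nc u * (4 ^+ p * gauge l p y)).
  by apply: ler_pM; rewrite ?nc_ge0//; have := ncD 1 (x ^+ 2); rewrite nc1; lra.
have T2 : nc (x ^+ 2) * (nc (2 + u) * nc u) * nc (gfun_rem l p w) <=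
    1 * (3 * nc u) * (4 * 4 ^+ p * gauge l p y).
  apply: ler_pM; rewrite ?nc_ge0 ?mulr_ge0 ?nc_ge0//.
  apply: ler_pM; rewrite ?nc_ge0 ?mulr_ge0 ?nc_ge0// ler_wpM2r//.
  have -> : 2 + u = 1 + (1 + u) by ring.
  by have := ncD 1 (1 + u); rewrite nc1; lra.
rewrite (ncX x) expr2 in T2; lra.
Qed.

Section Comparison.
Variables (mu : probability RT R) (phi : R[i] -> R[i]) (gamma alpha : R).
Variable sigma : {finite_measure set RT -> \bar R}.
Hypothesis mu0 : mu (`]-oo, 0[%classic : set R) = 0%E.
Hypothesis mu_phi : voiculescu_transform mu phi.
Hypothesis phiE : forall z : R[i], upper_half z ->
  phi z = gamma%:C + cintegral sigma D (fun t => (1 + t%:C * z) / (z - t%:C)).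
Hypothesis alpha0 : 0 <= alpha.
Local Notation g := (gfun D mu).

Lemma voiculescu_ratio (w : R[i]) : 0 < Im w -> phi w / w =
  (1 + w^-1 ^+ 2) * gfun D sigma w + gamma%:C * w^-1 + (fine (sigma D))%:C * w^-1 ^+ 2.
Proof.
move=> w0; have wn : w != 0 by apply: Im_neq0; rewrite gt_eqF.
have ik := cintegrable_kernel sigma mD w0.
have ic : cintegrable sigma D (fun=> 1).
  by apply: (@cintegrable_bounded _ _ _ mD _ 1) => [|t _]; [exact: cmeas_cst|rewrite nc1].
have E : (fine (sigma D))%:C = cintegral sigma D (fun=> 1).
  by rewrite (cintegralC sigma D (fun=> 1)) Rintegral_cst ?mul1r//; exact: mD.
rewrite phiE// (@eq_cintegral _ sigma _ _ (fun t =>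
    (w * (1 + w^-1 ^+ 2)) * (t%:C / (w - t%:C)) + w^-1 * 1)); last first.
  by move=> t _; field; rewrite wn upper_neq.
rewrite (cintegralD mD (cintegrableZ mD _ ik) (cintegrableZ mD _ ic)).
rewrite (cintegralZ mD _ ik) (cintegralZ mD _ ic) -E /gfun.
by field.
Qed.

Lemma voiculescu_ratio_cvg0 (e : R) : 0 < e ->
  \forall y \near +oo, nc (phi (ci y) / ci y) <= e.
Proof.
move=> e0; set c := `|gamma| + `|fine (sigma D)| + 1.
have c0 : 0 < c by rewrite /c ltr_wpDl// addr_ge0.
near=> y; have y0 : 0 < y by near: y; exact: nbhs_pinfty_gt.
have y1 : y^-1 <= 1 by near: y; exact: cvg_inv_small.
have yc : y^-1 <= e / (2 * c) by near: y; apply: cvg_inv_small; rewrite divr_gt0 ?mulr_gt0.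
have gy : nc (gfun D sigma (ci y)) <= e / 4.
  by near: y; apply: gfun_cvg0; [exact: mD|lra].
have iy : nc (ci y)^-1 = y^-1 by rewrite ncV nc_ci.
have iy2 : y^-1 ^+ 2 <= y^-1 by rewrite expr2 ler_piMl// invr_ge0 ltW.
rewrite voiculescu_ratio; last exact: y0.
apply: le_trans (ncD _ _) _.
have H1 := ncD ((1 + (ci y)^-1 ^+ 2) * gfun D sigma (ci y)) (gamma%:C * (ci y)^-1).
have H2 := ncD 1 ((ci y)^-1 ^+ 2).
rewrite nc1 ncX iy in H2.
have H3 : nc ((1 + (ci y)^-1 ^+ 2) * gfun D sigma (ci y)) <= 2 * (e / 4).
  by rewrite ncM; apply: ler_pM; rewrite ?nc_ge0//; lra.
have H4 : nc (gamma%:C * (ci y)^-1) = `|gamma| * y^-1 by rewrite ncM nc_real iy.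
have H5 : nc ((fine (sigma D))%:C * (ci y)^-1 ^+ 2) <= `|fine (sigma D)| * y^-1.
  by rewrite ncM nc_real ncX iy ler_wpM2l.
have H6 : c * y^-1 <= e / 2.
  move: yc; rewrite ler_pdivlMr ?mulr_gt0//; lra.
have yi : 0 < y^-1 by rewrite invr_gt0.
rewrite /c in H6; lra.
Unshelve. all: by end_near. Qed.

(** The drift term [gamma / (i y)] is imaginary and drops out of the real part; the mass of [sigma]
    contributes [y ^ -2] and is absorbed into the polynomial. *)
Lemma gap_of_expansion (Q : {poly R}) T : Q`_0 = 0 ->
  oinf (fun y => nc (phi (ci y) / ci y - g (ci y) - (toC Q).[(ci y)^-1])) T ->
  exists2 p : {poly R}, p`_0 = 0 & oinf (fun y => moment_gap mu sigma y - p.[y^-1 ^+ 2]) T.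
Proof.
move=> Q0 HQ; have [p [q [p0 E]]] := horner_inv_ci Q.
exists (p + fine (sigma D) *: 'X).
  by rewrite coefD coefZ coefX mulr0 addr0 p0.
apply: oinf_le HQ; near=> y; have y0 : 0 < y by near: y; exact: nbhs_pinfty_gt.
apply: le_trans (Re_nc _); rewrite le_eqVlt; apply/orP; left; apply/eqP; congr `|_|.
rewrite voiculescu_ratio; last exact: y0.
rewrite E sqr_inv_ci !(ReD, ReN) !Re_mulc !ReD !ImD !Re_gfun//.
rewrite inv_ci /moment_gap hornerD hornerZ hornerX /=.
by ring.
Unshelve. all: by end_near. Qed.

(** With [sigma] known, the unknown is [u = g(i y)]. At [w = F_mu(i y)] one has [phi w / w = u] and
    [1 / w = (1 + u) / (i y)], so the factor [s = 1 + u] is already polynomial. *)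
Lemma tail_equiv_sigma : regularly_varying_tail sigma (- alpha) ->
  asymp_equiv (tail mu) (tail sigma).
Proof.
move=> rv; have [p [ip g2 gy]] := exists_gauge rv alpha0.
pose N := Num.bound alpha; have aN : alpha < N%:R := archi_boundP alpha0.
pose P := (1 + 'X^2) * moment_poly sigma p + gamma *: 'X + fine (sigma D) *: 'X^2.
have P0 : P`_0 = 0.
  by rewrite -horner_coef0 !hornerE horner_coef0 moment_poly0 expr0n /= !mulr0 !addr0.
pose rr w := (1 + w^-1 ^+ 2) * gfun_rem sigma p w.
have PE y q : 0 < y -> nc (q - 1) <= 2^-1 -> 0 < Im (ci y * q) ->
    phi (ci y * q) / (ci y * q) = (toC P).[(ci y * q)^-1] + rr (ci y * q).
  move=> y0 q1 w0; rewrite voiculescu_ratio// (gfun_expansion ip)// /rr /P.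
  rewrite !rmorphD rmorphM rmorphD rmorph1 /= !map_polyZ !map_polyXn map_polyX.
  by rewrite !hornerE; ring.
pose It := iterate P (1 + 'X) N.+1.
have It0 : (P - It)`_0 = 0.
  by rewrite coefB P0; apply/eqP; rewrite subr_eq0; apply/eqP/esym; exact: iterate0.
have gap : oinf (fun y => nc (phi (ci y) / ci y - g (ci y) - (toC (P - It)).[(ci y)^-1]))
    (tail sigma).
  apply: (@oinf_near_eq _ (fun y => nc (g (ci y) - (toC It).[(ci y)^-1] - rr (ci y)))).
    near=> y; have y0 : 0 < y by near: y; exact: nbhs_pinfty_gt.
    have one : nc (1 - 1 : R[i]) <= 2^-1 by rewrite subrr nc0 invr_ge0.
    have := @PE y 1 y0 one; rewrite !mulr1 => /(_ y0) ->.
    by rewrite rmorphB /= hornerD hornerN -ncN; congr nc; ring.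
  apply: (@perturbed_oinf sigma alpha p P (1 + 'X) N (60 * 4 ^+ p) _ _
    (fun y => 1 + g (ci y)) (fun y => rr (ci y / (1 + g (ci y))))) => //.
  near=> y => E1; have y0 : 0 < y by near: y; exact: nbhs_pinfty_gt.
  have y1 : y^-1 <= 1 by near: y; exact: cvg_inv_small.
  have u1 : nc (g (ci y)) <= 2^-1 by near: y; apply: gfun_cvg0; [exact: mD|rewrite invr_gt0].
  have := near (voiculescu_left_inverse mu_phi) y.
  rewrite gfun_nonneg// => -[] // q1 u0 w0 wE.
  have [r1 r2] := weighted_rem_bounds ip y0 y1 u1 u0 q1.
  have wn : ci y / (1 + g (ci y)) != 0 by apply: Im_neq0; rewrite gt_eqF.
  split => //.
  - by rewrite ncV nc_ci.
  - by rewrite gauge_ge0.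
  - by have := ncD 1 (g (ci y)); rewrite nc1; lra.
  - have -> : (ci y)^-1 * (1 + g (ci y)) = (ci y / (1 + g (ci y)))^-1 by rewrite invfM invrK.
    rewrite -PE//.
    apply: (mulIf wn); rewrite divfK//; apply: (addrI (ci y / (1 + g (ci y)))); rewrite wE.
    by field.
  - rewrite rmorphD rmorph1 /= map_polyX !hornerE subrr nc0.
    by rewrite !mulr_ge0 ?exprn_ge0 ?nc_ge0.
have [q q0 Hq] := gap_of_expansion It0 gap.
have known k : (N <= k)%N -> Oinf (fun y => \int[sigma]_(t in D) xi y t ^+ k) (tail sigma).
  by move=> Nk; apply: xiX_Oinf_tail rv _; apply: lt_le_trans aN _; rewrite ler_nat.
have [m Hm] := xiX_int_oinf (@tail_ge0 _ sigma) (@tail_nonincreasing _ sigma) q0 Hq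
  (ex_intro _ N (or_intror known)).
apply: (@tail_asymp_of_moments _ sigma mu m _ alpha) => //.
  by move=> k /Hm[].
by have [] := Hm m (leqnn m).
Unshelve. all: by end_near. Qed.

(** With [mu] known, the unknown is [u = phi(i y) / (i y)], and the equation is
    [u = g(i y * (1 + u))]. *)
Lemma tail_equiv_mu : regularly_varying_tail mu (- alpha) ->
  asymp_equiv (tail sigma) (tail mu).
Proof.
move=> rv; have [p [ip g2 gy]] := exists_gauge rv alpha0.
pose N := Num.bound alpha; have aN : alpha < N%:R := archi_boundP alpha0.
pose P := moment_poly mu p.
have P0 : P`_0 = 0 by exact: moment_poly0.
(* The exact factor is now [1 / (1 + u)]; truncating its geometric series at order [N] leaves an
   error [(- u) ^ N / (1 + u)]. *)
pose S : {poly R} := \sum_(i < N) (- 'X) ^+ i.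
pose It := iterate P S N.+1.
have It0 : (It - P)`_0 = 0.
  by rewrite coefB [P`_0]P0; apply/eqP; rewrite subr_eq0; apply/eqP; exact: iterate0.
have C0 : 1 <= 4 ^+ p :> R by rewrite exprn_ege1// ler1n.
have gap : oinf (fun y => nc (phi (ci y) / ci y - g (ci y) - (toC (It - P)).[(ci y)^-1]))
    (tail mu).
  apply: (@oinf_near_eq _ (fun y => nc (phi (ci y) / ci y - (toC It).[(ci y)^-1] - gfun_rem mu p (ci y)))).
    near=> y; have y0 : 0 < y by near: y; exact: nbhs_pinfty_gt.
    have one : nc (1 - 1 : R[i]) <= 2^-1 by rewrite subrr nc0 invr_ge0.
    have := gfun_expansion ip y0 one; rewrite mulr1 => ->.
    by rewrite rmorphB /= hornerD hornerN; congr nc; ring.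
  apply: (@perturbed_oinf mu alpha p P S N (12 * 4 ^+ p) _ _
    (fun y => (1 + phi (ci y) / ci y)^-1) (fun y => gfun_rem mu p (ci y * (1 + phi (ci y) / ci y)))) => //.
  near=> y => E1; have y0 : 0 < y by near: y; exact: nbhs_pinfty_gt.
  have y1 : y^-1 <= 1 by near: y; exact: cvg_inv_small.
  have u1 : nc (phi (ci y) / ci y) <= 2^-1.
    by near: y; apply: voiculescu_ratio_cvg0; rewrite invr_gt0.
  have : 0 < Im (ci y + phi (ci y)) /\
      gfun setT mu (ci y + phi (ci y)) = phi (ci y) / ci y.
    by near: y; exact: voiculescu_right_inverse.
  have -> : ci y + phi (ci y) = ci y * (1 + phi (ci y) / ci y).
    by field; exact: ci_neq0.
  set u := phi (ci y) / ci y in u1 *.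
  move=> [w0]; rewrite gfun_nonneg// => uE.
  have q1 : nc (1 + u - 1) <= 2^-1 by rewrite addrC addKr.
  have qu : 2^-1 <= nc (1 + u) by have /andP[] := nc_q q1.
  have un : 1 + u != 0 by apply: nc_neq0; lra.
  split => //.
  - by rewrite ncV nc_ci.
  - by rewrite gauge_ge0.
  - by rewrite ncV -[leRHS]invrK lef_pV2 ?posrE//; lra.
  - by rewrite -invfM -(gfun_expansion ip).
  - rewrite rmorph_sum horner_sum.
    under eq_bigr do rewrite rmorphXn rmorphN /= map_polyX horner_exp hornerN hornerX.
    have := subrX1 (- u) N; set A := \sum_(i < N) _ => AE.
    have -> : (1 + u)^-1 - A = (- u) ^+ N / (1 + u).
      by rewrite -[(- u) ^+ N](subrK 1) AE; field.
    rewrite ncM ncX ncN ncV mulrC ler_wpM2r ?exprn_ge0 ?nc_ge0//.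
    apply: (@le_trans _ _ 2); last lra.
    by rewrite -[leRHS]invrK lef_pV2 ?posrE//; lra.
  - apply: le_trans (nc_rem_le ip y0 q1) _; rewrite ler_wpM2r ?gauge_ge0//.
    have : 2 ^+ p <= 4 ^+ p :> R by rewrite lerXn2r ?nnegrE ?ler_nat.
    by rewrite !exprS; lra.
  - apply: le_trans (nc_remB_le ip y0 q1) _; rewrite [1 + u]addrC addrK.
    by rewrite mulrAC.
have [q q0 Hq] := gap_of_expansion It0 gap.
have known k : (N <= k)%N -> Oinf (fun y => \int[mu]_(t in D) xi y t ^+ k) (tail mu).
  by move=> Nk; apply: xiX_Oinf_tail rv _; apply: lt_le_trans aN _; rewrite ler_nat.
have [m Hm] := xiX_int_oinf (@tail_ge0 _ mu) (@tail_nonincreasing _ mu) q0 Hq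
  (ex_intro _ N (or_introl known)).
apply: (@tail_asymp_of_moments _ mu sigma m _ alpha) => //.
  move=> k /Hm[_ _ /(oinfZ (-1))]; apply: oinf_ext => y; ring.
by have [] := Hm m (leqnn m).
Unshelve. all: by end_near. Qed.

End Comparison.
End Assembly.

Theorem theorem3p1 (R : realType) (mu : probability (measurableTypeR R) R)
    (phi : R[i] -> R[i]) (gamma : R)
    (sigma : {finite_measure set (measurableTypeR R) -> \bar R}) (alpha : R)
    (mu_free_regular : free_regular mu)
    (phi_mu : voiculescu_transform mu phi)
    (phiE : forall z : R[i], upper_half z ->
       phi z = gamma%:C +
         cintegral sigma (@Rnonneg R)
           (fun t => (1 + t%:C * z) / (z - t%:C)))
    (concentrated : concentrated_on_nonneg mu \/ concentrated_on_nonneg sigma)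
    (alpha_ge0 : 0 <= alpha) :
  (regularly_varying_tail mu (- alpha) <->
     regularly_varying_tail sigma (- alpha)) /\
  (regularly_varying_tail mu (- alpha) \/
     regularly_varying_tail sigma (- alpha) ->
   asymp_equiv (tail mu) (tail sigma)).
Proof.
have mu0 := free_regular_nonneg mu_free_regular.
have eqS := tail_equiv_sigma mu0 phi_mu phiE alpha_ge0.
have eqM := tail_equiv_mu mu0 phi_mu phiE alpha_ge0.
split; [split|] => [rv|rv|[rv|rv]].
- exact: regularly_varying_equiv (measurable_tail sigma) (eqM rv) rv.
- exact: regularly_varying_equiv (measurable_tail mu) (eqS rv) rv.
- exact: asymp_equiv_sym (eqM rv).
- exact: eqS.
Qed.
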